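(* Let $E$ be the extension operator $Eg(x)=\sum_{Q\in\mathcal W}\varphi_Q(x)\,y_Q$, $x\in\Omega$, with $y_Q=\frac1{\sigma(B_Q)}\int_{B_Q}g\,d\sigma$, associated to the Whitney cubes $\mathcal W$ of $\Omega$ as described in the context. For every $g\in L^1_{loc}(\Gamma,\sigma)$, $$T(Eg)=g\qquad\sigma\text{-a.e. in }\Gamma .$$ Moreover, $H\subset L^1_{loc}(\Gamma,\sigma)$ and there exists $C>0$ such that for every $g\in H$, $$\|Eg\|_W\le C\|g\|_H .$$
   Context: Let $n\ge2$ and let $0<d<n-1$ be a real number. $\Gamma\subset\mathbb R^n$ is a nonempty closed set which is Ahlfors regular of dimension $d$: there is $C_0\ge1$ with $C_0^{-1}r^d\le\mathcal H^d(\Gamma\cap B(x,r))\le C_0r^d$ for all $x\in\Gamma$, $r>0$. Set $\Omega=\mathbb R^n\setminus\Gamma$, $\sigma=\mathcal H^d|_\Gamma$, $\delta(z)=\operatorname{dist}(z,\Gamma)$ and $w(z)=\delta(z)^{d+1-n}$. $W=\{u\in L^1_{loc}(\Omega):\nabla u\in L^2(\Omega,w)\}$, where $\nabla u$ is the distributional gradient in $\Omega$ and $L^2(\Omega,w)=L^2(\Omega,w\,dz)$; $\|u\|_W=\big(\int_\Omega|\nabla u|^2w\,dz\big)^{1/2}$. $H$ is the space of measurable functions $g$ on $\Gamma$ with $\|g\|_H^2=\int_\Gamma\int_\Gamma\frac{|g(x)-g(y)|^2}{|x-y|^{d+1}}\,d\sigma(x)\,d\sigma(y)<\infty$. Trace: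 $Tu(x)=\lim_{r\to0}\frac1{|B(x,r)|}\int_{B(x,r)}u(y)\,dy$ for $x\in\Gamma$, whenever the limit exists ($\Gamma$ is Lebesgue-null). Whitney cubes: $\mathcal W$ is the family of maximal (for inclusion) dyadic cubes $Q$ such that $20Q\subset\Omega$ ($\lambda Q$ is the concentric cube dilated by $\lambda$). $\{\varphi_Q\}_{Q\in\mathcal W}$ is a smooth partition of unity with $\varphi_Q$ supported in $2Q$, $0\le\varphi_Q\le1$, $|\nabla\varphi_Q|\le C\operatorname{diam}(Q)^{-1}$ with $C$ independent of $Q$, and $\sum_Q\varphi_Q=\mathbf 1_\Omega$. For $Q\in\mathcal W$, $\delta(Q)=\operatorname{dist}(Q,\Gamma)$, a point $\xi_Q\in\Gamma$ is chosen such that $\operatorname{dist}(\xi_Q,Q)\le2\delta(Q)$, and $B_Q=B(\xi_Q,\delta(Q))$; integrals over $B_Q$ with respect to $\sigma$ are over $\Gamma\cap B_Q$. *)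

(* Defs.v *)
(* Points of R^n are row vectors 'rV[R]_n.  The norm that the library puts on
   'rV[R]_n is the sup norm: it is used for the topology and for
   differentiability only.  Distances, balls and diameters are Euclidean. *)
From HB Require Import structures.
From mathcomp Require Import all_boot all_order all_algebra.
From mathcomp Require Import all_classical all_reals all_analysis.

Set Implicit Arguments.
Unset Strict Implicit.
Unset Printing Implicit Defensive.

Import Order.TTheory GRing.Theory Num.Theory.
Import numFieldNormedType.Exports.

Local Open Scope classical_set_scope.
Local Open Scope ring_scope.

Section Euclidean.
Context {R : realType} {n : nat}.
Implicit Types (x y : 'rV[R]_n) (A B : set 'rV[R]_n).

Definition enorm x : R := Num.sqrt (\sum_(i < n) x ord0 i ^+ 2).

Definition eball x (r : R) : set 'rV[R]_n := [set y | enorm (y - x) < r].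

Definition dist_pt x A : R := inf [set enorm (x - y) | y in A].

Definition dist_set A B : R := inf [set enorm (p.1 - p.2) | p in A `*` B].

Definition ediam A : \bar R :=
  ereal_sup [set (enorm (p.1 - p.2))%:E | p in A `*` A].

Definition diam A : R := fine (ediam A).

End Euclidean.

Section CoverOuter.
Local Open Scope ereal_scope.
Context {R : realType} {T I : Type}.

(* S i is the set with index i and tau i its weight.  The index None stands for
   the empty set with weight 0, so that finite covers are allowed as well. *)
Definition countable_covers (P : set I) (S : I -> set T) (X : set T) :
    set (nat -> option I) :=
  [set F | (forall k i, F k = Some i -> P i) /\
           X `<=` \bigcup_k oapp S set0 (F k)].

Definition cover_outer (P : set I) (S : I -> set T) (tau : I -> \bar R)
    (X : set T) : \bar R :=
  ereal_inf [set \sum_(k <oo) oapp tau 0 (F k) | F in countable_covers P S X].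

Variables (P : set I) (S : I -> set T) (tau : I -> \bar R).
Hypothesis tau_ge0 : forall i, 0 <= tau i.

Let w (o : option I) : \bar R := oapp tau 0 o.

Let w_ge0 o : 0 <= w o.
Proof. by case: o => [i|]; [exact: tau_ge0|exact: lexx]. Qed.

Lemma cover_outer_ge0 X : 0 <= cover_outer P S tau X.
Proof.
apply: le_ereal_inf_tmp => x [F _ <-].
by apply: nneseries_ge0 => k _ _; exact: w_ge0.
Qed.

Lemma cover_outer0 : cover_outer P S tau set0 = 0.
Proof.
apply/eqP; rewrite eq_le cover_outer_ge0 andbT.
apply: ereal_inf_lbound; exists (fun=> None); first by split.
by rewrite eseries0.
Qed.

Lemma le_cover_outer :
  {homo (cover_outer P S tau) : A B / A `<=` B >-> A <= B}.
Proof.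
move=> A B AB; apply/ereal_inf_le_tmp => x [F [FP BF] <-].
by exists F => //; split=> //; exact: subset_trans BF.
Qed.

Lemma cover_outer_sigma_subadditive : sigma_subadditive (cover_outer P S tau).
Proof.
move=> A; have [[i ioo]|] := pselect (exists i, cover_outer P S tau (A i) = +oo).
  rewrite (eseries_pinfty _ _ ioo) ?leey// => k _.
  by rewrite -ltNye (lt_le_trans _ (cover_outer_ge0 _)).
rewrite -forallNE => Aoo.
suff add2e (e : {posnum R}) : cover_outer P S tau (\bigcup_n A n) <=
    \sum_(i <oo) cover_outer P S tau (A i) + e%:num%:E.
  by apply/lee_addgt0Pr => _/posnumP[].
rewrite (le_trans _ (epsilon_trick _ _ _))//; last first.
  by move=> k; exact: cover_outer_ge0.
pose Q k (F : nat -> option I) := countable_covers P S (A k) F /\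
  \sum_(j <oo) w (F j) <=
    cover_outer P S tau (A k) + (e%:num / (2 ^ k.+1)%:R)%:E.
have [G QG] : {G : nat -> nat -> option I & forall k, Q k (G k)}.
  apply: (@choice _ _ Q) => k; rewrite /Q /cover_outer.
  set U := (X in ereal_inf X); move infU : (ereal_inf U) => iU.
  case: iU infU => [r Ur|Uoo|Uoo].
  - have en1 : (0 < e%:num / (2 ^ k.+1)%:R)%R by [].
    have /(lb_ereal_inf_adherent en1) : ereal_inf U \is a fin_num by rewrite Ur.
    move=> [x [F cF <-] xU].
    by exists F; split => //; rewrite -Ur; exact/ltW.
  - by have := Aoo k; rewrite /cover_outer Uoo.
  - have := cover_outer_ge0 (A k).
    by rewrite /cover_outer Uoo leNgt ltNye.
have muG_ge0 x : 0 <= (w \o uncurry G) x by exact: w_ge0.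
apply: (@le_trans _ _ (\esum_(i in setT) (w \o uncurry G) i)).
  apply: ereal_inf_lbound => /=.
  have /card_esym/ppcard_eqP[f] := card_nat2.
  exists (uncurry G \o f).
    split=> [k i /=|].
      by rewrite /uncurry; case: (f k) => a b /=; exact: (QG a).1.1.
    move=> t [k _ /((QG k).1.2)] [j _ Gt].
    by exists (f^-1%FUN (k, j)) => //=; rewrite invK ?inE.
  rewrite -(esum_pred_image (w \o uncurry G) _ xpredT) ?[fun=> _]set_true//.
  by rewrite image_eq.
rewrite (_ : esum _ _ = \sum_(i <oo) \sum_(j <oo ) w (G i j)); last first.
  pose J : nat -> set (nat * nat) := fun i => [set (i, j) | j in setT].
  rewrite (_ : setT = \bigcup_k J k); last first.
    by rewrite predeqE => -[a b]; split => // _; exists a => //; exists b.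
  rewrite esum_bigcupT /=; last 2 first.
    - apply/trivIsetP => i j _ _ ij.
      rewrite predeqE => -[a m] /=; split => //= -[] [_] _ [<-{a} _].
      by move=> [m' _] [] /esym/eqP; rewrite (negbTE ij).
    - by move=> /= x; exact: w_ge0.
  rewrite -(image_id [set: nat]) -fun_true esum_pred_image//; last first.
    by move=> k _; exact: esum_ge0.
  apply: eq_eseriesr => /= j _.
  rewrite -(esum_pred_image (w \o uncurry G) (pair j) predT)//=; last first.
    by move=> ? ? _ _; exact: (@can_inj _ _ _ snd).
  by congr esum; rewrite predeqE => -[a b]; split; move=> [i _ <-]; exists i.
apply: lee_lim.
- apply: is_cvg_nneseries => k *.
  by apply: nneseries_ge0 => m *; exact: (muG_ge0 (k, m)).
- by apply: is_cvg_nneseries => k *; apply: adde_ge0 => //; exact: cover_outer_ge0.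
- by near=> k; apply: lee_sum => i _; exact: (QG i).2.
Unshelve. all: by end_near. Qed.

End CoverOuter.

Section Measures.
Local Open Scope ereal_scope.
Context (R : realType) (n : nat).

Definition box (ab : 'rV[R]_n * 'rV[R]_n) : set 'rV[R]_n :=
  [set x | forall i, (ab.1 ord0 i <= x ord0 i <= ab.2 ord0 i)%R].

Definition box_vol (ab : 'rV[R]_n * 'rV[R]_n) : \bar R :=
  (\prod_(i < n) Num.max 0 (ab.2 ord0 i - ab.1 ord0 i)%R)%R%:E.

Definition lebesgue : set 'rV[R]_n -> \bar R := cover_outer setT box box_vol.

Lemma box_vol_ge0 ab : 0 <= box_vol ab.
Proof. by rewrite lee_fin prodr_ge0// => i _; rewrite le_max lexx. Qed.

HB.instance Definition _ := isOuterMeasure.Build R 'rV[R]_n lebesgue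
  (cover_outer0 setT box box_vol_ge0) (cover_outer_ge0 setT box box_vol_ge0)
  (@le_cover_outer _ _ _ setT box box_vol)
  (cover_outer_sigma_subadditive setT box box_vol_ge0).

Definition hausdorff_content (d e : R) : set 'rV[R]_n -> \bar R :=
  cover_outer [set A | ediam A <= e%:E] id (fun A => ediam A `^ d).

(* No normalizing constant: H^d(A) = lim_(e -> 0) inf \sum_k diam(A_k)^d. *)
Definition hausdorff (d : R) (A : set 'rV[R]_n) : \bar R :=
  ereal_sup [set hausdorff_content d e A | e in [set e | (0 < e)%R]].

Section hausdorff_outer.
Variable d : R.

Let tau_ge0 (A : set 'rV[R]_n) : 0 <= ediam A `^ d.
Proof. exact: poweR_ge0. Qed.

Lemma hausdorff_ge0 A : 0 <= hausdorff d A.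
Proof.
apply: (@le_trans _ _ (hausdorff_content d 1 A)); first exact: cover_outer_ge0.
by apply: ereal_sup_ubound; exists 1%R => //=.
Qed.

Lemma hausdorff0 : hausdorff d set0 = 0.
Proof.
apply/eqP; rewrite eq_le hausdorff_ge0 andbT.
by apply: ge_ereal_sup => _ [e _ <-]; rewrite /hausdorff_content cover_outer0.
Qed.

Lemma le_hausdorff : {homo (hausdorff d) : A B / A `<=` B >-> A <= B}.
Proof.
move=> A B AB; apply: ge_ereal_sup => _ [e e0 <-].
apply: (@le_trans _ _ (hausdorff_content d e B)); first exact: le_cover_outer.
by apply: ereal_sup_ubound; exists e.
Qed.

Lemma hausdorff_sigma_subadditive : sigma_subadditive (hausdorff d).
Proof.
move=> F; apply: ge_ereal_sup => _ [e e0 <-].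
apply: le_trans (cover_outer_sigma_subadditive _ _ _ _) _ => //.
apply: lee_nneseries => k _; first by move=> _; exact: cover_outer_ge0.
by apply: ereal_sup_ubound; exists e.
Qed.

HB.instance Definition _ := isOuterMeasure.Build R 'rV[R]_n (hausdorff d)
  hausdorff0 hausdorff_ge0 le_hausdorff hausdorff_sigma_subadditive.

End hausdorff_outer.

End Measures.

(* The (complete) measure on the sigma-algebra of Caratheodory measurable sets:
   Lebesgue measure and H^d are obtained from their outer measures this way. *)
Definition cara_measure (R : realType) (T : pointedType)
    (mu : {outer_measure set T -> \bar R}) :
    {measure set (caratheodory_type mu) -> \bar R} :=
  (mu : set (caratheodory_type mu) -> \bar R).

Definition leb (R : realType) (n : nat) := cara_measure (@lebesgue R n).

Definition hausd (R : realType) (n : nat) (d : R) :=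
  cara_measure (@hausdorff R n d).

Section FunctionSpaces.
Context {R : realType} {n : nat}.
Implicit Types (Gamma Omega : set 'rV[R]_n) (u g : 'rV[R]_n -> R).

Definition L1loc (mu : {outer_measure set 'rV[R]_n -> \bar R})
    (D : set 'rV[R]_n) (f : 'rV[R]_n -> R) : Prop :=
  measurable_fun (D : set (caratheodory_type mu)) f /\
  forall K : set 'rV[R]_n, compact K -> K `<=` D ->
    (cara_measure mu).-integrable K (EFin \o f).

Definition partial (i : 'I_n) u : 'rV[R]_n -> R :=
  fun x => 'D_(delta_mx ord0 i) u x.

Definition grad u (x : 'rV[R]_n) : 'rV[R]_n := \row_i partial i u x.

(* C^oo: all the iterated partial derivatives are differentiable everywhere. *)
Definition smooth u : Prop :=
  forall (s : seq 'I_n) x, differentiable (foldr partial u s) x.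

Definition test_function Omega u : Prop :=
  [/\ smooth u, compact (closure [set x | u x != 0]) &
      closure [set x | u x != 0] `<=` Omega].

Definition is_weak_grad Omega u (G : 'rV[R]_n -> 'rV[R]_n) : Prop :=
  (forall i, L1loc (@lebesgue R n) Omega (fun x => G x ord0 i)) /\
  forall phi, test_function Omega phi -> forall i,
    \int[leb R n]_(x in Omega) (u x * partial i phi x) =
    - \int[leb R n]_(x in Omega) (G x ord0 i * phi x).

Definition ahlfors_regular (d : R) Gamma : Prop :=
  exists2 C0 : R, 1 <= C0 &
    forall x r, Gamma x -> 0 < r ->
      ((C0^-1 * r `^ d)%:E <= hausd n d (Gamma `&` eball x r) <=
       (C0 * r `^ d)%:E)%E.

Variables (d : R) (Gamma : set 'rV[R]_n).

Definition weight (z : 'rV[R]_n) : R := dist_pt z Gamma `^ (d + 1 - n%:R).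

Definition energy (G : 'rV[R]_n -> 'rV[R]_n) : \bar R :=
  (\int[leb R n]_(z in ~` Gamma) (enorm (G z) ^+ 2 * weight z)%:E)%E.

Definition W_space : set ('rV[R]_n -> R) :=
  [set u | L1loc (@lebesgue R n) (~` Gamma) u /\
           exists2 G, is_weak_grad (~` Gamma) u G & (energy G < +oo)%E].

(* The distributional gradient is unique up to null sets, so that the infimum is
   over a single value if it exists (and it is +oo otherwise). *)
Definition W_norm u : \bar R :=
  ereal_inf [set (energy G `^ 2^-1)%E | G in is_weak_grad (~` Gamma) u].

Definition H_norm g : \bar R :=
  ((\int[hausd n d]_(x in Gamma) \int[hausd n d]_(y in Gamma)
     ((g x - g y) ^+ 2 / enorm (x - y) `^ (d + 1))%:E) `^ 2^-1)%E.

Definition H_space : set ('rV[R]_n -> R) :=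
  [set g | measurable_fun (Gamma : set (caratheodory_type (@hausdorff R n d))) g
           /\ (H_norm g < +oo)%E].

(* u matters on the complement of Gamma only, Gamma being Lebesgue-null. *)
Definition ball_avg u (x : 'rV[R]_n) (r : R) : R :=
  (fine (leb R n (eball x r)))^-1 *
  \int[leb R n]_(y in eball x r `&` ~` Gamma) u y.

Definition trace u (x : 'rV[R]_n) : R := lim (ball_avg u x r @[r --> 0^'+]).

(* The integrability is what gives the real-valued integrals a meaning. *)
Definition trace_exists u (x : 'rV[R]_n) : Prop :=
  (\forall r \near 0^'+,
     (leb R n).-integrable (eball x r `&` ~` Gamma) (EFin \o u)) /\
  cvg (ball_avg u x r @[r --> 0^'+]).

End FunctionSpaces.

Section Whitney.
Context {R : realType} {n : nat}.

(* (k, m) stands for the closed cube \prod_i [m_i 2^k, (m_i + 1) 2^k]. *)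
Definition dyadic : Type := (int * 'rV[int]_n)%type.
HB.instance Definition _ := Choice.on dyadic.

Implicit Types (Q : dyadic) (Gamma : set 'rV[R]_n).

Definition side Q : R := 2 ^ Q.1.

Definition cube Q : set 'rV[R]_n :=
  [set x | forall i, (Q.2 ord0 i)%:~R * side Q <= x ord0 i
                     <= ((Q.2 ord0 i)%:~R + 1) * side Q].

Definition center Q : 'rV[R]_n :=
  \row_i (((Q.2 ord0 i)%:~R + 2^-1) * side Q).

Definition dilate (lambda : R) Q : set 'rV[R]_n :=
  [set center Q + lambda *: (x - center Q) | x in cube Q].

Definition whitney Gamma : set dyadic :=
  [set Q | dilate 20 Q `<=` ~` Gamma /\
     forall Q', dilate 20 Q' `<=` ~` Gamma -> cube Q `<=` cube Q' ->
       cube Q' = cube Q].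

Definition whitney_partition Gamma (phi : dyadic -> 'rV[R]_n -> R) : Prop :=
  [/\ forall Q, whitney Gamma Q ->
        [/\ smooth (phi Q),
            closure [set x | phi Q x != 0] `<=` dilate 2 Q &
            forall x, 0 <= phi Q x <= 1],
      exists C : R, forall Q x, whitney Gamma Q ->
        enorm (grad (phi Q) x) <= C / diam (cube Q) &
      forall x, \sum_(Q \in whitney Gamma) phi Q x = \1_(~` Gamma) x].

Definition whitney_points Gamma (xi : dyadic -> 'rV[R]_n) : Prop :=
  forall Q, whitney Gamma Q ->
    Gamma (xi Q) /\
    dist_pt (xi Q) (cube Q) <= 2 * dist_set (cube Q) Gamma.

Variables (d : R) (Gamma : set 'rV[R]_n).
Variables (phi : dyadic -> 'rV[R]_n -> R) (xi : dyadic -> 'rV[R]_n).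

Definition whitney_avg (g : 'rV[R]_n -> R) Q : R :=
  let D := Gamma `&` eball (xi Q) (dist_set (cube Q) Gamma) in
  (fine (hausd n d D))^-1 * \int[hausd n d]_(y in D) g y.

(* The sum is over a finite set of cubes at each point: 2Q contains x for
   finitely many Whitney cubes Q only. *)
Definition extension (g : 'rV[R]_n -> R) (x : 'rV[R]_n) : R :=
  \sum_(Q \in whitney Gamma) phi Q x * whitney_avg g Q.

End Whitney.

(* Main.v *)
(* Let Q be a Whitney cube of side l.  Near 2Q only boundedly many Whitney cubes
   count, all of side comparable to l, and since the phi_Q add up to 1 one may
   subtract any constant from the averages y_Q without changing grad(Eg).

   Energy: |grad(Eg)| <= C l^-1 max |y_Q' - y_Q| on 2Q, the maximum being over
   the neighbours Q' of Q, and Jensen's inequality bounds (y_Q' - y_Q)^2 by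
   C l^(-2d) times the integral of |g(x) - g(y)|^2 over D_Q x D_Q, where D_Q is
   the part of Gamma in a ball of radius comparable to l around Q.  As w is of
   size l^(d+1-n) on 2Q, summing over Q leaves, for x <> y, the sum of the
   l^(-1-d) over the cubes with x and y in D_Q.  There l >= c |x - y|, and there
   are boundedly many cubes of each side, so the sum is at most C |x-y|^(-1-d).
   The exchange of sum and integrals only needs that lower integrals are
   superadditive, so that measurability on the product never comes up.

   Trace: by the same counting, the integral of |Eg - g(x)| over B(x, r) is at
   most C r^(n-d) times the integral of |g - g(x)| over the part of Gamma in
   B(x, K r), which is o(r^n) at the Lebesgue points x of g.  Almost every x is
   one, by Vitali's covering lemma and the outer regularity of H^d applied to
   |g - q| with q rational.

   Eg is C^1 off Gamma.  That its classical gradient is the weak one follows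
   from the translation invariance of Lebesgue measure, applied to difference
   quotients of the product with a test function. *)
Require Import Defs.
From mathcomp Require Import all_boot all_order all_algebra.
From mathcomp Require Import all_classical all_reals all_analysis.
From mathcomp Require Import measurable_realfun lra ring.

Set Implicit Arguments.
Unset Strict Implicit.
Unset Printing Implicit Defensive.

(* MathComp-Analysis has a [center] too. *)
Import Defs.
Import Order.TTheory GRing.Theory Num.Theory.
Import numFieldNormedType.Exports.

Local Open Scope classical_set_scope.
Local Open Scope ring_scope.

(** * Euclidean distance *)

(** Both measures are given by covers and Carathéodory's construction, so measurability of open
    sets, the lower bound for the volume of a box, translation invariance and the outer regularity
    of H^d all have to be extracted from covers. Bounds over infinitely many cubes are stated for
    arbitrary duplicate-free lists of cubes. The sums are then finite, so that finite
    superadditivity of lower integrals suffices, and the passage to infinitely many cubes is made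
    once, in [dyadic_integral_le]. The series that both estimates need is the sum of l^b over cubes,
    with b = -(d + 1) for the energy and b = n - d for the trace. The signs differ: in the first
    case the smallest cubes dominate and |x - y| bounds their side from below, in the second the
    largest ones dominate and r bounds their side from above. [sum_side] treats both at once, since
    only b <> 0 matters for convergence. Sup-norm balls are cubes, whereas the theorem speaks of
    Euclidean distances; the powers of n in the constants come from comparing the two norms. *)

Section EuclideanNorm.
Context {R : realType} {n : nat}.
Implicit Types (x y z : 'rV[R]_n) (A : set 'rV[R]_n).

Lemma enorm_ge0 x : 0 <= enorm x.
Proof. exact: sqrtr_ge0. Qed.

Lemma sqr_enorm x : enorm x ^+ 2 = \sum_(i < n) x ord0 i ^+ 2.
Proof. by rewrite sqr_sqrtr// sumr_ge0// => i _; exact: sqr_ge0. Qed.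

Lemma enorm_le_sum x (c : R) :
  0 <= c -> \sum_(i < n) x ord0 i ^+ 2 <= c ^+ 2 -> enorm x <= c.
Proof. by move=> c0; rewrite -sqr_enorm ler_pXn2r ?nnegrE ?enorm_ge0. Qed.

Lemma norm_coord_le_enorm x i : `|x ord0 i| <= enorm x.
Proof.
rewrite -(@ler_pXn2r _ 2)// ?nnegrE ?enorm_ge0//.
rewrite sqr_enorm real_normK ?num_real// (bigD1 i)//= lerDl sumr_ge0// => j _.
exact: sqr_ge0.
Qed.

Lemma norm_rVP x (c : R) : 0 <= c ->
  (forall i, `|x ord0 i| <= c) <-> `|x| <= c.
Proof.
move=> c0; rewrite /Num.norm/= mx_normrE; split=> [h|/bigmax_leP[_ h] i].
  by apply/bigmax_leP; split => // -[a b] _ /=; rewrite (ord1 a); exact: h.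
exact: (h (ord0, i)).
Qed.

Lemma norm_rV_ltP x (c : R) : 0 < c ->
  (forall i, `|x ord0 i| < c) <-> `|x| < c.
Proof.
move=> c0; rewrite /Num.norm/= mx_normrE; split=> [h|/bigmax_ltP[_ h] i].
  by apply/bigmax_ltP; split => // -[a b] _ /=; rewrite (ord1 a); exact: h.
exact: (h (ord0, i)).
Qed.

Lemma norm_coord_le x i : `|x ord0 i| <= `|x|.
Proof. exact: (norm_rVP x (normr_ge0 x)).2. Qed.

Lemma norm_le_enorm x : `|x| <= enorm x.
Proof.
by apply/(norm_rVP _ (enorm_ge0 _)) => i; exact: norm_coord_le_enorm.
Qed.

(** The sharp constant is sqrt n; since n <= n^2, the cruder n avoids a root in every later
    constant. *)
Lemma enorm_le_norm x : enorm x <= n%:R * `|x|.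
Proof.
apply: enorm_le_sum; first by rewrite mulr_ge0.
have h i : x ord0 i ^+ 2 <= `|x| ^+ 2.
  by rewrite -[_ ^+ 2]real_normK ?num_real// ler_pXn2r ?nnegrE// norm_coord_le.
apply: le_trans (ler_sum _ (fun i _ => h i)) _.
rewrite sumr_const card_ord -[leLHS]mulr_natl exprMn ler_wpM2r ?sqr_ge0//.
by rewrite -natrX ler_nat; case: (n) => // m; rewrite expnS leq_pmulr ?expn_gt0.
Qed.

Lemma enorm0 : enorm (0 : 'rV[R]_n) = 0.
Proof.
by apply/eqP; rewrite eq_le enorm_ge0 andbT (le_trans (enorm_le_norm _))// normr0 mulr0.
Qed.

Lemma enorm_eq0 x : enorm x = 0 -> x = 0.
Proof.
by move=> x0; apply/normr0_eq0/eqP; rewrite eq_le normr_ge0 -x0 norm_le_enorm.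
Qed.

Lemma enormN x : enorm (- x) = enorm x.
Proof. by congr Num.sqrt; apply: eq_bigr => i _; rewrite mxE sqrrN. Qed.

Lemma enorm_distC x y : enorm (x - y) = enorm (y - x).
Proof. by rewrite -enormN opprB. Qed.

(** Instead of Cauchy-Schwarz: (a + b)^2 <= (1 + t) a^2 + (1 + 1/t) b^2 in each coordinate, with t =
    |y| / |x|, for which the sum of the right-hand sides is exactly (|x| + |y|)^2. *)
Lemma ler_enormD x y : enorm (x + y) <= enorm x + enorm y.
Proof.
have [/enorm_eq0->|x0] := eqVneq (enorm x) 0; first by rewrite enorm0 !add0r.
have [/enorm_eq0->|y0] := eqVneq (enorm y) 0; first by rewrite enorm0 !addr0.
have {}x0 : 0 < enorm x by rewrite lt_neqAle eq_sym x0 enorm_ge0.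
have {}y0 : 0 < enorm y by rewrite lt_neqAle eq_sym y0 enorm_ge0.
apply: enorm_le_sum; first by rewrite addr_ge0 ?enorm_ge0.
pose t := enorm y / enorm x; have t0 : 0 < t by rewrite divr_gt0.
have h i : (x + y) ord0 i ^+ 2 <=
    (1 + t) * x ord0 i ^+ 2 + (1 + t^-1) * y ord0 i ^+ 2.
  rewrite mxE -subr_ge0.
  have -> : (1 + t) * x ord0 i ^+ 2 + (1 + t^-1) * y ord0 i ^+ 2 -
    (x ord0 i + y ord0 i) ^+ 2 = t^-1 * (t * x ord0 i - y ord0 i) ^+ 2.
    by field; rewrite gt_eqF.
  by rewrite mulr_ge0 ?sqr_ge0// invr_ge0 ltW.
apply: le_trans (ler_sum _ (fun i _ => h i)) _.
rewrite big_split/= -!mulr_sumr -!sqr_enorm le_eqVlt; apply/orP; left.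
by apply/eqP; rewrite /t; field; rewrite !gt_eqF.
Qed.

Lemma ler_enorm_distD z x y : enorm (x - y) <= enorm (x - z) + enorm (z - y).
Proof. by apply: le_trans (ler_enormD _ _); rewrite addrA subrK. Qed.

Lemma enorm_lipschitz x y : `|enorm x - enorm y| <= enorm (x - y).
Proof.
rewrite ler_norml lerNl opprB !lerBlDr; apply/andP; split.
  by rewrite enorm_distC -{1}(subrK x y) ler_enormD.
by rewrite -{1}(subrK y x) ler_enormD.
Qed.

Lemma continuous_enorm_lipschitz (f : 'rV[R]_n -> R) :
  (forall x y, `|f x - f y| <= enorm (x - y)) -> continuous f.
Proof.
move=> lf x; apply: (@cvgrPdist_lt R R^o _ (nbhs x) _ f (f x)).2 => e e0.
have e' : 0 < e / n.+1%:R by rewrite divr_gt0.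
apply/nbhs_ballP; exists (e / n.+1%:R) => //= y; rewrite -ball_normE/=.
rewrite ltr_pdivlMr// mulrC => h; rewrite (le_lt_trans (lf _ _))//.
by rewrite (le_lt_trans (enorm_le_norm _))// (le_lt_trans _ h)// ler_wpM2r// ler_nat.
Qed.

Lemma eball_sub_ball x (r : R) : eball x r `<=` ball x r.
Proof.
move=> y; rewrite /eball/= -ball_normE/= => h.
by rewrite distrC (le_lt_trans (norm_le_enorm _)).
Qed.

(** With [n.+1] in place of [n] the inequality stays strict in dimension 0 too. *)
Lemma ball_sub_eball x (r : R) : ball x r `<=` eball x (n.+1%:R * r).
Proof.
move=> y; rewrite /eball/= -ball_normE/= => h.
rewrite (le_lt_trans (enorm_le_norm _))// distrC.
by rewrite (@le_lt_trans _ _ (n.+1%:R * `|x - y|))// ?ler_wpM2r ?ler_nat ?ltr_pM2l.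
Qed.

Lemma open_eball x (r : R) : open (eball x r).
Proof.
have -> : eball x r = (fun y => enorm (y - x)) @^-1` [set t | t < r] by [].
apply: open_comp; last exact: open_lt.
move=> y _; apply: continuous_enorm_lipschitz => a b.
by rewrite (le_trans (enorm_lipschitz _ _))// opprB addrA subrK.
Qed.

Lemma eball_center x (r : R) : 0 < r -> eball x r x.
Proof. by move=> r0; rewrite /eball/= subrr enorm0. Qed.

Lemma dist_pt_has_lbound x A : has_lbound [set enorm (x - y) | y in A].
Proof. by exists 0 => _ [y _ <-]; exact: enorm_ge0. Qed.

Lemma dist_pt_le x y A : A y -> dist_pt x A <= enorm (x - y).
Proof. by move=> Ay; apply: ge_inf; [exact: dist_pt_has_lbound|exists y]. Qed.

Lemma le_dist_pt x A (c : R) : A !=set0 ->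
  (forall y, A y -> c <= enorm (x - y)) -> c <= dist_pt x A.
Proof.
move=> [a Aa] h; apply: lb_le_inf; first by exists (enorm (x - a)), a.
by move=> _ [y Ay <-]; exact: h.
Qed.

Lemma dist_pt_adherent x A (e : R) : A !=set0 -> 0 < e ->
  exists2 y, A y & enorm (x - y) < dist_pt x A + e.
Proof.
move=> [a Aa] e0.
have [|_ [y Ay <-] h] := inf_adherent (E := [set enorm (x - y) | y in A]) e0.
  by split; [exists (enorm (x - a)), a|exact: dist_pt_has_lbound].
by exists y.
Qed.

Lemma dist_pt_lipschitz A x y : A !=set0 ->
  `|dist_pt x A - dist_pt y A| <= enorm (x - y).
Proof.
move=> A0; have h u v : dist_pt u A - enorm (u - v) <= dist_pt v A.
  apply: le_dist_pt => // a Aa; rewrite lerBlDl.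
  exact: le_trans (dist_pt_le _ Aa) (ler_enorm_distD _ _ _).
have h1 := h x y; have h2 := h y x; rewrite enorm_distC in h2.
by rewrite ler_norml; apply/andP; split; lra.
Qed.

Lemma dist_pt_gt0 x A : A !=set0 -> closed A -> ~ A x -> 0 < dist_pt x A.
Proof.
move=> A0 cA Ax; have : open (~` A) by rewrite openC.
rewrite openE => /(_ x Ax) /nbhs_ballP[e/= e0 he].
rewrite (lt_le_trans e0)//; apply: le_dist_pt => // y Ay.
rewrite leNgt; apply/negP => h; apply: (he y) => //.
by apply: eball_sub_ball; rewrite /eball/= enorm_distC.
Qed.

Lemma compact_norm_lt (K : set 'rV[R]_n) : compact K ->
  exists a : R, forall x, K x -> `|x| < a.
Proof.
move=> cK; have [M [_ hM]] := compact_bounded cK; exists (`|M| + 2) => x Kx.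
have h1 : M < `|M| + 1 by rewrite ltr_pwDr// ler_norm.
by apply: le_lt_trans (hM _ h1 x Kx) _; rewrite ltrD2l ltr1n.
Qed.

End EuclideanNorm.

(** * Lebesgue measure *)

Section CoverOuterLemmas.
Local Open Scope ereal_scope.
Context {R : realType} {T I : Type}.
Variables (P : set I) (S : I -> set T) (tau : I -> \bar R).
Hypothesis tau_ge0 : forall i, 0 <= tau i.

Lemma oapp_ge0 (o : option I) : 0 <= oapp tau 0 o.
Proof. by case: o. Qed.

Lemma le_cover_outer_sum (F : nat -> option I) (X : set T) :
  countable_covers P S X F -> cover_outer P S tau X <= \sum_(k <oo) oapp tau 0 (F k).
Proof. by move=> FX; apply: ereal_inf_lbound; exists F. Qed.

Lemma cover_outer_adherent (X : set T) (e : R) : (0 < e)%R ->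
  cover_outer P S tau X < +oo ->
  exists2 F, countable_covers P S X F &
    \sum_(k <oo) oapp tau 0 (F k) < cover_outer P S tau X + e%:E.
Proof.
move=> e0 Xoo; have Xfin : cover_outer P S tau X \is a fin_num.
  by rewrite ge0_fin_numE// cover_outer_ge0.
by have [_ [F cF <-] h] := lb_ereal_inf_adherent e0 Xfin; exists F.
Qed.

End CoverOuterLemmas.

Lemma countable_bigcup_measurable d (T : sigmaRingType d) (I : countType)
    (P : set I) (F : I -> set T) :
  (forall i, P i -> measurable (F i)) -> measurable (\bigcup_(i in P) F i).
Proof.
move=> mF; rewrite bigcup_mkcond; apply: countable_bigcupT_measurable.
  exact: countableP.
by move=> i; case: ifPn => // /[!inE]; exact: mF.
Qed.

(** * Lebesgue measurability of open sets *)

Section RationalBalls.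
Context {R : realType} {n : nat}.
Implicit Types (x : 'rV[R]_n) (U : set 'rV[R]_n).

Definition ratv (q : 'rV[rat]_n) : 'rV[R]_n := map_mx ratr q.

Lemma ratv_dense x (e : R) : 0 < e -> exists q, `|x - ratv q| < e.
Proof.
move=> e0.
have /choice[f hf] : forall i, exists q : rat, `|x ord0 i - ratr q| < e.
  move=> i; have [|q] := @rat_in_itvoo R (x ord0 i - e) (x ord0 i + e).
    by rewrite ltrBlDr -addrA ltrDl addr_gt0.
  rewrite in_itv/= => /andP[h1 h2]; exists q.
  by rewrite distrC ltr_distl h1 h2.
exists (\row_i f i); apply/norm_rV_ltP => // i.
by rewrite !mxE.
Qed.

Lemma ratball_approx x (e : R) : 0 < e ->
  exists p : 'rV[rat]_n * rat, [/\ `|x - ratv p.1| < ratr p.2, (0 < ratr p.2 :> R) &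
    ratr p.2 < e].
Proof.
move=> e0; have [|s] := @rat_in_itvoo R 0 e; first exact: e0.
rewrite in_itv/= => /andP[s0 se].
have [q hq] := ratv_dense x s0.
by exists (q, s).
Qed.

(** Closed sup-norm balls are boxes, so this countable union reduces the measurability of open sets
    to that of boxes. *)
Lemma open_bigcup_ratball U : open U ->
  U = \bigcup_(p in [set p : 'rV[rat]_n * rat | closed_ball_ Num.norm (ratv p.1) (ratr p.2) `<=` U])
        closed_ball_ Num.norm (ratv p.1) (ratr p.2).
Proof.
move=> oU; apply/seteqP; split=> [x Ux|x [p /= h /h]//].
move: oU; rewrite openE => /(_ x Ux) /nbhs_ballP[e/= e0 he].
have e2 : 0 < e / 2 by rewrite divr_gt0.
have [p [p1 p2 p3]] := ratball_approx x e2.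
exists p => /=; last by rewrite /closed_ball_/= distrC ltW.
move=> y /= hy; apply: he; rewrite -ball_normE/=.
rewrite (le_lt_trans (ler_distD (ratv p.1) _ _))// (splitr e) ltrD//.
  exact: lt_trans p1 p3.
exact: le_lt_trans hy p3.
Qed.

End RationalBalls.

Section LebesgueOpen.
Context {R : realType} {n : nat}.
Implicit Types (x : 'rV[R]_n) (U X : set 'rV[R]_n).
Local Notation lebT := (caratheodory_type (@lebesgue R n)).

Definition cut_box_l i (t : R) (ab : 'rV[R]_n * 'rV[R]_n) :=
  (ab.1, (\row_j (if j == i then Num.min (ab.2 ord0 j) t else ab.2 ord0 j))).

Definition cut_box_r i (t : R) (ab : 'rV[R]_n * 'rV[R]_n) :=
  ((\row_j (if j == i then Num.max (ab.1 ord0 j) t else ab.1 ord0 j)), ab.2).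

(** If the hyperplane misses the box, one of the two pieces has reversed endpoints; [Num.max 0]
    gives it volume 0 and the other piece is the whole box. *)
Lemma box_vol_cut i t ab :
  (box_vol (cut_box_l i t ab) + box_vol (cut_box_r i t ab) = box_vol ab)%E.
Proof.
rewrite /box_vol -EFinD; congr EFin.
rewrite (bigD1 i)//= [X in _ + X](bigD1 i)//= [RHS](bigD1 i)//=.
rewrite !mxE eqxx.
rewrite [X in _ * X + _](eq_bigr (fun j => Num.max 0 (ab.2 ord0 j - ab.1 ord0 j))); last first.
  by move=> j /negbTE ji; rewrite mxE ji.
rewrite [X in _ + _ * X](eq_bigr (fun j => Num.max 0 (ab.2 ord0 j - ab.1 ord0 j))); last first.
  by move=> j /negbTE ji; rewrite mxE ji.
rewrite -mulrDl; congr (_ * _).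
move: (ab.1 ord0 i) (ab.2 ord0 i) => a b.
by case: (leP b t) => h1; case: (leP a t) => h2; do ?[case: (leP 0 _) => ?]; lra.
Qed.

(** Cutting every box of a cover of X along the hyperplane gives covers of the two parts without
    changing the total volume. This is Carathéodory's condition for half-spaces, and boxes are
    intersections of these. *)
Lemma lebesgue_halfspaces i t X :
  (lebesgue (X `&` [set x | x ord0 i <= t]%R) +
   lebesgue (X `&` [set x | t <= x ord0 i]%R) <= lebesgue X)%E.
Proof.
apply: le_ereal_inf_tmp => _ [F [FP XF] <-].
pose F1 k := omap (cut_box_l i t) (F k).
pose F2 k := omap (cut_box_r i t) (F k).
have -> : (\sum_(k <oo) oapp (@box_vol R n) 0 (F k) =
  \sum_(k <oo) oapp (@box_vol R n) 0 (F1 k) + \sum_(k <oo) oapp (@box_vol R n) 0 (F2 k))%E.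
  rewrite -nneseriesD; last 2 first.
  - by move=> k _ _; apply: oapp_ge0; exact: box_vol_ge0.
  - by move=> k _ _; apply: oapp_ge0; exact: box_vol_ge0.
  apply: eq_eseriesr => k _; rewrite /F1 /F2; case: (F k) => [ab|]/=.
    by rewrite box_vol_cut.
  by rewrite adde0.
apply: leeD; apply: le_cover_outer_sum; split=> // x [Xx /= xt].
  have [k _] := XF _ Xx; case Fk : (F k) => [ab|]//= xab.
  exists k => //; rewrite /F1 Fk/= => j; rewrite mxE; have := xab j.
  by case: eqP => [->|_]// /andP[-> h]; rewrite /= le_min h.
have [k _] := XF _ Xx; case Fk : (F k) => [ab|]//= xab.
exists k => //; rewrite /F2 Fk/= => j; rewrite mxE; have := xab j.
by case: eqP => [->|_]// /andP[h ->]; rewrite andbT ge_max h.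
Qed.

Lemma lebesgue_measurable_le i t : measurable ([set x | x ord0 i <= t] : set lebT).
Proof.
apply: le_caratheodory_measurable => X.
apply: le_trans (lebesgue_halfspaces i t X); apply: leeD2l.
by apply: le_outer_measure => x [? /= /negP]; rewrite -ltNge => /ltW.
Qed.

Lemma lebesgue_measurable_ge i t : measurable ([set x | t <= x ord0 i] : set lebT).
Proof.
apply: le_caratheodory_measurable => X.
rewrite addeC; apply: le_trans (lebesgue_halfspaces i t X); apply: leeD2r.
by apply: le_outer_measure => x [? /= /negP]; rewrite -ltNge => /ltW.
Qed.

Lemma lebesgue_measurable_box ab : measurable (box ab : set lebT).
Proof.
have -> : box ab = \bigcap_i ([set x | ab.1 ord0 i <= x ord0 i] `&`
                              [set x | x ord0 i <= ab.2 ord0 i]).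
  apply/seteqP; split=> x h i; first by move=> _; have /andP := h i.
  by have [h1 h2] := h i Logic.I; apply/andP.
apply: fin_bigcap_measurable => // i _; apply: measurableI.
  exact: lebesgue_measurable_ge.
exact: lebesgue_measurable_le.
Qed.

Lemma closed_ball_box x (r : R) : 0 <= r ->
  closed_ball_ Num.norm x r = box (x - const_mx r, x + const_mx r).
Proof.
move=> r0; apply/seteqP; split=> y /= h.
  move=> i; have /(norm_rVP _ r0)/(_ i) := h.
  by rewrite !mxE distrC ler_distl.
rewrite /closed_ball_/= distrC; apply/norm_rVP => // i; have := h i.
by rewrite !mxE ler_distl.
Qed.

Lemma lebesgue_measurable_open U : open U -> measurable (U : set lebT).
Proof.
move=> oU; rewrite (open_bigcup_ratball oU).
apply: countable_bigcup_measurable => p _.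
(* A ball of negative rational radius is empty. *)
have [p0|p0] := leP 0 (ratr p.2 : R); last first.
  rewrite [X in measurable X](_ : _ = set0)//.
  apply/seteqP; split=> y //=; apply/negP; rewrite -ltNge.
  exact: lt_le_trans p0 (normr_ge0 _).
rewrite closed_ball_box//; exact: lebesgue_measurable_box.
Qed.

Lemma lebesgue_measurable_closed U : closed U -> measurable (U : set lebT).
Proof.
by move=> cU; rewrite -(setCK U); apply/measurableC/lebesgue_measurable_open/closed_openC.
Qed.

End LebesgueOpen.

(** * Lower bound for the volume of a covered box *)

Section BoxLowerBound.
Context {R : realType}.
Local Open Scope ereal_scope.

(* Slicing by the last coordinate t: almost the same cover, restricted to the
   boxes that meet the slice, covers a box of one dimension less, and integrating
   the resulting inequality over t gives the claim. *)
Lemma prod_le_cover (n : nat) (al be : nat -> R) :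
  (forall i, (al i <= be i)%R) ->
  forall (a b : nat -> nat -> R) (P : pred nat),
  (forall x : nat -> R, (forall i, (i < n)%N -> (al i <= x i <= be i)%R) ->
     exists2 k, P k & forall i, (i < n)%N -> (a k i <= x i <= b k i)%R) ->
  (\prod_(i < n) (be i - al i)%R)%:E <=
  \sum_(k <oo) (if P k then (\prod_(i < n) Num.max 0 (b k i - a k i)%R)%:E else 0).
Proof.
move=> albe; elim: n => [|n IH] a b P cov.
  (* In dimension 0 all products are 1, and the covering hypothesis supplies one admissible
     index. *)
  have [k Pk _] := cov al (fun i (h : (i < 0)%N) => ltac:(by [])).
  rewrite !big_ord0; apply: (le_trans _ (@nneseries_lim_ge R _ xpredT 0%N k.+1 _)); last first.
    by move=> m _ _; case: ifP => // _; rewrite big_ord0.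
  rewrite big_mkord big_ord_recr/= Pk big_ord0 leeDr// sume_ge0// => i _.
  by case: ifP => // _; rewrite big_ord0.
pose v k : R := (\prod_(i < n) Num.max 0 (b k i - a k i))%R.
have v0 k : (0 <= v k)%R by rewrite prodr_ge0// => i _; rewrite le_max lexx.
pose I : set R := `[al n, be n]%classic.
pose J k : set R := `[a k n, b k n]%classic.
have mI : measurable I by exact: measurable_itv.
have mJ k : measurable (J k) by exact: measurable_itv.
pose c : R := (\prod_(i < n) (be i - al i))%R.
have c0 : (0 <= c)%R by rewrite prodr_ge0// => i _; rewrite subr_ge0.
pose f k (t : R) : \bar R := (if P k then v k else 0)%:E * (\1_(J k) t)%:E.
have f0 k t : 0 <= f k t.
  by rewrite mule_ge0//; case: ifP; rewrite lee_fin.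
have mf k : measurable_fun I (f k).
  by apply/measurable_EFinP/measurable_funM.
have key t : I t -> c%:E <= \sum_(k <oo) f k t.
  (* Restricting to the boxes that meet the slice at height [t] is what the predicate [P] is carried
     along for. *)
  move=> It; pose P' k := P k && (a k n <= t <= b k n)%R.
  have /IH/le_trans -> // : forall x : nat -> R,
     (forall i, (i < n)%N -> (al i <= x i <= be i)%R) ->
     exists2 k, P' k & forall i, (i < n)%N -> (a k i <= x i <= b k i)%R.
    move=> x hx; pose x' i := if i == n then t else x i.
    have [|k Pk hk] := cov x'; first move=> i.
      rewrite ltnS leq_eqVlt /x'; case: eqP => [->_|_ /= ]; last exact: hx.
      by move: It; rewrite /I /= in_itv.
    exists k.
      by rewrite /P' Pk/=; have := hk n (ltnSn n); rewrite /x' eqxx.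
    move=> i ni; have := hk i (ltnW ni).
    by rewrite /x' (ltn_eqF ni).
  apply: lee_nneseries => [k _ _|k _].
    by case: ifP; rewrite ?lee_fin// => _; exact: v0.
  rewrite /f /P'; case: (P k) => //=.
  rewrite indicE (_ : (t \in J k) = (a k n <= t <= b k n)%R); last by rewrite /J mem_setE in_itv.
  by case: ifP; rewrite ?mule1 ?mule0.
have -> : (\prod_(i < n.+1) (be i - al i)%R)%:E =
    \int[lebesgue_measure]_(t in I) (cst c%:E t).
  rewrite integral_cst//= (lebesgue_measure_itv `[al n, be n])/= lte_fin.
  rewrite big_ord_recr/= -/c; case: ltP => h; first by rewrite -EFinB -EFinM.
  have -> : be n = al n by apply/eqP; rewrite eq_le h albe.
  by rewrite subrr mulr0 mule0.
apply: (@le_trans _ _ (\int[lebesgue_measure]_(t in I) (\sum_(k <oo) f k t))).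
  apply: ge0_le_integral => //.
  by apply: ge0_emeasurable_sum => [k t _ _|k _]; [exact: f0|exact: mf].
rewrite integral_nneseries//.
apply: lee_nneseries => [k _ _|k _]; first exact: integral_ge0.
have mEJ : measurable_fun I (fun t : R => (\1_(J k) t : R)%:E).
  by apply/measurable_EFinP; exact: measurable_indic.
rewrite /f ge0_integralZl_EFin//; last by case: ifP.
rewrite (@integral_indic _ _ _ lebesgue_measure I mI (J k) (mJ k)); case Pk : (P k); last first.
  by rewrite mul0e.
rewrite big_ord_recr/= -/(v k) EFinM lee_wpmul2l ?lee_fin//.
apply: (@le_trans _ _ (lebesgue_measure (J k))).
  apply: le_measure; rewrite ?inE.
  - exact: (measurableI _ _ (mJ k) mI).
  - exact: (mJ k).
  - exact: subIsetl.
rewrite (lebesgue_measure_itv `[a k n, b k n])/= lte_fin; case: ifP => h.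
  by rewrite -EFinB lee_fin le_max lexx orbT.
by rewrite lee_fin le_max lexx.
Qed.

End BoxLowerBound.

(** * Volumes of boxes and balls, translation invariance *)

Section LebesgueOuter.
Context {R : realType} {n : nat}.
Implicit Types (x h : 'rV[R]_n) (A B : set 'rV[R]_n).
Local Notation lebT := (caratheodory_type (@lebesgue R n)).

Lemma lebesgue_box_ge (p q : 'rV[R]_n) : (forall i, p ord0 i <= q ord0 i) ->
  ((\prod_(i < n) (q ord0 i - p ord0 i))%:E <= lebesgue (box (p, q)))%E.
Proof.
move=> pq; apply: le_ereal_inf_tmp => _ [F [FP XF] <-].
(* The covering inequality indexes coordinates by [nat], which keeps its induction on the dimension
   free of dependent types; vectors are padded with 0. *)
pose nc (v : 'rV[R]_n) (i : nat) : R :=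
  if insub i is Some j then v ord0 (j : 'I_n) else 0.
have ncE v (i : 'I_n) : nc v i = v ord0 i.
  by rewrite /nc insubT//= => hi; congr (v _ _); exact: val_inj.
pose ab k : 'rV[R]_n * 'rV[R]_n := odflt (0, 0) (F k).
have := @prod_le_cover R n (nc p) (nc q) _ (fun k => nc (ab k).1)
  (fun k => nc (ab k).2) (fun k => isSome (F k)).
under eq_bigr do rewrite !ncE.
move=> H; apply: (le_trans (H _ _)).
- by move=> i; rewrite /nc; case: insubP.
- move=> x hx; have [|k _] := XF (\row_i x i).
    by move=> i; rewrite mxE -!ncE; exact: hx.
  rewrite /ab; case Fk : (F k) => [cd|]//= xcd; exists k; rewrite Fk//=.
  by move=> i ni; have := xcd (Ordinal ni); rewrite mxE -!ncE.
- apply: lee_nneseries => [k _ _|k _]; rewrite /ab.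
    by case: ifP => // _; rewrite lee_fin prodr_ge0// => i _; rewrite le_max lexx.
  case: (F k) => //= cd.
  by under eq_bigr do rewrite !ncE.
Qed.

Lemma lebesgue_box_le (ab : 'rV[R]_n * 'rV[R]_n) : (lebesgue (box ab) <= box_vol ab)%E.
Proof.
have := @le_cover_outer_sum R _ _ setT (@box R n) (@box_vol R n)
  (fun k => if k == 0%N then Some ab else None) (box ab).
rewrite (@nneseriesD1 _ _ 0%N)//; last first.
  by move=> k _; case: ifP => // _; exact: box_vol_ge0.
rewrite eseries0 ?adde0; last by move=> k _ /=; case: ifP.
by apply; split => // x xab; exists 0%N.
Qed.

Lemma lebesgue_closed_ball_le x (r : R) : 0 <= r ->
  (lebesgue (closed_ball_ Num.norm x r) <= ((2 * r) ^+ n)%:E)%E.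
Proof.
move=> r0; rewrite closed_ball_box//; apply: le_trans (lebesgue_box_le _) _.
rewrite /box_vol/= (eq_bigr (fun=> 2 * r)) ?prodr_const ?card_ord// => i _.
rewrite !mxE; have -> : x ord0 i + r - (x ord0 i - r) = 2 * r by ring.
by rewrite max_r// mulr_ge0.
Qed.

Lemma lebesgue_ball_le x (r : R) : 0 <= r ->
  (lebesgue (ball x r) <= ((2 * r) ^+ n)%:E)%E.
Proof.
move=> r0; apply: le_trans (lebesgue_closed_ball_le x r0).
by apply: le_outer_measure => y; rewrite -ball_normE/= => /ltW.
Qed.

Lemma lebesgue_eball_ge x (r : R) : 0 < r ->
  (((2 / n.+1%:R * r) ^+ n)%:E <= lebesgue (eball x r))%E.
Proof.
(* The cube of half-side r / (n + 1) lies in the open Euclidean ball because n < n + 1. *)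
move=> r0; pose s := r / n.+1%:R; have s0 : 0 < s by rewrite divr_gt0.
apply: (@le_trans _ _ (lebesgue (closed_ball_ Num.norm x s))).
  rewrite (closed_ball_box _ (ltW s0)).
  apply: (le_trans _ (lebesgue_box_ge _)); last first.
    by move=> i; rewrite !mxE lerD2l ge0_cp ?ltW.
  rewrite lee_fin (eq_bigr (fun=> 2 / n.+1%:R * r)) ?prodr_const ?card_ord// => i _.
  by rewrite !mxE /s; ring.
apply: le_outer_measure => y; rewrite /closed_ball_/= distrC => h; rewrite /eball/=.
rewrite (le_lt_trans (enorm_le_norm _))//.
apply: (@le_lt_trans _ _ (n%:R * s)); first by rewrite ler_wpM2l.
by rewrite /s mulrCA gtr_pMr// ltr_pdivrMr// mul1r ltr_nat.
Qed.

Lemma lebesgue_bounded A x (r : R) : A `<=` ball x r -> (lebesgue A < +oo)%E.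
Proof.
have [r0|r0] := leP 0 r => Ax.
  rewrite (le_lt_trans (le_outer_measure (@lebesgue R n) _ _ Ax))//.
  by rewrite (le_lt_trans (lebesgue_ball_le _ r0))// ltry.
have -> : A = set0.
  apply/seteqP; split=> y // /Ax; rewrite -ball_normE/= => h.
  by have := lt_trans h r0; rewrite normr_lt0.
by rewrite outer_measure0.
Qed.

Lemma box_shift (ab : 'rV[R]_n * 'rV[R]_n) h :
  (fun x => x + h) @^-1` box ab = box (ab.1 - h, ab.2 - h).
Proof.
by apply/seteqP; split=> x /= H i; have := H i; rewrite !mxE lerBlDr lerBrDr.
Qed.

Lemma lebesgue_shift_le A h : (lebesgue ((fun x => x + h)%R @^-1` A) <= lebesgue A)%E.
Proof.
apply: le_ereal_inf_tmp => _ [F [FP XF] <-].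
apply: (le_trans (@le_cover_outer_sum R _ _ setT (@box R n) (@box_vol R n)
  (fun k => omap (fun ab => (ab.1 - h, ab.2 - h)) (F k)) _ _)).
  split=> // x /= /XF[k _]; case Fk : (F k) => [ab|]//= xab; exists k => //.
  by rewrite Fk/= -box_shift.
apply: lee_nneseries => k _.
  by move=> _; case: (F k) => //= *; exact: box_vol_ge0.
case: (F k) => [[a b]|]//=; rewrite /box_vol/= lee_fin.
rewrite le_eqVlt; apply/orP; left; apply/eqP/eq_bigr => i _.
by rewrite !mxE opprB addrA subrK.
Qed.

Lemma lebesgue_shift A h : lebesgue ((fun x => x + h)%R @^-1` A) = lebesgue A.
Proof.
apply/eqP; rewrite eq_le lebesgue_shift_le/=.
apply: le_trans (lebesgue_shift_le _ (- h)).
by apply: le_outer_measure => x /=; rewrite subrK.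
Qed.

(** Testing the shifted set against X amounts to testing A against X shifted the other way, since
    the outer measure is translation invariant. *)
Lemma lebesgue_measurable_shift A h : measurable (A : set lebT) ->
  measurable ((fun x => x + h) @^-1` A : set lebT).
Proof.
move=> mA; apply: le_caratheodory_measurable => X.
have e B : lebesgue (X `&` (fun x => x + h) @^-1` B) =
    lebesgue ((fun x => x - h) @^-1` X `&` B).
  rewrite -[RHS](lebesgue_shift _ h); congr lebesgue.
  by apply/seteqP; split=> x /=; rewrite addrK.
have HX := mA ((fun x => x - h) @^-1` X).
change (lebesgue (X `&` (fun x => x + h)%R @^-1` A) +
  lebesgue (X `&` (fun x => x + h)%R @^-1` (~` A)) <= lebesgue X)%E.
by rewrite e (e (~` A)) -(lebesgue_shift X (- h)) [leRHS]HX.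
Qed.

End LebesgueOuter.

Section EDiam.
Context {R : realType} {n : nat}.
Implicit Types (x y : 'rV[R]_n) (A B : set 'rV[R]_n).

Lemma ediam_ge A x y : A x -> A y -> ((enorm (x - y))%:E <= ediam A)%E.
Proof. by move=> Ax Ay; apply: ereal_sup_ubound; exists (x, y). Qed.

Lemma ediam_le A (r : R) : (forall x y, A x -> A y -> enorm (x - y) <= r) ->
  (ediam A <= r%:E)%E.
Proof. by move=> h; apply: ge_ereal_sup => _ [[x y] [/= Ax Ay] <-]; rewrite lee_fin h. Qed.

Lemma ediam_ge0 A : A !=set0 -> (0 <= ediam A)%E.
Proof. by move=> [x Ax]; have := ediam_ge Ax Ax; rewrite subrr enorm0. Qed.

Lemma ediam_set0 : ediam (@set0 'rV[R]_n) = -oo%E.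
Proof. by rewrite /ediam setX0 image_set0 ereal_sup0. Qed.

End EDiam.

(** * Sets of finite H^d measure are Lebesgue null when d < n *)

Section HausdorffNull.
Context {R : realType} {n : nat} (d : R).
Hypotheses (d0 : 0 < d) (dn : d < n%:R).
Implicit Types (A : set 'rV[R]_n).
Local Open Scope ereal_scope.

(** A set of diameter r <= e lies in a cube of side 2r around any of its points, and r^n = r^(n-d)
    r^d <= e^(n-d) r^d. *)
Lemma lebesgue_le_ediam A (e : R) : (0 < e)%R -> ediam A <= e%:E ->
  lebesgue A <= (2 ^+ n * e `^ (n%:R - d))%:E * ediam A `^ d.
Proof.
move=> e0 Ae.
have [->|/set0P[x Ax]] := eqVneq A set0.
  rewrite outer_measure0 mule_ge0 ?poweR_ge0// lee_fin mulr_ge0 ?powR_ge0//.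
have A0 : 0 <= ediam A by apply: ediam_ge0; exists x.
have Afin : ediam A \is a fin_num.
  by rewrite ge0_fin_numE// (le_lt_trans Ae)// ltry.
move: (ediam A) (@ediam_ge _ _ A x) A0 Afin Ae => [r| |]// hr.
rewrite !lee_fin => r0 _ re.
apply: (@le_trans _ _ (lebesgue (closed_ball_ Num.norm x r))).
  apply: le_outer_measure => y Ay; rewrite /closed_ball_/=.
  by rewrite (le_trans (norm_le_enorm _))// -lee_fin hr.
apply: le_trans (lebesgue_closed_ball_le _ r0) _.
rewrite poweR_EFin -EFinM lee_fin exprMn -mulrA ler_wpM2l ?exprn_ge0//.
have [->|rn0] := eqVneq r 0%R.
  rewrite [X in (X <= _)%R](_ : _ = 0%R) ?mulr_ge0 ?powR_ge0//.
  by case: n dn => [|m _]; [rewrite ltNge ltW|rewrite expr0n].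
rewrite -powR_mulrn// -{1}(subrK d n%:R) powRD; last by rewrite (negbTE rn0) implybT.
rewrite ler_wpM2r ?powR_ge0// ge0_ler_powR// ?nnegrE// ?subr_ge0 ltW//.
Qed.

Lemma lebesgue_hausdorff0 A : hausdorff d A < +oo -> lebesgue A = 0.
Proof.
move=> Aoo; have H0 : 0 <= hausdorff d A by exact: outer_measure_ge0.
have Afin : hausdorff d A \is a fin_num by rewrite ge0_fin_numE.
pose K : R := (2 ^+ n * (fine (hausdorff d A) + 1))%R.
have K0 : (0 < K)%R by rewrite mulr_gt0 ?exprn_gt0// ltr_pwDr// fine_ge0.
have nd : (0 < n%:R - d)%R by rewrite subr_gt0.
have key (t : R) : (0 < t)%R -> lebesgue A <= (K * t)%:E.
  (* The mesh for which the factor e^(n-d) gained on each covering set is exactly t. *)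
  move=> t0; pose e := (t `^ (n%:R - d)^-1)%R.
  have e0 : (0 < e)%R by rewrite powR_gt0.
  have et : (e `^ (n%:R - d) = t)%R.
    by rewrite -powRrM mulVf ?gt_eqF// powRr1// ltW.
  have ce : hausdorff_content d e A <= hausdorff d A.
    by apply: ereal_sup_ubound; exists e.
  have [F [FP XF] hF] := cover_outer_adherent (fun B => poweR_ge0 (ediam B) d)
    ltr01 (le_lt_trans ce Aoo).
  apply: (@le_trans _ _ (\sum_(k <oo) lebesgue (oapp id set0 (F k)))).
    exact: le_trans (le_outer_measure _ _ _ XF) (outer_measure_sigma_subadditive _ _).
  apply: (@le_trans _ _ (\sum_(k <oo) (2 ^+ n * t)%:E * oapp (fun B => ediam B `^ d) 0 (F k))).
    apply: lee_nneseries => [k _ _|k _]; first exact: outer_measure_ge0.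
    case Fk : (F k) => [B|]/=; last by rewrite outer_measure0 mule0.
    by rewrite -et; apply: lebesgue_le_ediam => //; exact: FP Fk.
  rewrite nneseriesZl; last by move=> k _; apply: oapp_ge0 => B; exact: poweR_ge0.
  rewrite /K mulrAC [leRHS]EFinM; apply: lee_wpmul2l.
    by rewrite lee_fin mulr_ge0 ?exprn_ge0// ltW.
  by rewrite EFinD fineK// (le_trans (ltW hF))// leeD2r.
apply/eqP; rewrite eq_le outer_measure_ge0 andbT.
apply/lee_addgt0Pr => e e0; rewrite add0e.
apply: le_trans (key (e / K)%R _) _; first by rewrite divr_gt0.
by rewrite lee_fin mulrC divfK ?gt_eqF.
Qed.

End HausdorffNull.

(** * Hausdorff measure *)

Section CaratheodoryCriterion.
Context {R : realType} {n : nat}.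
Variable mu : {outer_measure set 'rV[R]_n -> \bar R}.
Local Open Scope ereal_scope.

(** A metric outer measure: additive on sets at positive distance. Only this inequality is at stake,
    the other one being subadditivity. *)
Definition metric_outer := forall (A B : set 'rV[R]_n) (e : R), (0 < e)%R ->
  (forall a b, A a -> B b -> (e <= enorm (a - b))%R) -> mu A + mu B <= mu (A `|` B).

Hypothesis mu_metric : metric_outer.
Variables (f : 'rV[R]_n -> R).
Hypothesis f_lip : forall x y, (`|f x - f y| <= enorm (x - y))%R.

Let t (j : nat) : R := (j.+1%:R^-1)%R.

Let t_gt0 j : (0 < t j)%R. Proof. by rewrite invr_gt0. Qed.

Let t_le i j : (i <= j)%N -> (t j <= t i)%R.
Proof. by move=> ij; rewrite lef_pV2 ?posrE// ler_nat. Qed.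

Let t_lt j : (t j.+1 < t j)%R.
Proof. by rewrite ltf_pV2 ?posrE// ltr_nat. Qed.

Section shells.
Variable X : set 'rV[R]_n.

Let S j := X `&` [set x | (t j.+1 <= f x < t j)%R].

(** The usual splitting into even and odd shells, done as one induction. [S N.+1] is at positive
    distance from all the shells before [S N], so it merges with the shorter union; the two unions
    take turns in absorbing the new shell. *)
Let sum_shells N :
  \sum_(j < N.+1) mu (S j) <=
    mu (\bigcup_(j < N.+1) S j) + mu (\bigcup_(j < N) S j).
Proof.
elim: N => [|N IH].
  by rewrite big_ord1 bigcup_mkord big_ord1 leeDl.
rewrite big_ord_recr/=; apply: le_trans (leeD2r _ IH) _.
rewrite -addeA addeC; apply: leeD; last exact: lexx.
apply: (le_trans (@mu_metric _ _ (t N - t N.+1)%R _ _)).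
- by rewrite subr_gt0.
- move=> a b [i /= iN [_ /andP[ta _]]] [_ /andP[_ tb]].
  apply: le_trans (f_lip a b); apply: le_trans (ler_norm _).
  by rewrite lerB// ?(ltW tb)// (le_trans _ ta)// t_le.
- apply: le_outer_measure => x [[i /= iN Si]|SN].
    by exists i => //=; rewrite (leq_trans iN)// -addn2 leq_addr.
  by exists N.+1 => //=.
Qed.

Let cvg_shells : mu X < +oo -> forall e : R, (0 < e)%R ->
  exists N, \sum_(N <= j <oo) mu (S j) < e%:E.
Proof.
move=> Xoo e e0.
have foo : \sum_(0 <= j <oo) mu (S j) < +oo.
  apply: (@le_lt_trans _ _ (mu X + mu X)); last by rewrite lte_add_pinfty.
  apply: lime_le; first by apply: is_cvg_nneseries => *; exact: outer_measure_ge0.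
  apply: nearW => -[|N]; first by rewrite big_geq// adde_ge0// outer_measure_ge0.
  rewrite big_mkord; apply: le_trans (sum_shells N) _.
  by apply: leeD; apply: le_outer_measure; apply: bigcup_sub => i _ x [].
have := nneseries_tail_cvg foo (fun k _ => outer_measure_ge0 mu (S k)).
have e0' : 0 < e%:E by rewrite lte_fin.
move=> /(_ _ (open_ereal_lt' e0'))[N _ /(_ N (leqnn N))/= h].
by exists N.
Qed.

(** Carathéodory's criterion. The part of X where f >= t N is at positive distance from {f <= 0};
    what is left of {f > 0} lies in the shells from N on, whose measures have a small sum. *)
Lemma metric_outer_le : mu (X `&` [set x | (f x <= 0)%R]) +
  mu (X `&` ~` [set x | (f x <= 0)%R]) <= mu X.
Proof.
have [->|Xoo] := eqVneq (mu X) +oo; first by rewrite leey.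
have {}Xoo : mu X < +oo by rewrite ltey.
apply/lee_addgt0Pr => e e0.
have [N hN] := cvg_shells Xoo e0.
pose B := X `&` [set x | (t N <= f x)%R].
have cov : X `&` ~` [set x | (f x <= 0)%R] `<=` B `|` \bigcup_j S (N + j)%N.
  move=> x [Xx /= /negP]; rewrite -ltNge => fx.
  have [tf|ft] := leP (t N) (f x); [by left|right].
  have [j tj] : exists j, (t (N + j)%N <= f x)%R.
    have hj := @truncnS_gt R (f x)^-1; set j := Num.truncn _ in hj.
    exists j; rewrite /t invf_ple ?posrE//.
    by rewrite (le_trans (ltW hj))// ler_nat ltnS leq_addl.
  (* Going down from [j], the last threshold still below [f x] determines the shell of [x]. *)
  elim: j tj => [|j IH] tj; first by move: ft; rewrite ltNge -{1}(addn0 N) tj.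
  have [/IH//|ft'] := leP (t (N + j)%N) (f x).
  by exists j => //; split=> //=; rewrite ft' andbT -addnS.
have B' : mu (X `&` ~` [set x | (f x <= 0)%R]) <= mu B + \sum_(N <= j <oo) mu (S j).
  apply: le_trans (le_outer_measure _ _ _ cov) _.
  apply: le_trans (outer_measureU2 _ _ _) _; apply: leeD2l.
  rewrite -nneseries_addn; last by move=> *; exact: outer_measure_ge0.
  under eq_eseriesr do rewrite addnC.
  exact: outer_measure_sigma_subadditive.
apply: (le_trans (leeD2l _ B')); rewrite addeA; apply: leeD; last exact: ltW.
apply: (le_trans (@mu_metric _ _ (t N) _ _)) => //.
- move=> a b [_ /= fa] [_ /= fb]; rewrite enorm_distC; apply: le_trans (f_lip _ _).
  by apply: le_trans (ler_norm _); rewrite lerBrDr (le_trans _ fb)// gerDl.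
- by apply: le_outer_measure => x [[]|[]].
Qed.

End shells.

Lemma metric_outer_measurable :
  measurable ([set x | f x <= 0]%R : set (caratheodory_type mu)).
Proof. by apply: le_caratheodory_measurable => X; exact: metric_outer_le. Qed.

End CaratheodoryCriterion.

Section MetricClosed.
Context {R : realType} {n : nat}.
Variable mu : {outer_measure set 'rV[R]_n -> \bar R}.

Lemma metric_outer_closed (F : set 'rV[R]_n) : metric_outer mu -> closed F ->
  measurable (F : set (caratheodory_type mu)).
Proof.
move=> mm cF; have [->|/set0P F0] := eqVneq F set0; first exact: measurable0.
have -> : F = [set x | dist_pt x F <= 0].
  apply/seteqP; split=> x /=.
    by move=> Fx; rewrite (le_trans (dist_pt_le _ Fx))// subrr enorm0.
  by apply: contraPP => Fx; apply/negP; rewrite -ltNge dist_pt_gt0.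
apply: metric_outer_measurable => // x y; exact: dist_pt_lipschitz.
Qed.

End MetricClosed.

(** * Metric property and outer regularity of H^d *)

Section HausdorffMetric.
Context {R : realType} {n : nat} (d : R).
Hypothesis d0 : 0 < d.
Implicit Types (A B E : set 'rV[R]_n).
Local Open Scope ereal_scope.
Local Notation hauT := (caratheodory_type (@hausdorff R n d)).

Lemma hausdorff_content_anti (c c' : R) A : (c <= c')%R ->
  hausdorff_content d c' A <= hausdorff_content d c A.
Proof.
move=> cc; apply: ereal_inf_le_tmp => x [F [FP AF] <-]; exists F => //; split=> //.
by move=> k S /FP /= h; rewrite (le_trans h)// lee_fin.
Qed.

Lemma le_hausdorff_content (c : R) A : (0 < c)%R ->
  hausdorff_content d c A <= hausdorff d A.
Proof. by move=> c0; apply: ereal_sup_ubound; exists c. Qed.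

(** A set of diameter at most c < e cannot meet both A and B, so any cover splits into the sets that
    meet A and the others, which cover B. *)
Lemma hausdorff_content_metric A B (e c : R) : (c < e)%R ->
  (forall a b, A a -> B b -> (e <= enorm (a - b))%R) ->
  hausdorff_content d c A + hausdorff_content d c B <= hausdorff_content d c (A `|` B).
Proof.
move=> ce sep; apply: le_ereal_inf_tmp => _ [F [FP AF] <-].
pose meets (S : set 'rV[R]_n) := `[< exists2 a, A a & S a >].
pose F1 k := if F k is Some V then (if meets V then Some V else None) else None.
pose F2 k := if F k is Some V then (if meets V then None else Some V) else None.
pose tau S : \bar R := @ediam R n S `^ d.
have tau0 S : 0 <= tau S by exact: poweR_ge0.
have -> : \sum_(k <oo) oapp tau 0 (F k) =
  \sum_(k <oo) oapp tau 0 (F1 k) + \sum_(k <oo) oapp tau 0 (F2 k).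
  rewrite -nneseriesD; last 2 first.
  - by move=> k _ _; apply: oapp_ge0.
  - by move=> k _ _; apply: oapp_ge0.
  apply: eq_eseriesr => k _; rewrite /F1 /F2; case: (F k) => [S|]/=; last by rewrite adde0.
  by case: ifP => _ /=; rewrite ?adde0 ?add0e.
apply: leeD; apply: le_cover_outer_sum; split.
- by move=> k S; rewrite /F1; case Fk : (F k) => [S'|]//; case: ifP => // _ [<-]; exact: FP Fk.
- move=> x Ax; have [k _] := AF x (or_introl Ax); case Fk : (F k) => [S|]//= Sx.
  exists k => //; rewrite /F1 Fk; suff -> : meets S by [].
  by apply/asboolP; exists x.
- by move=> k S; rewrite /F2; case Fk : (F k) => [S'|]//; case: ifP => // _ [<-]; exact: FP Fk.
- move=> x Bx; have [k _] := AF x (or_intror Bx); case Fk : (F k) => [S|]//= Sx.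
  exists k => //; rewrite /F2 Fk; case: ifP => // /asboolP[a Aa Sa].
  have := le_trans (ediam_ge Sa Sx) (FP _ _ Fk); rewrite lee_fin => h.
  by have := sep _ _ Aa Bx; rewrite leNgt (le_lt_trans h ce).
Qed.

Lemma hausdorff_metric : metric_outer (@hausdorff R n d).
Proof.
move=> A B e e0 sep; change (hausdorff d A + hausdorff d B <= hausdorff d (A `|` B)).
have [->|] := eqVneq (hausdorff d (A `|` B)) +oo; first by rewrite leey.
rewrite -ltey => Moo; set M := hausdorff d (A `|` B) in Moo *.
have fin C : C `<=` A `|` B -> hausdorff d C \is a fin_num.
  move=> CAB; rewrite ge0_fin_numE ?outer_measure_ge0//.
  exact: le_lt_trans (le_outer_measure _ _ _ CAB) Moo.
have fA := fin A (@subsetUl _ _ _); have fB := fin B (@subsetUr _ _ _).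
(* The two measures on the left are separate suprema over meshes; both meshes are replaced by a
   common smaller one, at most e / 2. *)
have key (a b : R) : (0 < a)%R -> (0 < b)%R ->
    hausdorff_content d a A + hausdorff_content d b B <= M.
  move=> a0 b0; pose c := Num.min a (Num.min b (e / 2)%R).
  have c0 : (0 < c)%R by rewrite !lt_min a0 b0 divr_gt0.
  apply: (@le_trans _ _ (hausdorff_content d c (A `|` B))); last exact: le_hausdorff_content.
  apply: le_trans (hausdorff_content_metric _ sep); last first.
    have e2 : (e / 2 < e)%R by lra.
    by rewrite !gt_min e2 !orbT.
  by apply: leeD; apply: hausdorff_content_anti; rewrite /c !ge_min lexx ?orbT.
rewrite -leeBrDr//; apply: ge_ereal_sup => _ [a /= a0 <-].
have fa : hausdorff_content d a A \is a fin_num.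
  rewrite ge0_fin_numE ?cover_outer_ge0//; last by move=> S; exact: poweR_ge0.
  by rewrite (le_lt_trans (le_hausdorff_content _ a0))// -ge0_fin_numE ?outer_measure_ge0.
rewrite leeBrDr// addeC -leeBrDr//; apply: ge_ereal_sup => _ [b /= b0 <-].
by rewrite leeBrDr// addeC; exact: key.
Qed.

Lemma hausdorff_measurable_closed E : closed E -> measurable (E : set hauT).
Proof. exact/metric_outer_closed/hausdorff_metric. Qed.

Lemma hausdorff_measurable_open E : open E -> measurable (E : set hauT).
Proof.
by move=> oE; rewrite -(setCK E); apply/measurableC/hausdorff_measurable_closed/open_closedC.
Qed.

Lemma powR_enlarge (r e : R) : (0 <= r)%R -> (0 < e)%R ->
  exists2 h : R, (0 < h)%R & ((r + h) `^ d <= r `^ d + e)%R.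
Proof.
move=> r0 e0; pose s := ((r `^ d + e) `^ d^-1)%R.
have sd : (s `^ d = r `^ d + e)%R.
  by rewrite -powRrM mulVf ?gt_eqF// powRr1// addr_ge0 ?powR_ge0// ltW.
have rs : (r < s)%R.
  rewrite ltNge; apply/negP => sr.
  have : (s `^ d <= r `^ d)%R by rewrite ge0_ler_powR ?nnegrE ?powR_ge0// ltW.
  by rewrite sd gerDl leNgt e0.
exists (s - r)%R; first by rewrite subr_gt0.
by rewrite addrC subrK sd.
Qed.

(** The open set is the union of the balls of radius k around the points of S, which adds at most 2k
    to the diameter. In the choice of k, h / 2 controls the d-th power of the diameter and c / 2
    keeps the diameter below 2c. *)
Lemma ediam_enlarge (S : set 'rV[R]_n) (c e : R) : (0 < c)%R -> (0 < e)%R ->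
  ediam S <= c%:E ->
  exists S', [/\ open S', S `<=` S', ediam S' <= (2 * c)%:E &
     ediam S' `^ d <= ediam S `^ d + e%:E].
Proof.
move=> c0 e0; have [->|/set0P Sn0] := eqVneq S set0.
  move=> _; exists set0; split => //; first by rewrite ediam_set0 leNye.
  by rewrite leeDl// lee_fin ltW.
move=> Sc; have S0 := ediam_ge0 Sn0.
have Sfin : ediam S \is a fin_num by rewrite ge0_fin_numE// (le_lt_trans Sc)// ltry.
move: (@ediam_ge _ _ S) S0 Sfin Sc; case: (ediam S) => [r| |]// hS r0 _ rc.
rewrite !lee_fin in r0 rc.
have [h h0 rh] := powR_enlarge r0 e0.
pose k := Num.min (h / 2)%R (c / 2)%R.
have k0 : (0 < k)%R by rewrite lt_min !divr_gt0.
have kh : (2 * k <= h)%R by rewrite mulrC -ler_pdivlMr// ge_min lexx.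
have kc : (2 * k <= c)%R by rewrite mulrC -ler_pdivlMr// ge_min lexx orbT.
have Sdiam : ediam (\bigcup_(s in S) eball s k) <= (r + 2 * k)%:E.
  apply: ediam_le => x y [a Sa xa] [b Sb yb].
  have := hS _ _ Sa Sb; rewrite lee_fin => ab.
  rewrite /eball/= in xa yb.
  have h1 := ler_enorm_distD a x y; have h2 := ler_enorm_distD b a y.
  by rewrite (enorm_distC y b) in yb; lra.
exists (\bigcup_(s in S) eball s k); split.
- by apply: bigcup_open => s _; exact: open_eball.
- by move=> x Sx; exists x => //; exact: eball_center.
- by rewrite (le_trans Sdiam)// lee_fin; lra.
- have [x Sx] := Sn0.
  have h0' : 0 <= ediam (\bigcup_(s in S) eball s k).
    by apply: ediam_ge0; exists x, x => //; exact: eball_center.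
  apply: (@le_trans _ _ ((r + h)%:E `^ d)).
    apply: gt0_ler_poweR; [exact: ltW| | |].
    - by rewrite in_itv/= h0' leey.
    - by rewrite in_itv/= lee_fin addr_ge0 ?leey// ltW.
    - by rewrite (le_trans Sdiam)// lee_fin lerD2l.
  by rewrite !poweR_EFin -EFinD lee_fin.
Qed.

(** Half of the error c pays for a near-optimal cover of mesh c, the other half for making its sets
    open. Opening them may double their diameters, hence the content at mesh 2c. *)
Lemma hausdorff_content_open A (c : R) : (0 < c)%R -> hausdorff d A < +oo ->
  exists U, [/\ open U, A `<=` U & hausdorff_content d (2 * c)%R U <= hausdorff d A + c%:E].
Proof.
move=> c0 Aoo.
have c20 : (0 < c / 2)%R by rewrite divr_gt0.
have tau0 (S : set 'rV[R]_n) : 0 <= ediam S `^ d by exact: poweR_ge0.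
have [F [FP AF] hF] := cover_outer_adherent tau0 c20
  (le_lt_trans (le_hausdorff_content A c0) Aoo).
pose e k : R := (c / 2 / (2 ^ k.+1)%:R)%R.
have e0 k : (0 < e k)%R by rewrite divr_gt0// ltr0n expn_gt0.
have /choice[G hG] k : exists G : option (set 'rV[R]_n),
    [/\ open (oapp id set0 G), oapp id set0 (F k) `<=` oapp id set0 G,
      forall S, G = Some S -> ediam S <= (2 * c)%:E &
      oapp (fun S => ediam S `^ d) 0 G <= oapp (fun S => ediam S `^ d) 0 (F k) + (e k)%:E].
  case Fk : (F k) => [S|].
    have [S' [h1 h2 h3 h4]] := ediam_enlarge c0 (e0 k) (FP _ _ Fk).
    by exists (Some S'); split => // ? [<-].
  by exists None; split => //=; rewrite add0e lee_fin ltW.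
exists (\bigcup_k oapp id set0 (G k)); split.
- by apply: bigcup_open => k _; case: (hG k).
- by move=> x /AF[k _ Fx]; exists k => //; case: (hG k) => _ + _ _; exact.
- apply: (@le_trans _ _ (\sum_(k <oo) oapp (fun S => ediam S `^ d) 0 (G k))).
    by apply: le_cover_outer_sum; split=> // k S; case: (hG k) => _ _ + _; exact.
  apply: (@le_trans _ _ (\sum_(k <oo) (oapp (fun S => ediam S `^ d) 0 (F k) + (e k)%:E))).
    apply: lee_nneseries => [k _ _|k _]; last by case: (hG k).
    exact: oapp_ge0.
  apply: (le_trans (epsilon_trick _ _ (ltW c20))).
    by move=> k; exact: oapp_ge0.
  rewrite [in leRHS](splitr c) EFinD addeA; apply: leeD => //.
  rewrite (le_trans (ltW hF))//; apply: leeD => //; exact: le_hausdorff_content.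
Qed.

(** At one mesh only the content of an open neighbourhood is controlled, not its measure.
    Intersecting the neighbourhoods for the meshes 2 / (k + 1) gives a set whose trace on D has
    measure at most that of E; continuity from above, available because D has finite measure, then
    yields a finite intersection. *)
Lemma hausdorff_outer_regular (D E : set 'rV[R]_n) (e : R) :
  measurable (D : set hauT) -> hausdorff d D < +oo -> E `<=` D -> (0 < e)%R ->
  exists U, [/\ open U, E `<=` U & hausdorff d (U `&` D) <= hausdorff d E + e%:E].
Proof.
move=> mD Doo ED e0.
have Eoo : hausdorff d E < +oo := le_lt_trans (le_outer_measure _ _ _ ED) Doo.
have /choice[U hU] k : exists U, [/\ open U, E `<=` U &
    hausdorff_content d (2 * k.+1%:R^-1)%R U <= hausdorff d E + (k.+1%:R^-1)%:E].
  by apply: hausdorff_content_open => //; rewrite invr_gt0.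
pose W k := \bigcap_(j < k.+1) U j.
have oW k : open (W k).
  rewrite /W; elim: k => [|k IH].
    by rewrite bigcap_mkord big_ord1; case: (hU 0%N).
  rewrite bigcap_mkord big_ord_recr/= -bigcap_mkord; apply: openI => //.
  by case: (hU k.+1).
have EW k : E `<=` W k by move=> x Ex j _; case: (hU j) => _ + _; exact.
have mW k : measurable (W k `&` D : set hauT).
  by apply: measurableI => //; exact: hausdorff_measurable_open.
pose B := \bigcap_k (W k `&` D).
have HB : hausdorff d B <= hausdorff d E.
  apply: ge_ereal_sup => _ [c /= c0 <-].
  apply/lee_addgt0Pr => s s0.
  pose m := Num.min (c / 2)%R s; have m0 : (0 < m)%R by rewrite lt_min s0 divr_gt0.
  have hj := @truncnS_gt R m^-1; set j := Num.truncn _ in hj.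
  have jm : (j.+1%:R^-1 <= m)%R by rewrite invf_ple ?posrE// ltW.
  apply: (@le_trans _ _ (hausdorff_content d (2 * j.+1%:R^-1)%R (U j))).
    apply: (@le_trans _ _ (hausdorff_content d (2 * j.+1%:R^-1)%R B)).
      apply: hausdorff_content_anti; rewrite mulrC -ler_pdivlMr// (le_trans jm)//.
      by rewrite ge_min lexx.
    by apply: le_cover_outer => x /(_ j Logic.I)[+ _]; apply => /=.
  have [_ _ /le_trans] := hU j; apply; apply: leeD2l.
  by rewrite lee_fin (le_trans jm)// ge_min lexx orbT.
have := @nonincreasing_cvg_mu _ hauT R (hausd n d) (fun k => W k `&` D).
have mB : measurable (B : set hauT) by exact: bigcap_measurable.
have W0oo : hausd n d (W 0%N `&` D) < +oo.
  by apply: le_lt_trans Doo; apply: le_outer_measure => x [].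
move=> /(_ W0oo mW mB) cvW.
have {}cvW : hausdorff d (W k `&` D) @[k --> \oo] --> hausdorff d B.
  apply: cvW; apply/nonincreasing_seqP => k; apply/subsetPset => x [Wx Dx]; split=> // j /= jk.
  by apply: Wx => /=; rewrite (ltn_trans jk).
have Efin : hausdorff d E \is a fin_num by rewrite ge0_fin_numE ?outer_measure_ge0.
have : hausdorff d B < hausdorff d E + e%:E.
  by rewrite (le_lt_trans HB)// lteDl// lte_fin.
move=> /open_ereal_lt' /cvW[N _ /(_ N (leqnn N))/= h].
by exists (W N); split => //; exact: ltW.
Qed.

End HausdorffMetric.

(** * Lower integrals and averages *)

(* The library integral of a nonnegative function is the supremum of the
   integrals of the simple functions below it.  For functions that are not known
   to be measurable it is a lower integral: monotone and superadditive. *)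
Section LowerIntegral.
Context d (T : measurableType d) (R : realType).
Variable mu : {measure set T -> \bar R}.
Implicit Types (f g h : T -> \bar R) (D : set T).
Local Open Scope ereal_scope.
Import HBNNSimple.

Lemma lower_integral_le D f g : (forall x, D x -> 0 <= f x) ->
  (forall x, D x -> f x <= g x) ->
  \int[mu]_(x in D) f x <= \int[mu]_(x in D) g x.
Proof.
move=> f0 fg; rewrite [leLHS]integral_mkcond [leRHS]integral_mkcond.
rewrite !ge0_integralTE; last 2 first.
- by apply: erestrict_ge0 => x Dx; rewrite (le_trans (f0 _ Dx))// fg.
- exact: erestrict_ge0.
apply: le_ereal_sup => _ [h /= hf <-]; exists h => //= x.
apply: le_trans (hf x) _; rewrite /patch; case: ifPn => // /set_mem Dx.
exact: fg.
Qed.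

Lemma lower_integral_ge_sint f (a : {nnsfun T >-> R}) : (forall x, 0 <= f x) ->
  (forall x, (a x)%:E <= f x) -> sintegral mu a <= \int[mu]_x f x.
Proof. by move=> f0 af; rewrite ge0_integralTE//; apply: ereal_sup_ubound; exists a. Qed.

Lemma lower_integralD f g : (forall x, 0 <= f x) -> (forall x, 0 <= g x) ->
  \int[mu]_x f x + \int[mu]_x g x <= \int[mu]_x (f x + g x).
Proof.
move=> f0 g0; set M := \int[mu]_x (f x + g x).
have fg0 x : 0 <= f x + g x by rewrite adde_ge0.
have [->|Mfin] := eqVneq M +oo; first by rewrite leey.
have fM : \int[mu]_x f x <= M by apply: lower_integral_le => // x _; rewrite leeDl.
have gM : \int[mu]_x g x <= M by apply: lower_integral_le => // x _; rewrite leeDr.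
have ffin : \int[mu]_x f x \is a fin_num.
  by rewrite ge0_fin_numE ?integral_ge0// (le_lt_trans fM)// ltey.
have gfin : \int[mu]_x g x \is a fin_num.
  by rewrite ge0_fin_numE ?integral_ge0// (le_lt_trans gM)// ltey.
rewrite -leeBrDr// [leLHS]ge0_integralTE//.
apply: ge_ereal_sup => _ [a /= af <-].
have afin : sintegral mu a \is a fin_num.
  rewrite ge0_fin_numE ?sintegral_ge0//.
  by rewrite (le_lt_trans (lower_integral_ge_sint f0 af))// -ge0_fin_numE ?integral_ge0.
rewrite leeBrDr// addeC -leeBrDr// [leLHS]ge0_integralTE//.
apply: ge_ereal_sup => _ [b /= bg <-]; rewrite leeBrDr// addeC -sintegralD//.
by apply: (lower_integral_ge_sint (a := add_nnsfun a b)) => // x; rewrite /= EFinD leeD.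
Qed.

Lemma lower_integralZ f (c : R) : (0 <= c)%R -> (forall x, 0 <= f x) ->
  c%:E * \int[mu]_x f x <= \int[mu]_x (c%:E * f x).
Proof.
rewrite le_eqVlt => /predU1P[<-|c0] f0.
  by rewrite mul0e integral_ge0// => x _; rewrite mul0e.
rewrite -lee_pdivlMl// [leLHS]ge0_integralTE//.
apply: ge_ereal_sup => _ [a /= af <-]; rewrite lee_pdivlMl//.
rewrite -(sintegralrM mu c a).
apply: (lower_integral_ge_sint (a := scale_nnsfun a (ltW c0))) => x /=.
  by rewrite mule_ge0// lee_fin ltW.
by rewrite EFinM lee_wpmul2l// lee_fin ltW.
Qed.

(** The form in which sums and integrals are exchanged later, once for a single integral and twice
    in a row for a double one. *)
Lemma lower_integral_sum (I : Type) (s : seq I) (c : I -> R) (F : I -> T -> \bar R)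
    (G : T -> \bar R) :
  (forall i, (0 <= c i)%R) -> (forall i x, 0 <= F i x) ->
  (forall x, \sum_(i <- s) (c i)%:E * F i x <= G x) ->
  \sum_(i <- s) (c i)%:E * \int[mu]_x F i x <= \int[mu]_x G x.
Proof.
move=> c0 F0; have sum0 r x : 0 <= \sum_(i <- r) (c i)%:E * F i x.
  by apply: sume_ge0 => i _; rewrite mule_ge0// lee_fin.
elim: s G => [|i s IH] G FG.
  by rewrite big_nil integral_ge0// => x _; rewrite (le_trans _ (FG x))// big_nil.
rewrite big_cons; apply: le_trans (_ : _ <= \int[mu]_x ((c i)%:E * F i x +
    \sum_(j <- s) (c j)%:E * F j x)) _; last first.
  apply: lower_integral_le => x _; first by rewrite adde_ge0// mule_ge0// lee_fin.
  by have := FG x; rewrite big_cons.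
apply: le_trans (lower_integralD _ _) => [|x|x]; last 2 first.
- by rewrite mule_ge0// lee_fin.
- exact: sum0.
by apply: leeD; [exact: lower_integralZ|exact: IH].
Qed.

End LowerIntegral.

(** * Jensen's inequality for averages *)

Section Jensen.
Context d (T : measurableType d) (R : realType).
Variable mu : {measure set T -> \bar R}.
Implicit Types (f g : T -> R) (A B : set T).

Definition avg A f : R := (fine (mu A))^-1 * \int[mu]_(x in A) f x.

Section finite.
Variable A : set T.
Hypotheses (mA : measurable A) (A0 : (0 < mu A)%E) (Aoo : (mu A < +oo)%E).

Lemma fine_measure_gt0 : 0 < fine (mu A).
Proof. by rewrite fine_gt0// A0. Qed.

Lemma integrable_cst_finite (c : R) : mu.-integrable A (EFin \o cst c).
Proof.
apply/integrableP; split; first by apply/measurable_EFinP; exact: measurable_cst.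
by rewrite (integral_cst _ mA (`|c|%:E)%E) lte_mul_pinfty// lee_fin.
Qed.

Lemma avgB f (c : R) : mu.-integrable A (EFin \o f) ->
  avg A (fun x => f x - c) = avg A f - c.
Proof.
move=> If; rewrite /avg RintegralB//; last exact: integrable_cst_finite.
rewrite Rintegral_cst// mulrBr (mulrC c) mulKf ?gt_eqF//; exact: fine_measure_gt0.
Qed.

(** With m the average of f, integrate 2 m f - m^2 <= f^2; the left-hand side integrates to m^2
    times the measure. *)
Lemma sqr_avg_le f : mu.-integrable A (EFin \o f) ->
  ((avg A f ^+ 2)%:E * mu A <= \int[mu]_(x in A) (f x ^+ 2)%:E)%E.
Proof.
move=> If; have mf := measurable_int _ If.
have [->|foo] := eqVneq (\int[mu]_(x in A) (f x ^+ 2)%:E)%E +oo%E; first by rewrite leey.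
set m := avg A f.
have If2 : mu.-integrable A (EFin \o (fun x => f x ^+ 2)).
  apply/integrableP; split.
    by apply/measurable_EFinP/measurable_funX/measurable_EFinP.
  under eq_integral => x _ do rewrite /= ger0_norm ?sqr_ge0//.
  by rewrite ltey.
have Ifm : mu.-integrable A (EFin \o (fun x => 2 * m * f x - m ^+ 2)).
  have I1 : mu.-integrable A (EFin \o (fun x => 2 * m * f x)).
    rewrite (_ : _ \o _ = (fun x => (2 * m)%:E * (f x)%:E)%E); first exact: integrableZl.
    by apply/funext => x /=; rewrite EFinM.
  have := integrableB mA I1 (integrable_cst_finite (m ^+ 2)).
  by apply: eq_integrable => // x _ /=.
have : (\int[mu]_(x in A) (2 * m * f x - m ^+ 2) <= \int[mu]_(x in A) (f x ^+ 2)).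
  apply: le_Rintegral => // x _; rewrite -subr_ge0.
  by rewrite (_ : _ - _ = (f x - m) ^+ 2) ?sqr_ge0//; ring.
rewrite RintegralB//; last 2 first.
- rewrite (_ : _ \o _ = (fun x => (2 * m)%:E * (f x)%:E)%E); first exact: integrableZl.
  by apply/funext => x /=; rewrite EFinM.
- exact: integrable_cst_finite.
rewrite RintegralZl// Rintegral_cst//.
have -> : \int[mu]_(x in A) f x = m * fine (mu A).
  by rewrite /m /avg mulrC mulVKf// gt_eqF// fine_measure_gt0.
have -> : 2 * m * (m * fine (mu A)) - m ^+ 2 * fine (mu A) = m ^+ 2 * fine (mu A) by ring.
rewrite -lee_fin EFinM fineK; last by rewrite ge0_fin_numE.
by rewrite /Rintegral fineK//; exact: (integrable_fin_num mA If2).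
Qed.

Lemma sqr_avgB_le f (c : R) : mu.-integrable A (EFin \o f) ->
  (((avg A f - c) ^+ 2)%:E * mu A <= \int[mu]_(x in A) ((f x - c) ^+ 2)%:E)%E.
Proof.
move=> If; rewrite -avgB//; apply: sqr_avg_le.
have := integrableB mA If (integrable_cst_finite c).
by apply: eq_integrable => // x _ /=.
Qed.

End finite.

(** Jensen twice: in y with g(x) frozen, then in x with the average over B frozen. *)
Lemma sqr_avg_dist_le A B g :
  measurable A -> (0 < mu A)%E -> (mu A < +oo)%E -> mu.-integrable A (EFin \o g) ->
  measurable B -> (0 < mu B)%E -> (mu B < +oo)%E -> mu.-integrable B (EFin \o g) ->
  (((avg A g - avg B g) ^+ 2 * fine (mu A) * fine (mu B))%:E <=
   \int[mu]_(x in A) \int[mu]_(y in B) ((g x - g y) ^+ 2)%:E)%E.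
Proof.
move=> mA A0 Aoo Ag mB B0 Boo Bg.
have Bfin : mu B \is a fin_num by rewrite ge0_fin_numE.
have Afin : mu A \is a fin_num by rewrite ge0_fin_numE.
pose h x : R := (g x - avg B g) ^+ 2.
have h1 x : ((fine (mu B))%:E * (h x)%:E <= \int[mu]_(y in B) ((g x - g y) ^+ 2)%:E)%E.
  have := @sqr_avgB_le B mB B0 Boo g (g x) Bg.
  rewrite fineK// muleC /h -sqrrN opprB => /le_trans; apply.
  by under eq_integral do rewrite -sqrrN opprB.
apply: (@le_trans _ _ (\int[mu]_(x in A) ((fine (mu B))%:E * (h x)%:E)))%E; last first.
  apply: lower_integral_le => x _; last exact: h1.
  by rewrite mule_ge0// lee_fin ?sqr_ge0// fine_ge0.
have mg : measurable_fun A g by apply/measurable_EFinP; exact: measurable_int Ag.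
rewrite ge0_integralZl_EFin; last 4 first.
- exact: mA.
- by move=> x _; rewrite lee_fin sqr_ge0.
- by apply/measurable_EFinP/measurable_funX/measurable_funB.
- by rewrite fine_ge0.
rewrite mulrC EFinM lee_wpmul2l ?lee_fin ?fine_ge0//.
by rewrite EFinM fineK//; apply: sqr_avgB_le.
Qed.

End Jensen.

(** * Lebesgue points on an Ahlfors regular set *)

Lemma seq_argmax (R : realType) (T : eqType) (f : T -> R) (s : seq T) : s != [::] ->
  exists2 p, p \in s & forall q, q \in s -> f q <= f p.
Proof.
elim: s => // p s IH _; have [->|s0] := eqVneq s [::].
  by exists p; rewrite ?mem_head// => q; rewrite inE => /eqP ->.
have [p1 p1s h] := IH s0; have [pp|pp] := leP (f p) (f p1).
  exists p1; first by rewrite inE p1s orbT.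
  by move=> q; rewrite inE => /predU1P[->//|/h].
exists p; first by rewrite mem_head.
by move=> q; rewrite inE => /predU1P[->//|/h qp]; rewrite (le_trans qp)// ltW.
Qed.

Section FiniteVitali.
Context {R : realType} {n : nat}.
Implicit Types (s : seq ('rV[R]_n * R)) (p q : 'rV[R]_n * R).

Lemma ball_meet_sub p q (x : 'rV[R]_n) : p.2 <= q.2 ->
  ball p.1 p.2 x -> ball q.1 q.2 x -> ball p.1 p.2 `<=` ball q.1 (3 * q.2).
Proof.
rewrite -!ball_normE/= => pq px qx y; rewrite /ball_/= => py.
have h1 := ler_distD x q.1 y; have h2 := ler_distD p.1 x y.
by rewrite (distrC x p.1) in h2; lra.
Qed.

(** Greedy selection: keep a ball of largest radius, drop those that meet it (its triple contains
    them), and repeat. Disjointness is phrased as a sum of indicators at most 1, which is what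
    superadditivity of lower integrals consumes. *)
Lemma finite_vitali s : exists s', [/\ {subset s' <= s},
  forall x, \sum_(q <- s') \1_(ball q.1 q.2) x <= 1 :> R &
  forall p, p \in s -> exists2 q, q \in s' & ball p.1 p.2 `<=` ball q.1 (3 * q.2)].
Proof.
move: {2}(size s).+1 (ltnSn (size s)) => N.
elim: N s => // N IH s; rewrite ltnS => sN.
have [->|s0] := eqVneq s [::].
  by exists [::]; split => // x; rewrite big_nil.
have [p0 p0s pmax] := seq_argmax snd s0.
pose dis q := ~~ `[< exists x, ball p0.1 p0.2 x /\ ball q.1 q.2 x >].
(* The test [q != p0] guarantees that the list shrinks even when the ball [p0] is empty and hence
   disjoint from itself. *)
have [|s' [s's s'1 s'c]] := IH [seq q <- s | dis q && (q != p0)].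
  rewrite (leq_trans _ sN)// size_filter ltn_neqAle count_size andbT -all_count.
  by apply/allPn; exists p0 => //; rewrite eqxx andbF.
exists (p0 :: s'); split.
- by move=> q; rewrite inE => /predU1P[->//|/s's]; rewrite mem_filter => /andP[].
- move=> x; rewrite big_cons {1}indicE; have [xp0|xp0] := pselect (ball p0.1 p0.2 x); last first.
    by rewrite memNset// add0r.
  rewrite mem_set// big1_seq ?addr0// => q /andP[_ /s's]; rewrite mem_filter => /andP[/andP[+ _] _].
  move=> /asboolPn nq; rewrite indicE memNset// => xq; apply: nq; exists x; split => //.
- move=> p ps; have [dp|] := boolP (dis p && (p != p0)).
    have [|q qs' pq] := s'c p; first by rewrite mem_filter dp.
    by exists q => //; rewrite inE qs' orbT.
  rewrite negb_and negbK => /orP[/negPn|/eqP ->]; last first.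
    exists p0; first exact: mem_head.
    by move=> y yb; exact: (ball_meet_sub (lexx _) yb yb yb).
  move=> /asboolP[x [xp0 xp]]; exists p0; first exact: mem_head.
  exact: (ball_meet_sub (pmax _ ps) xp xp0).
Qed.

End FiniteVitali.

Section Ahlfors.
Context {R : realType} {n : nat} (d : R) (Gamma : set 'rV[R]_n).
Hypotheses (d0 : 0 < d) (cG : closed Gamma) (aG : ahlfors_regular d Gamma).
Local Notation hauT := (caratheodory_type (@hausdorff R n d)).
Local Notation sigma := (hausd n d).

Lemma ahlfors_ball_le : exists2 C : R, 0 < C & forall x r, Gamma x -> 0 < r ->
  (hausdorff d (Gamma `&` ball x r) <= (C * r `^ d)%:E)%E.
Proof.
have [C C1 hC] := aG; exists (C * n.+1%:R `^ d).
  by rewrite mulr_gt0 ?powR_gt0// (lt_le_trans _ C1).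
move=> x r Gx r0; have nr0 : 0 < n.+1%:R * r by rewrite mulr_gt0.
have /andP[_ h] := hC x _ Gx nr0.
rewrite -mulrA -powRM ?(ltW r0)//; apply: le_trans h.
by apply: le_outer_measure; apply: setIS; exact: ball_sub_eball.
Qed.

Lemma ahlfors_eball_ge : exists2 c : R, 0 < c & forall x r, Gamma x -> 0 < r ->
  ((c * r `^ d)%:E <= hausdorff d (Gamma `&` eball x r))%E.
Proof.
have [C C1 hC] := aG; exists C^-1; first by rewrite invr_gt0 (lt_le_trans _ C1).
by move=> x r Gx r0; have /andP[] := hC x _ Gx r0.
Qed.

(** The centre may lie off Gamma: a nonempty intersection is contained in a ball of twice the radius
    around one of its points. *)
Lemma ahlfors_bounded x (r : R) : (hausdorff d (Gamma `&` ball x r) < +oo)%E.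
Proof.
have [C C0 hC] := ahlfors_ball_le.
have [->|/set0P[y [Gy xy]]] := eqVneq (Gamma `&` ball x r) set0.
  by rewrite outer_measure0 ltry.
have r0 : 0 < r + r.
  by move: xy; rewrite -ball_normE/= => h; rewrite addr_gt0//; exact: le_lt_trans h.
apply: le_lt_trans (le_lt_trans (hC _ _ Gy r0) (ltry _)).
apply: le_outer_measure => z [Gz xz]; split=> //.
exact: ball_triangle (ball_sym xy) xz.
Qed.

Lemma ahlfors_measurable : measurable (Gamma : set hauT).
Proof. exact: hausdorff_measurable_closed. Qed.

Lemma ahlfors_measurable_ball x r : measurable (Gamma `&` ball x r : set hauT).
Proof.
apply: measurableI; first exact: ahlfors_measurable.
by apply: hausdorff_measurable_open; exact: ball_open.
Qed.

Lemma ahlfors_measurable_eball x r : measurable (Gamma `&` eball x r : set hauT).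
Proof.
apply: measurableI; first exact: ahlfors_measurable.
by apply: hausdorff_measurable_open => //; exact: open_eball.
Qed.

End Ahlfors.

(** * Vitali covering and upper densities *)

Section Differentiation.
Context {R : realType} {n : nat} (d : R) (Gamma : set 'rV[R]_n).
Hypotheses (d0 : 0 < d) (cG : closed Gamma) (aG : ahlfors_regular d Gamma).
Local Notation hauT := (caratheodory_type (@hausdorff R n d)).
Local Notation sigma := (hausd n d).
Local Open Scope ereal_scope.

Lemma outer_measure_bigsetU (T : Type) (mu : {outer_measure set T -> \bar R})
    (I : Type) (s : seq I) (A : I -> set T) :
  mu (\big[setU/set0]_(i <- s) A i) <= \sum_(i <- s) mu (A i).
Proof.
elim/big_rec2 : _ => [|i B b _ h]; first by rewrite outer_measure0.
exact: le_trans (outer_measureU2 _ _ _) (leeD2l _ h).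
Qed.

Lemma sum_disjoint_integral (f : 'rV[R]_n -> R) (U : set 'rV[R]_n)
    (s : seq ('rV[R]_n * R)) : (forall x, 0 <= f x)%R ->
  (forall x, \sum_(q <- s) \1_(ball q.1 q.2) x <= 1 :> R)%R ->
  (forall q, q \in s -> ball q.1 q.2 `<=` U) ->
  \sum_(q <- s) \int[sigma]_(x in Gamma `&` ball q.1 q.2) (f x)%:E <=
  \int[sigma]_(x in Gamma `&` U) (f x)%:E.
Proof.
move=> f0 s1 sU; rewrite [leRHS]integral_mkcond.
pose F (q : 'rV[R]_n * R) (x : hauT) : \bar R :=
  (f x * (\1_Gamma x * \1_(ball q.1 q.2) x))%:E.
have FE (V : set 'rV[R]_n) x : ((fun x => (f x)%:E) \_ (Gamma `&` V)) x =
    (f x * (\1_Gamma x * \1_V x))%:E.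
  rewrite patchE in_setI !indicE.
  by case: (x \in Gamma) => /=; case: (x \in V); rewrite ?(mulr0, mul0r, mulr1).
rewrite (eq_bigr (fun q => 1%:E * \int[sigma]_x (F q x))); last first.
  move=> q _; rewrite mul1e integral_mkcond; apply: eq_integral => x _.
  by rewrite FE.
apply: (@lower_integral_sum _ _ _ sigma _ s (fun=> 1%R) F) => [i|q x|x].
- by [].
- by rewrite lee_fin !mulr_ge0.
rewrite FE; under eq_bigr do rewrite mul1e.
rewrite sumEFin lee_fin -mulr_sumr ler_wpM2l// -mulr_sumr ler_wpM2l//.
have [xU|xU] := pselect (U x); first by rewrite indicE mem_set.
rewrite big1_seq// => q /andP[_ qs]; rewrite indicE memNset// => xq; apply: xU.
exact: sU xq.
Qed.

Let ratball (p : 'rV[rat]_n * rat) : 'rV[R]_n * R := (ratv p.1, ratr p.2).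

(** Rational balls make the cover countable. Its finite stages increase to a set containing E; each
    stage is thinned to a disjoint subfamily whose triples still cover it, and continuity from below
    concludes. *)
Lemma vitali_bound (f : 'rV[R]_n -> R) (a : R) (E U : set 'rV[R]_n) :
  (forall x, 0 <= f x)%R -> (0 < a)%R ->
  (forall x, E x -> exists p, [/\ ball (ratball p).1 (ratball p).2 x,
     ball (ratball p).1 (ratball p).2 `<=` U &
     a%:E * hausdorff d (Gamma `&` ball (ratball p).1 (3 * (ratball p).2)%R) <=
     \int[sigma]_(x in Gamma `&` ball (ratball p).1 (ratball p).2) (f x)%:E]) ->
  E `<=` Gamma ->
  a%:E * hausdorff d E <= \int[sigma]_(x in Gamma `&` U) (f x)%:E.
Proof.
move=> f0 a0 cov EG.
pose P p := `[< ball (ratball p).1 (ratball p).2 `<=` U /\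
     a%:E * hausdorff d (Gamma `&` ball (ratball p).1 (3 * (ratball p).2)%R) <=
     \int[sigma]_(x in Gamma `&` ball (ratball p).1 (ratball p).2) (f x)%:E >].
pose B (q : 'rV[R]_n * R) := Gamma `&` ball q.1 q.2.
pose L N := [seq ratball p | p <- pmap unpickle (iota 0 N) & P p].
pose G N : set hauT := \big[setU/set0]_(q <- L N) B q.
have mB q : measurable (B q : set hauT) by exact: ahlfors_measurable_ball.
have mG N : measurable (G N : set hauT) by apply: bigsetU_measurable => q _; exact: mB.
have GP N x : G N x <-> exists2 q, q \in L N & B q x.
  rewrite /G -bigcup_seq; split=> [[q /= qL qx]|[q qL qx]]; by exists q.
have LP p : P p -> forall N, (pickle p < N)%N -> ratball p \in L N.
  move=> Pp N pN; apply: map_f; rewrite mem_filter Pp/= mem_pmap.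
  by apply/mapP; exists (pickle p); rewrite ?pickleK// mem_iota.
have sG : nondecreasing_seq G.
  apply/nondecreasing_seqP => N; apply/subsetPset => x /GP[q qL qx].
  move: qL qx => /mapP[p pL ->] qx; apply/GP.
  exists (ratball p) => //; apply: map_f; move: pL; rewrite !mem_filter => /andP[-> pL].
  move: pL; rewrite andTb !mem_pmap => /mapP[k]; rewrite mem_iota => kN e.
  by apply/mapP; exists k => //; rewrite mem_iota; move: kN; rewrite !add0n => /ltnW.
have EU : E `<=` \bigcup_N G N.
  move=> x Ex; have [p [px pU pI]] := cov _ Ex; exists (pickle p).+1 => //.
  apply/GP; exists (ratball p); last by split => //; exact: EG.
  by apply: LP => //; apply/asboolP.
rewrite -lee_pdivlMl//; apply: le_trans (le_outer_measure _ _ _ EU) _.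
have := @nondecreasing_cvg_mu _ hauT R sigma G mG (bigcup_measurable (fun k _ => mG k)) sG.
move/cvg_lim => <-//; apply: lime_le.
  apply: ereal_nondecreasing_is_cvgn => i j ij; apply: le_outer_measure.
  exact/subsetPset/sG.
apply: nearW => N /=; rewrite lee_pdivlMl//.
have [s' [s's s'1 s'c]] := finite_vitali (L N).
have sP q : q \in s' -> ball q.1 q.2 `<=` U /\
    a%:E * hausdorff d (Gamma `&` ball q.1 (3 * q.2)%R) <=
    \int[sigma]_(x in Gamma `&` ball q.1 q.2) (f x)%:E.
  by move=> /s's/mapP[p + ->]; rewrite mem_filter => /andP[/asboolP].
apply: le_trans (sum_disjoint_integral f0 s'1 (fun q qs => (sP q qs).1)).
apply: (@le_trans _ _ (\sum_(q <- s') a%:E * hausdorff d (Gamma `&` ball q.1 (3 * q.2)%R))).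
  rewrite -ge0_sume_distrr; last by move=> i _; exact: outer_measure_ge0.
  apply: lee_wpmul2l; first by rewrite lee_fin ltW.
  apply: le_trans (outer_measure_bigsetU _ _ _).
  apply: le_outer_measure => x /GP[q qL [Gx qx]].
  have [q' q's qq'] := s'c _ qL.
  by rewrite -bigcup_seq; exists q' => //=; split => //; exact: qq'.
rewrite big_seq [leRHS]big_seq; apply: lee_sum => q qs.
exact: (sP q qs).2.
Qed.

(** Passage from B(x, r) to a rational ball B(q, s) with r < s < 2r and |x - q| < s - r. It contains
    B(x, r), stays in B(x, 3r), and its triple stays in B(x, 8r) since 3s + (s - r) < 8r; hence the
    factor 8^d. *)
Lemma upper_density_bound : exists2 K : R, (0 < K)%R &
  forall (f : 'rV[R]_n -> R) (a r : R) (x : 'rV[R]_n) (U : set 'rV[R]_n),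
  (forall x, 0 <= f x)%R -> (0 < a)%R -> Gamma x -> (0 < r)%R -> ball x (3 * r)%R `<=` U ->
  (K * a * r `^ d)%:E <= \int[sigma]_(y in Gamma `&` ball x r) (f y)%:E ->
  exists p, [/\ ball (ratball p).1 (ratball p).2 x,
     ball (ratball p).1 (ratball p).2 `<=` U &
     a%:E * hausdorff d (Gamma `&` ball (ratball p).1 (3 * (ratball p).2)%R) <=
     \int[sigma]_(x in Gamma `&` ball (ratball p).1 (ratball p).2) (f x)%:E].
Proof.
have [C C0 hC] := ahlfors_ball_le aG.
exists (C * 8 `^ d)%R; first by rewrite mulr_gt0 ?powR_gt0.
move=> f a r x U f0 a0 Gx r0 xU fx.
have r2 : (r < 2 * r)%R by lra.
have [s] := rat_in_itvoo r2; rewrite in_itv/= => /andP[rs s2].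
have sr : (0 < ratr s - r :> R)%R by lra.
have [q hq] := ratv_dense x sr.
have s0 : (0 < ratr s :> R)%R by lra.
exists (q, s); rewrite /ratball/=; split.
- by rewrite -ball_normE/= distrC (lt_trans hq)//; lra.
- apply: subset_trans xU => y; rewrite -!ball_normE/= => yq.
  by have := ler_distD (ratv q) x y; lra.
- apply: (@le_trans _ _ (\int[sigma]_(y in Gamma `&` ball x r) (f y)%:E)); last first.
    change (\int[sigma]_(y in Gamma `&` ball x r) (f y)%:E <=
      \int[sigma]_(y in Gamma `&` ball (ratv q) (ratr s)) (f y)%:E).
    rewrite integral_mkcond [leRHS]integral_mkcond; apply: lower_integral_le.
      by move=> y _; apply: erestrict_ge0 => z _; rewrite lee_fin.
    move=> y _; rewrite !patchE; case: ifPn => [|_]; last first.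
      by case: ifPn => // _; rewrite lee_fin.
    rewrite inE => -[Gy xy]; rewrite mem_set//; split => //.
    move: xy; rewrite -!ball_normE/= => xy.
    by have := ler_distD x (ratv q) y; rewrite (distrC (ratv q) x); lra.
  apply: le_trans fx.
  have -> : (C * 8 `^ d * a * r `^ d = a * (C * (8 `^ d * r `^ d)))%R by ring.
  rewrite [leRHS]EFinM; apply: lee_wpmul2l; first by rewrite lee_fin ltW.
  have r4 : (0 < 8 * r)%R by lra.
  rewrite -powRM ?(ltW r0)//; apply: le_trans (hC _ _ Gx r4).
  apply: le_outer_measure => y [Gy]; rewrite -!ball_normE/= => yq; split => //=.
  by have := ler_distD (ratv q) x y; rewrite /=; lra.
Qed.

(** On a small neighbourhood U of E, f is below a except on a set that contributes little, so its
    integral over U is at most a H^d(E) plus an error. The density hypothesis makes the same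
    integral at least 2 a H^d(E). The factor 2 in the constant lets H^d(E) be absorbed, as it is
    finite. *)
Lemma null_upper_density : exists2 K : R, (0 < K)%R &
  forall (f : 'rV[R]_n -> R) (a rho : R) (E : set 'rV[R]_n),
  (forall x, 0 <= f x)%R -> (0 < a)%R ->
  sigma.-integrable (Gamma `&` ball 0%R rho) (EFin \o f) ->
  E `<=` (Gamma `&` ball 0%R rho) `&` [set x | (f x < a)%R] ->
  (forall x, E x -> forall e, (0 < e)%R -> exists r, [/\ (0 < r)%R, (r < e)%R &
     (K * a * r `^ d)%:E <= \int[sigma]_(y in Gamma `&` ball x r) (f y)%:E]) ->
  hausdorff d E = 0.
Proof.
have [K0 K00 hK] := upper_density_bound; exists (2 * K0)%R; first by rewrite mulr_gt0.
move=> f a rho E f0 a0 If EDf hE.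
set D := Gamma `&` ball 0%R rho in If EDf.
have ED : E `<=` D by move=> x /EDf[].
have mD : measurable (D : set hauT) by exact: ahlfors_measurable_ball.
have Doo : hausdorff d D < +oo by exact: ahlfors_bounded.
have fin S : S `<=` D -> hausdorff d S \is a fin_num.
  move=> SD; rewrite ge0_fin_numE ?outer_measure_ge0//.
  exact: le_lt_trans (le_outer_measure _ _ _ SD) Doo.
pose A := D `&` [set x | (f x < a)%R].
have mf : measurable_fun (D : set hauT) f.
  by apply/measurable_EFinP; exact: measurable_int If.
have mA : measurable (A : set hauT).
  have := mf mD `]-oo, a[%classic (measurable_itv _).
  by rewrite (_ : D `&` f @^-1` _ = A)// /A set_itvNyo.
have key U : open U -> E `<=` U -> U `<=` ball 0%R rho ->
    (2 * a)%:E * hausdorff d E <= \int[sigma]_(x in Gamma `&` U) (f x)%:E.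
  move=> oU EU Urho; apply: vitali_bound => //; first by rewrite mulr_gt0.
    move=> x Ex; have [e /= e0 xeU] : exists2 e : R, (0 < e)%R & ball x e `<=` U.
      by move: oU; rewrite openE => /(_ x (EU _ Ex)) /nbhs_ballP.
    have e3 : (0 < e / 3)%R by rewrite divr_gt0.
    have [r [r0 re fr]] := hE _ Ex _ e3.
    apply: (hK f (2 * a)%R r x U f0 _ (ED _ Ex).1 r0); first by rewrite mulr_gt0.
      by apply: subset_trans xeU; apply: le_ball; lra.
    by have -> : (K0 * (2 * a) = 2 * K0 * a)%R by ring.
  by move=> x /ED[].
have fDE : EFin \o (f \_ D) = (EFin \o f) \_ D by rewrite restrict_EFin.
have IfD : sigma.-integrable setT (EFin \o (f \_ D)).
  by rewrite fDE; exact/(integrable_mkcond _ mD).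
suff H (t : R) : (0 < t)%R -> hausdorff d E <= (2 * t)%:E.
  apply/eqP; rewrite eq_le outer_measure_ge0 andbT.
  apply/lee_addgt0Pr => e e0; rewrite add0e; apply: le_trans (H (e / 2)%R _) _.
    by rewrite divr_gt0.
  by rewrite lee_fin mulrC divfK.
move=> t0; have at0 : (0 < a * t)%R by rewrite mulr_gt0.
have [dl [dl0 hdl]] := integral_normr_continuous IfD at0.
pose e := Num.min (dl / 2)%R t; have e0 : (0 < e)%R by rewrite lt_min t0 divr_gt0.
have edl : (e < dl)%R by rewrite gt_min; apply/orP; left; lra.
have et : (e <= t)%R by rewrite ge_min lexx orbT.
(* [U1] bounds the measure of U by that of E, while [U2] makes the part of U outside [A], where f
   may be large, so small that absolute continuity applies. *)
have [U1 [oU1 EU1 hU1]] := hausdorff_outer_regular d0 mD Doo ED e0.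
have AD : A `<=` D by move=> x [].
have [U2 [oU2 AU2 hU2]] := hausdorff_outer_regular d0 mD Doo AD e0.
pose U := U1 `&` U2 `&` ball 0%R rho.
have oU : open U by apply: openI; [exact: openI|exact: ball_open].
have mU : measurable (U : set hauT) by exact: hausdorff_measurable_open.
have EU : E `<=` U.
  move=> x Ex; split; last by case: (ED _ Ex).
  by split; [exact: EU1|apply: AU2; exact: EDf].
have GU : Gamma `&` U = (D `&` U).
  apply/seteqP; split => x [h1 h2]; last by split => //; case: h1.
  by split => //; split => //; case: h2.
have := key U oU EU (@subIsetr _ _ _); rewrite GU.
have mDU : measurable (D `&` U : set hauT) by exact: measurableI.
have mDUA : measurable ((D `&` U) `&` A : set hauT) by exact: measurableI.
have mDUnA : measurable ((D `&` U) `\` A : set hauT) by exact: measurableD.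
have eDU : (D `&` U) `&` A `|` (D `&` U) `\` A = D `&` U.
  apply/seteqP; split => x; first by move=> [[]|[]].
  by move=> DUx; have [Ax|nAx] := pselect (A x); [left|right].
have split_f : \int[sigma]_(x in D `&` U) (f x)%:E =
  \int[sigma]_(x in (D `&` U) `&` A) (f x)%:E + \int[sigma]_(x in (D `&` U) `\` A) (f x)%:E.
  have := @ge0_integral_setU _ hauT R sigma _ _ mDUA mDUnA (EFin \o f).
  rewrite eDU; apply.
  - by apply/measurable_EFinP; apply: measurable_funS mf => // x [].
  - by move=> x _; rewrite lee_fin.
  - by apply/disj_setPS => x [[_ Ax] [_ nAx]].
rewrite split_f => {}key.
have I1 : \int[sigma]_(x in (D `&` U) `&` A) (f x)%:E <= a%:E * (hausdorff d E + t%:E).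
  apply: (@le_trans _ _ (a%:E * sigma ((D `&` U) `&` A))).
    rewrite -(integral_cst sigma mDUA a%:E).
    apply: lower_integral_le => x [_ [_ /= fa]]; rewrite lee_fin//.
    exact: ltW.
  apply: lee_wpmul2l; first by rewrite lee_fin ltW.
  apply: (@le_trans _ _ (hausdorff d E + e%:E)); last by rewrite leeD2l.
  by apply: le_trans hU1; apply: le_outer_measure => x [[Dx [[U1x _] _]] _].
have I2 : \int[sigma]_(x in (D `&` U) `\` A) (f x)%:E <= (a * t)%:E.
  have sm : sigma ((D `&` U) `\` A) < dl%:E.
    apply: (@le_lt_trans _ _ e%:E); last by rewrite lte_fin.
    have := mA (U2 `&` D); rewrite (_ : U2 `&` D `&` A = A); last first.
      by apply/seteqP; split => x; [case|move=> Ax; split => //; split; [exact: AU2|exact: AD]].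
    move=> eq2; have := hU2; rewrite [leLHS]eq2.
    rewrite leeD2lE; last exact: fin.
    apply: le_trans; apply: le_outer_measure => x [[Dx [[_ U2x] _]] nAx].
    by split.
  have := hdl _ mDUnA sm; move/ltW; rewrite -lee_fin; apply: le_trans.
  rewrite /Rintegral fineK.
    apply: lower_integral_le => x [[Dx _] _]; rewrite lee_fin// patchE mem_set//.
    exact: ler_norm.
  have : sigma.-integrable ((D `&` U) `\` A) (EFin \o (fun x => `|(f \_ D) x|%R)).
    apply: (@integrableS _ _ _ sigma setT) => //.
    exact: integrable_norm.
  exact: integrable_fin_num.
have := le_trans key (leeD I1 I2).
move: (fin _ ED); case: (hausdorff d E) => // h _.
rewrite -!EFinM -!EFinD !lee_fin => hh.
have : (a * h <= a * (2 * t))%R by lra.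
by rewrite ler_pM2l.
Qed.

End Differentiation.

Section LebesguePoints.
Context {R : realType} {n : nat} (d : R) (Gamma : set 'rV[R]_n).
Hypotheses (d0 : 0 < d) (cG : closed Gamma) (aG : ahlfors_regular d Gamma).
Local Notation hauT := (caratheodory_type (@hausdorff R n d)).
Local Notation sigma := (hausd n d).
Local Open Scope ereal_scope.

Lemma compact_closed_ball_ (x : 'rV[R]_n) (r : R) : compact (closed_ball_ Num.norm x r).
Proof.
apply: bounded_closed_compact; last exact: closed_closed_ball_.
exists (`|x| + r)%R; split; first exact: num_real.
move=> M hM y /=; rewrite /closed_ball_/= => hy.
rewrite (le_trans _ (ltW hM))// -(subrK x y) (le_trans (ler_normD _ _))//.
by rewrite addrC lerD2l distrC.
Qed.

Lemma L1loc_integrable_ball (mu : {outer_measure set 'rV[R]_n -> \bar R})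
    (g : 'rV[R]_n -> R) (F : set 'rV[R]_n) x (r : R) :
  (forall U, open U -> measurable (U : set (caratheodory_type mu))) ->
  closed F -> L1loc mu F g ->
  (cara_measure mu).-integrable (F `&` ball x r) (EFin \o g).
Proof.
move=> mO cF [mg Ig].
have mC V : closed V -> measurable (V : set (caratheodory_type mu)).
  by move=> cV; rewrite -(setCK V); apply/measurableC/mO/closed_openC.
have cK : compact (closed_ball_ Num.norm x r `&` F).
  apply: compact_closedI => //; exact: compact_closed_ball_.
apply: (integrableS _ _ _ (Ig _ cK (@subIsetr _ _ _))).
- by apply: measurableI; apply: mC => //; exact: closed_closed_ball_.
- by apply: measurableI; [exact: mC|apply: mO; exact: ball_open].
- by move=> y [Fy]; rewrite -ball_normE/= => xy; split => //; exact: ltW.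
Qed.

Lemma null_outer_negligible (mu : {outer_measure set 'rV[R]_n -> \bar R})
    (N : set 'rV[R]_n) : mu N = 0 -> (cara_measure mu).-negligible N.
Proof.
move=> N0; exists N; split => //.
apply: le_caratheodory_measurable => X.
have -> : mu (X `&` N) = 0.
  apply/eqP; rewrite eq_le outer_measure_ge0 andbT -N0.
  by apply: le_outer_measure => x [].
by rewrite add0e; apply: le_outer_measure => x [].
Qed.

Lemma countable_bigcup_negligible d' (T : measurableType d') (I : countType)
    (mu : {measure set T -> \bar R}) (F : I -> set T) :
  (forall i, mu.-negligible (F i)) -> mu.-negligible (\bigcup_i F i).
Proof.
move=> NF; pose G k := if unpickle k is Some i then F i else set0.
have GU : \bigcup_i F i `<=` \bigcup_k G k.
  by move=> x [i _ Fx]; exists (pickle i) => //; rewrite /G pickleK.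
apply: (negligibleS GU); apply: negligible_bigcup => k; rewrite /G; case: (unpickle k) => // .
exact: negligible_set0.
Qed.

(* By Ahlfors regularity the measure of the ball may be replaced by [r `^ d]. *)
Definition lebesgue_point (g : 'rV[R]_n -> R) (x : 'rV[R]_n) :=
  forall e : R, (0 < e)%R -> exists2 r0 : R, (0 < r0)%R &
    forall r, (0 < r)%R -> (r < r0)%R ->
    \int[sigma]_(y in Gamma `&` ball x r) `|g y - g x|%:E <= (e * r `^ d)%:E.

(** At an exceptional point x, take q rational close to g(x) and a rational between |g(x) - q| and
    the tolerance: |g - q| is below a at x but has upper density at least a multiple of a there.
    Such points form a null set for each (q, a). *)
Theorem ae_lebesgue_point (g : 'rV[R]_n -> R) : L1loc (@hausdorff R n d) Gamma g ->
  {ae sigma, forall x, Gamma x -> lebesgue_point g x}.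
Proof.
move=> Lg.
have Ig x r : sigma.-integrable (Gamma `&` ball x r) (EFin \o g).
  by apply: L1loc_integrable_ball => // U; exact: hausdorff_measurable_open.
have mD x r : measurable (Gamma `&` ball x r : set hauT) by exact: ahlfors_measurable_ball.
have [K K0 hK] := null_upper_density d0 cG aG.
have [C C0 hC] := ahlfors_ball_le aG.
pose f (q : rat) (y : 'rV[R]_n) : R := `|g y - ratr q|%R.
have If q x r : sigma.-integrable (Gamma `&` ball x r) (EFin \o f q).
  apply: integrable_norm => //.
  have := integrableB (mD x r) (Ig x r)
    (@integrable_cst_finite _ hauT R sigma _ (mD x r) (ahlfors_bounded aG x r) (ratr q)).
  by apply: eq_integrable => // y _ /=.
(* The index is (q, a, m); the ball of radius m around 0 makes the measure finite and |g - q|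
   integrable. *)
pose N (i : rat * rat * nat) : set 'rV[R]_n :=
  [set x | [/\ (Gamma `&` ball 0%R i.2%:R) x, (f i.1.1 x < ratr i.1.2)%R,
    (0 < ratr i.1.2 :> R)%R &
    forall e, (0 < e)%R -> exists r, [/\ (0 < r)%R, (r < e)%R &
     (K * ratr i.1.2 * r `^ d)%:E <= \int[sigma]_(y in Gamma `&` ball x r) (f i.1.1 y)%:E]]].
have N0 i : sigma.-negligible (N i).
  apply: null_outer_negligible.
  have [a0|a0] := leP (ratr i.1.2 : R) 0%R.
    rewrite (_ : N i = set0) ?outer_measure0//.
    by apply/seteqP; split => x // [_ _ +]; rewrite ltNge a0.
  apply: (hK (f i.1.1) (ratr i.1.2) i.2%:R) => //.
  - by move=> x; exact: normr_ge0.
  - by move=> x [].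
  - by move=> x [_ _ _].
apply: (negligibleS _ (countable_bigcup_negligible N0)) => x nx.
apply: contrapT => nN; apply: nx => Gx e e0.
(* K e' accounts for the mean of |g - q|, and C e' for |q - g(x)| times the measure of the ball. *)
pose e' := (e / (K + C))%R; have e'0 : (0 < e')%R by rewrite divr_gt0// addr_gt0.
have [q hq] := @rat_in_itvoo R (g x - e')%R (g x + e')%R ltac:(lra).
have {}hq : (f q x < e')%R.
  by move: hq; rewrite in_itv/= /f => /andP[h1 h2]; rewrite ltr_distl; lra.
have [a] := rat_in_itvoo hq; rewrite in_itv/= => /andP[fa ae].
have a0 : (0 < ratr a :> R)%R by exact: (le_lt_trans (normr_ge0 _) fa).
have hm := @truncnS_gt R `|x|%R; set m := Num.truncn _ in hm.
have : exists2 r0 : R, (0 < r0)%R & forall r, (0 < r)%R -> (r < r0)%R ->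
    \int[sigma]_(y in Gamma `&` ball x r) (f q y)%:E <= (K * ratr a * r `^ d)%:E.
  apply: contrapT => h; apply: nN; exists (q, a, m.+1) => //; split => //=.
    by split => //; rewrite -ball_normE/= sub0r normrN.
  move=> s s0; apply: contrapT => h'; apply: h; exists s => // r r0 rs.
  by rewrite leNgt; apply/negP => h; apply: h'; exists r; split => //; exact: ltW.
move=> [r0 r00 hr]; exists r0 => // r rpos rr0.
have h1 := hr _ rpos rr0; have h2 := hC x r Gx rpos.
apply: (@le_trans _ _ (\int[sigma]_(y in Gamma `&` ball x r) ((f q y)%:E + e'%:E))).
  apply: (@lower_integral_le _ hauT R sigma (Gamma `&` ball x r)) => y _.
    by rewrite lee_fin normr_ge0.
  rewrite -EFinD lee_fin; apply: le_trans (ler_distD (ratr q) _ _) _.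
  by rewrite lerD2l distrC ltW.
have fq0 : forall y : hauT, (Gamma `&` ball x r) y -> 0 <= (f q y)%:E.
  by move=> y _; rewrite lee_fin normr_ge0.
have e'0E : forall y : hauT, (Gamma `&` ball x r) y -> 0 <= (cst e'%:E y).
  by move=> y _; rewrite lee_fin ltW.
rewrite (@ge0_integralD _ hauT R sigma _ (mD x r) _ _ fq0 (measurable_int _ (If q x r))
  e'0E (measurable_cst _)).
rewrite (integral_cst sigma (mD x r) e'%:E).
have -> : (e * r `^ d = K * e' * r `^ d + e' * (C * r `^ d))%R.
  by rewrite /e'; field; rewrite gt_eqF// addr_gt0.
rewrite EFinD; apply: leeD.
  apply: le_trans h1 _; rewrite lee_fin ler_wpM2r ?powR_ge0// ler_wpM2l ?ltW//.
by rewrite [leRHS]EFinM; apply: lee_wpmul2l => //; rewrite lee_fin ltW.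
Qed.

End LebesguePoints.

(** * Dyadic and Whitney cubes *)

Section LevelSums.
Context {R : realType}.

Lemma geometric_sum_le (t : R) (J : nat) : 0 <= t -> t < 1 ->
  \sum_(j < J) t ^+ j <= (1 - t)^-1.
Proof.
move=> t0 t1; have t1' : 0 < 1 - t by rewrite subr_gt0.
rewrite -[leRHS]mul1r ler_pdivlMr//.
have := subrX1 t J; rewrite mulrC => e.
have -> : (\sum_(j < J) t ^+ j) * (1 - t) = 1 - t ^+ J by lra.
by rewrite gerBl exprn_ge0.
Qed.

Lemma sum_levels (T : eqType) (s : seq T) (h : T -> nat) (v : T -> R) (N : nat) (V t : R) :
  0 <= V -> 0 <= t -> t < 1 ->
  (forall j, (count (fun Q => h Q == j) s <= N)%N) ->
  (forall Q, Q \in s -> v Q <= V * t ^+ h Q) ->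
  \sum_(Q <- s) v Q <= N%:R * V * (1 - t)^-1.
Proof.
move=> V0 t0 t1 hN hv; pose J := (\max_(Q <- s) h Q).+1.
apply: (@le_trans _ _ (\sum_(Q <- s) \sum_(j < J | j == h Q :> nat) V * t ^+ j)).
  rewrite big_seq [leRHS]big_seq; apply: ler_sum => Q Qs.
  have hJ : (h Q < J)%N by rewrite ltnS leq_bigmax_seq.
  by rewrite (big_pred1 (Ordinal hJ)) ?hv.
rewrite (exchange_big_dep xpredT)//=.
apply: (@le_trans _ _ (\sum_(j < J) N%:R * V * t ^+ j)).
  apply: ler_sum => j _; rewrite big_const_seq iter_addr_0 -[leLHS]mulr_natl -mulrA.
  rewrite ler_wpM2r ?mulr_ge0 ?exprn_ge0// ler_nat.
  by rewrite (eq_count (a2 := fun Q => h Q == j))// => Q /=; rewrite eq_sym.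
by rewrite -mulr_sumr ler_wpM2l ?geometric_sum_le// mulr_ge0.
Qed.

End LevelSums.

Section DyadicCubes.
Context {R : realType} {n : nat}.
Implicit Types (Q : @dyadic n) (x y : 'rV[R]_n).

Lemma side_gt0 Q : 0 < side Q :> R.
Proof. exact: exprz_gt0. Qed.

Lemma side_ge0 Q : 0 <= side Q :> R.
Proof. exact/ltW/side_gt0. Qed.

Lemma center_coord Q i (x : 'rV[R]_n) :
  ((Q.2 ord0 i)%:~R * side Q <= x ord0 i <= ((Q.2 ord0 i)%:~R + 1) * side Q) =
  (`|(center Q - x) ord0 i| <= side Q / 2).
Proof.
rewrite !mxE ler_norml; apply/idP/idP => /andP[h1 h2]; apply/andP; split; lra.
Qed.

Lemma cubeE Q : cube Q = closed_ball_ Num.norm (center Q : 'rV[R]_n) (side Q / 2).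
Proof.
have s2 : 0 <= side Q / 2 :> R by rewrite divr_ge0// side_ge0.
apply/seteqP; split=> x /=.
  by move=> h; apply/(norm_rVP _ s2) => i; rewrite -center_coord.
by move=> /(norm_rVP _ s2) h i; rewrite center_coord.
Qed.

Lemma dilateE (l : R) Q : 0 < l ->
  dilate l Q = closed_ball_ Num.norm (center Q : 'rV[R]_n) (l * side Q / 2).
Proof.
move=> l0; rewrite /dilate cubeE; apply/seteqP; split=> x /=.
  move=> [y yQ <-]; rewrite /closed_ball_/= opprD addNKr normrN normrZ gtr0_norm//.
  by rewrite -mulrA ler_pM2l// distrC.
rewrite /closed_ball_/= => xQ; exists (center Q + l^-1 *: (x - center Q)).
  rewrite /= opprD addNKr normrN normrZ gtr0_norm ?invr_gt0//.
  by rewrite ler_pdivrMl// mulrA distrC.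
rewrite [_ + _ - _]addrC addKr scalerA mulfV ?gt_eqF// scale1r addrC subrK//.
Qed.

Lemma center_cube Q : cube Q (center Q : 'rV[R]_n).
Proof. by rewrite cubeE /closed_ball_/= subrr normr0 divr_ge0// side_ge0. Qed.

(** The integer division rounds down, so that the parent is right for negative coordinates too. *)
Definition parent Q : dyadic := (Q.1 + 1, \row_i (Q.2 ord0 i %/ 2)%Z).

Lemma side_parent Q : side (parent Q) = 2 * side Q :> R.
Proof. by rewrite /side/= expfzDr// expr1z mulrC. Qed.

Lemma cube_parent Q : (cube Q : set 'rV[R]_n) `<=` cube (parent Q).
Proof.
move=> x xQ i; have /andP[h1 h2] := xQ i; rewrite side_parent mxE.
have s0 : 0 < side Q :> R := side_gt0 Q.
set m := Q.2 ord0 i in h1 h2 *.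
have mE : (m%:~R : R) = (m %/ 2)%Z%:~R * 2 + (m %% 2)%Z%:~R.
  by rewrite {1}(divz_eq m 2) intrD intrM.
have r0 : 0 <= (m %% 2)%Z%:~R :> R by rewrite ler0z modz_ge0.
have r1 : (m %% 2)%Z%:~R <= 1 :> R.
  rewrite -[1]/(1%:~R) ler_int; have := ltz_mod m (d := 2) isT.
  by rewrite -ltzD1.
move: h1 h2; rewrite mE => h1 h2.
have p1 : 0 <= (m %% 2)%Z%:~R * side Q :> R by rewrite mulr_ge0// ltW.
have p2 : (m %% 2)%Z%:~R * side Q <= side Q :> R by rewrite ger_pMl.
by apply/andP; split; lra.
Qed.

Lemma cube_parent_neq Q : (0 < n)%N -> cube (parent Q) <> cube Q :> set 'rV[R]_n.
Proof.
move=> n0 e; pose i : 'I_n := Ordinal n0; have s0 : 0 < side Q :> R := side_gt0 Q.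
pose x : 'rV[R]_n := \row_i (((parent Q).2 ord0 i)%:~R * side (parent Q)).
pose y : 'rV[R]_n := \row_i ((((parent Q).2 ord0 i)%:~R + 1) * side (parent Q)).
have p0 : 0 < side (parent Q) :> R := side_gt0 _.
have xQ : cube Q x.
  by rewrite -e => j; rewrite !mxE lexx/= ler_wpM2r ?ltW// ltrDl.
have yQ : cube Q y.
  by rewrite -e => j; rewrite !mxE lexx/= andbT ler_wpM2r ?ltW// ltrDl.
have /andP[h1 _] := xQ i; have /andP[_ h2] := yQ i; move: h1 h2.
by rewrite !mxE side_parent; lra.
Qed.

(** After division by the side, each coordinate m of a cube satisfies |m + 1/2 - t| <= K, so its
    offset from the floor of t - K - 1/2 lies in [0, 2K + 1]. The offsets inject the cubes into a
    finite set of functions. *)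
Lemma dyadic_count (K : R) : 0 <= K -> exists N : nat,
  forall (k : int) x (s : seq dyadic), uniq s ->
  (forall Q, Q \in s -> Q.1 = k /\ `|center Q - x| <= K * side Q) -> (size s <= N)%N.
Proof.
move=> K0; pose L := (Num.truncn (2 * K + 1)).+1; exists (L ^ n)%N => k x s us hs.
pose t i : R := x ord0 i / 2 ^ k.
pose a i : int := Num.floor (t i - K - 2^-1).
pose f (Q : dyadic) : {ffun 'I_n -> 'I_L} := [ffun i => inord `|Q.2 ord0 i - a i|%N].
have bnd Q i : Q \in s -> (0 <= Q.2 ord0 i - a i) /\ (`|Q.2 ord0 i - a i| < L)%N.
  move=> /hs[Qk hQ]; have := le_trans (norm_coord_le _ i) hQ.
  have s0 : 0 < side Q :> R := side_gt0 Q.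
  rewrite !mxE; have -> : x ord0 i = t i * side Q by rewrite /t /side Qk divfK// gt_eqF// exprz_gt0.
  rewrite -mulrBl normrM (gtr0_norm s0) ler_pM2r// ler_norml => /andP[h1 h2].
  have /andP[a1 a2] := floor_itv (t i - K - 2^-1).
  rewrite -/(a i) in a1 a2; rewrite intrD in a2.
  have h0 : 0 <= Q.2 ord0 i - a i.
    have hlt : a i < Q.2 ord0 i + 1 by rewrite -(ltr_int R) intrD; lra.
    by rewrite subr_ge0 -ltzD1.
  split=> //; rewrite ltnS truncn_ge_nat; last lra.
  by rewrite natr_absz ger0_norm// intrB; lra.
have finj : {in s &, injective f}.
  move=> Q Q' Qs Q's /ffunP ff; have [Qk _] := hs _ Qs; have [Qk' _] := hs _ Q's.
  case: Q Q' Qs Q's Qk Qk' ff => [k1 m] [k2 m'] Qs Q's /= -> -> ff.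
  congr pair; apply/rowP => i; have := congr1 val (ff i).
  have [m0 mL] := bnd _ i Qs; have [m'0 m'L] := bnd _ i Q's.
  rewrite !ffunE /= !inordK//= => /(congr1 Posz).
  by rewrite !gez0_abs// => /addIr.
rewrite -(size_map f); have := max_card (mem (map f s)).
rewrite card_ffun !card_ord => /(leq_trans _); apply.
by rewrite (card_uniqP _)// map_inj_in_uniq.
Qed.

Lemma powR2_le1 (u : R) : 2 `^ u <= 1 -> u <= 0.
Proof.
move=> h; rewrite leNgt; apply/negP => u0.
have : (2 `^ u) `^ u^-1 <= 1 `^ u^-1 :> R.
  by rewrite ge0_ler_powR ?nnegrE ?powR_ge0 ?invr_ge0 ?(ltW u0).
by rewrite powR1 -powRrM mulfV ?gt_eqF// powRr1//; lra.
Qed.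

(** Used with [Q0] maximizing l^b, which is a largest or a smallest cube according to the sign of b.
    In both cases l^b decays geometrically with the distance in scale from [Q0]. *)
Lemma side_powR Q Q0 (b : R) : side Q `^ b <= side Q0 `^ b :> R ->
  side Q `^ b = side Q0 `^ b * (2 `^ (- `|b|)) ^+ `|Q.1 - Q0.1|%N.
Proof.
pose z := Q.1 - Q0.1.
have -> : side Q `^ b = side Q0 `^ b * 2 `^ (z%:~R * b) :> R.
  rewrite powRrM powR_intmul// -powRM ?exprz_ge0// /side -expfzDr//.
  by rewrite /z addrC subrK.
rewrite ger_pMr ?powR_gt0 ?side_gt0// => /powR2_le1 zb.
congr (_ * _); rewrite -powR_mulrn ?powR_ge0// -powRrM; congr (_ `^ _).
by rewrite natr_absz intr_norm mulNr -normrM [b * _]mulrC ler0_norm ?opprK.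
Qed.

(* Boundedly many cubes of each side contribute: a geometric series. *)
Lemma sum_side (K b : R) : 0 <= K -> b != 0 -> exists2 C : R, 0 < C &
  forall x (s : seq dyadic) (V : R), uniq s -> 0 <= V ->
  (forall Q, Q \in s -> `|center Q - x| <= K * side Q /\ side Q `^ b <= V) ->
  \sum_(Q <- s) side Q `^ b <= C * V.
Proof.
move=> K0 b0; have [N hN] := dyadic_count K0.
pose t : R := 2 `^ (- `|b|).
have t1 : t < 1.
  rewrite /t powRN invf_lt1 ?powR_gt0// ltNge; apply/negP => /powR2_le1.
  by rewrite leNgt normr_gt0 b0.
(* At each distance from the scale of [Q0] there are two scales, with at most N cubes each; the
   successor keeps the constant positive. *)
exists ((N + N).+1%:R * (1 - t)^-1); first by rewrite mulr_gt0// invr_gt0 subr_gt0.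
move=> x s V us V0 hs; have [->|s0] := eqVneq s [::].
  by rewrite big_nil !mulr_ge0// invr_ge0 subr_ge0 ltW.
have [Q0 Q0s hQ0] := seq_argmax (fun Q => side Q `^ b : R) s0.
have -> : (N + N).+1%:R * (1 - t)^-1 * V = (N + N).+1%:R * V * (1 - t)^-1 by rewrite mulrAC.
apply: (@sum_levels _ _ _ (fun Q => `|Q.1 - Q0.1|%N)) => //; first exact: powR_ge0.
- move=> j; apply/leqW; pose P (z : int) := fun Q : @dyadic n => Q.1 == Q0.1 + z.
  have PN z : (count (P z) s <= N)%N.
    rewrite -size_filter; apply: (hN (Q0.1 + z) x); first exact: filter_uniq.
    by move=> Q; rewrite mem_filter => /andP[/eqP Qz /hs[]].
  apply: leq_trans (leq_add (PN j%:Z) (PN (- j%:Z))).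
  rewrite -count_predUI (leq_trans _ (leq_addr _ _))//; apply: sub_count => Q /= /eqP <-.
  rewrite /P; case: (Q.1 - Q0.1) (subrK Q0.1 Q.1) => k <- /=.
    by rewrite addrC eqxx.
  by rewrite NegzE [X in _ || (X == _)]addrC eqxx orbT.
- move=> Q Qs; rewrite (side_powR (hQ0 _ Qs)) ler_wpM2r ?exprn_ge0 ?powR_ge0//.
  by case: (hs _ Q0s).
Qed.

End DyadicCubes.

Section DyadicRange.
Context {R : realType} {n : nat}.
Implicit Types (Q : @dyadic n) (x y : 'rV[R]_n).

(** [sum_side] with b = -1: the inverse sides add up to at most C / a, and each of them is at least
    1 / (c a), so there are at most C c cubes. *)
Lemma dyadic_count_range (K c : R) : 0 <= K -> 0 < c -> exists N : nat,
  forall x (a : R) (s : seq dyadic), 0 < a -> uniq s ->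
  (forall Q, Q \in s -> `|center Q - x| <= K * side Q /\ a <= side Q <= c * a) ->
  (size s <= N)%N.
Proof.
move=> K0 c0; have [C C0 hC] := @sum_side R n K (-1) K0 ltac:(by rewrite oppr_eq0 oner_eq0).
exists (Num.truncn (C * c)).+1 => x a s a0 us hs; apply/leqW.
rewrite truncn_ge_nat; last by rewrite mulr_ge0// ltW.
have ca0 : 0 < c * a by rewrite mulr_gt0.
have /(hC x s (a^-1) us) : 0 <= a^-1 by rewrite invr_ge0 ltW.
move=> /(_ _)/le_trans h; have {h} : \sum_(Q <- s) (c * a)^-1 <= C * a^-1.
  apply: (@le_trans _ _ (\sum_(Q <- s) (side Q : R) `^ (-1))).
    rewrite big_seq [leRHS]big_seq; apply: ler_sum => Q Qs.
    have [_ /andP[h1 h2]] := hs _ Qs.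
    by rewrite powR_inv1 ?side_ge0// lef_pV2 ?posrE ?side_gt0.
  apply: h => // Q Qs; have [h0 /andP[h1 h2]] := hs _ Qs; split => //.
  by rewrite powR_inv1 ?side_ge0// lef_pV2 ?posrE ?side_gt0.
rewrite big_const_seq iter_addr_0 count_predT invfM -[_ *+ _]mulr_natl.
by rewrite mulrA ler_pM2r ?invr_gt0// ler_pdivrMr.
Qed.

Lemma finite_dyadic_range (K a b : R) x : 0 < a ->
  finite_set [set Q : dyadic | `|center Q - x| <= K * side Q /\ a <= side Q <= b].
Proof.
move=> a0; have K'0 : 0 <= `|K| by [].
have c0 : 0 < `|b / a| + 1 by rewrite ltr_wpDl.
have [N hN] := dyadic_count_range K'0 c0.
apply: contrapT => /(infinite_set_fset N.+1)[B BS].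
apply/negP; rewrite -leqNgt.
apply: (hN x a) => //; first exact: finmap.fset_uniq.
move=> Q /BS[h1 /andP[h2 h3]]; split.
  by rewrite (le_trans h1)// ler_wpM2r ?side_ge0// ler_norm.
rewrite h2 (le_trans h3)//; rewrite -ler_pdivrMr// (le_trans (ler_norm _))//.
by rewrite lerDl.
Qed.

Lemma ediam_cube_le Q : (ediam (cube Q : set 'rV[R]_n) <= (n%:R * side Q)%:E)%E.
Proof.
apply: ediam_le => x y; rewrite cubeE /closed_ball_/= => xQ yQ.
rewrite (le_trans (enorm_le_norm _))// ler_wpM2l//.
by have := ler_distD (center Q) x y; rewrite (distrC x (center Q)); lra.
Qed.

Lemma diam_cube_ge Q : (0 < n)%N -> side Q <= diam (cube Q : set 'rV[R]_n).
Proof.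
move=> n0; pose i : 'I_n := Ordinal n0.
pose x : 'rV[R]_n := \row_i ((Q.2 ord0 i)%:~R * side Q).
pose y : 'rV[R]_n := \row_i (((Q.2 ord0 i)%:~R + 1) * side Q).
have s0 : 0 < side Q :> R := side_gt0 Q.
have xQ : cube Q x by move=> j; rewrite !mxE lexx/= ler_wpM2r ?ltW// ltrDl.
have yQ : cube Q y by move=> j; rewrite !mxE lexx/= andbT ler_wpM2r ?ltW// ltrDl.
have h0 : (0 <= ediam (cube Q : set 'rV[R]_n))%E by apply: ediam_ge0; exists x.
have hfin : ediam (cube Q : set 'rV[R]_n) \is a fin_num.
  by rewrite ge0_fin_numE// (le_lt_trans (ediam_cube_le Q))// ltry.
rewrite -lee_fin /diam fineK//; apply: le_trans (ediam_ge yQ xQ).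
rewrite lee_fin; apply: le_trans (norm_coord_le_enorm _ i).
rewrite !mxE -mulrBl addrAC subrr add0r mul1r; exact: ler_norm.
Qed.

End DyadicRange.

(** * Geometry of Whitney cubes *)

Section WhitneyGeometry.
Context {R : realType} {n : nat} (Gamma : set 'rV[R]_n).
Hypotheses (n0 : (0 < n)%N) (G0 : Gamma !=set0).
Implicit Types (Q : @dyadic n) (x y : 'rV[R]_n).
Local Notation nu := (n%:R : R).

Let nu1 : 1 <= nu. Proof. by rewrite ler1n. Qed.

Lemma dilate2P Q x : dilate 2 Q x <-> `|center Q - x| <= side Q.
Proof. by rewrite dilateE// /closed_ball_/= mulrAC divff ?mul1r// pnatr_eq0. Qed.

Lemma cube_dilate2 Q : (cube Q : set 'rV[R]_n) `<=` dilate 2 Q.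
Proof.
move=> x; rewrite cubeE => h; apply/dilate2P; apply: le_trans h _.
by have := side_ge0 (R := R) Q; lra.
Qed.

(** 20Q has half-side 10 l and 2Q has half-side l, which leaves 10 - 1 = 9. *)
Lemma whitney_far Q x y : whitney Gamma Q -> dilate 2 Q x -> Gamma y ->
  9 * side Q < `|x - y|.
Proof.
move=> [QG _] /dilate2P xQ Gy.
have : 10 * side Q < `|center Q - y|.
  rewrite ltNge; apply/negP => h; apply: (QG y) => //.
  by rewrite dilateE// /closed_ball_/= (le_trans h)//; have := side_ge0 (R := R) Q; lra.
by have := ler_distD x (center Q) y; lra.
Qed.

(* By maximality, the parent dilated by 20 meets [Gamma]. *)
Lemma whitney_near Q : whitney Gamma Q ->
  exists2 p, Gamma p & `|center Q - p| <= 21 * side Q.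
Proof.
move=> [QG Qmax]; have s0 := side_ge0 (R := R) Q.
have : ~ (dilate 20 (parent Q) `<=` ~` Gamma).
  move=> h; have := Qmax _ h (cube_parent (R := R) (Q := Q)).
  exact: cube_parent_neq.
move=> /existsNP[p /not_implyP[pQ /contrapT Gp]]; exists p => //.
move: pQ; rewrite dilateE// /closed_ball_/= side_parent => h.
have := cube_parent (center_cube (R := R) Q).
rewrite cubeE /closed_ball_/= side_parent => h2.
by have := ler_distD (center (parent Q)) (center Q) p; rewrite (distrC (center Q) (center _)); lra.
Qed.

Lemma le_nu_norm x (c : R) : `|x| <= c -> enorm x <= nu * c.
Proof. by move=> h; rewrite (le_trans (enorm_le_norm _))// ler_wpM2l. Qed.

(** The upper constant is 21, the distance in sides from the centre to Gamma, plus 1 for moving from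
    the centre to a point of 2Q; the factor n turns the sup norm into the Euclidean one. *)
Lemma whitney_dist Q x : whitney Gamma Q -> dilate 2 Q x ->
  9 * side Q <= dist_pt x Gamma <= 22 * nu * side Q.
Proof.
move=> wQ xQ; apply/andP; split.
  apply: le_dist_pt => // y Gy; apply: le_trans (norm_le_enorm _).
  exact/ltW/(whitney_far wQ xQ).
have [p Gp hp] := whitney_near wQ; apply: (le_trans (dist_pt_le _ Gp)).
have -> : 22 * nu * side Q = nu * (22 * side Q) by ring.
apply: le_nu_norm; move/dilate2P : xQ => xQ.
by have := ler_distD (center Q) x p; rewrite (distrC x (center Q)); lra.
Qed.

Lemma whitney_dist_set Q : whitney Gamma Q ->
  9 * side Q <= dist_set (cube Q) Gamma <= 22 * nu * side Q.
Proof.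
move=> wQ; have [p Gp hp] := whitney_near wQ.
have cQ := center_cube (R := R) Q.
apply/andP; split.
  apply: lb_le_inf; first by exists (enorm (center Q - p)), (center Q, p).
  move=> _ [[x y] [/= xQ Gy] <-]; apply: le_trans (norm_le_enorm _).
  exact/ltW/(whitney_far wQ (cube_dilate2 xQ)).
apply: (@le_trans _ _ (enorm (center Q - p))).
  apply: ge_inf; last by exists (center Q, p).
  by exists 0 => _ [q _ <-]; exact: enorm_ge0.
have -> : 22 * nu * side Q = nu * (22 * side Q) by ring.
by apply: le_nu_norm; have := side_ge0 (R := R) Q; lra.
Qed.

(** 46 bounds 2 * 22 for the choice of xi, plus 1 for a nearly closest point of Q, plus 1/2 from
    there to the centre. *)
Lemma whitney_points_near xi Q : whitney_points Gamma xi -> whitney Gamma Q ->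
  `|center Q - xi Q| <= 46 * nu * side Q.
Proof.
move=> hxi wQ; have [_ hd] := hxi _ wQ; have /andP[_ hs] := whitney_dist_set wQ.
have s0 := side_gt0 (R := R) Q.
have cQ0 : (cube Q : set 'rV[R]_n) !=set0 by exists (center Q); exact: center_cube.
have [y yQ hy] := dist_pt_adherent (xi Q) cQ0 s0.
move: yQ; rewrite cubeE /closed_ball_/= => yQ.
have h1 := ler_distD y (center Q) (xi Q); have h2 := norm_le_enorm (xi Q - y).
rewrite (distrC (xi Q)) in h2.
have h3 : side Q <= nu * side Q by rewrite ler_peMl// ltW.
by lra.
Qed.

Lemma whitney_ball_sub xi Q y : whitney_points Gamma xi -> whitney Gamma Q ->
  eball (xi Q) (dist_set (cube Q) Gamma) y -> `|center Q - y| <= 68 * nu * side Q.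
Proof.
move=> hxi wQ yQ; have h1 := whitney_points_near hxi wQ.
have /andP[_ hs] := whitney_dist_set wQ.
have h2 := norm_le_enorm (y - xi Q); rewrite /eball/= in yQ.
by have := ler_distD (xi Q) (center Q) y; rewrite (distrC (xi Q) y); lra.
Qed.

(** Both sides are compared with the distance from the common point x to Gamma, and 22 / 9 < 3. *)
Lemma whitney_neighbors Q Q' x : whitney Gamma Q -> whitney Gamma Q' ->
  dilate 2 Q x -> dilate 2 Q' x -> side Q' <= 3 * nu * side Q.
Proof.
move=> wQ wQ' xQ xQ'; have /andP[h1 h2] := whitney_dist wQ xQ.
have /andP[h3 h4] := whitney_dist wQ' xQ'.
have h5 : 0 <= nu * side Q by rewrite mulr_ge0// side_ge0.
by lra.
Qed.

(** 208 = 68 * 3 + 3 + 1: from y to the centre of Q', from there to x, and from x to the centre of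
    Q, with the side of Q' at most 3 n times that of Q. *)
Lemma whitney_ball_neighbor xi Q Q' x y : whitney_points Gamma xi ->
  whitney Gamma Q -> whitney Gamma Q' -> dilate 2 Q x -> dilate 2 Q' x ->
  eball (xi Q') (dist_set (cube Q') Gamma) y -> `|center Q - y| <= 208 * nu ^+ 2 * side Q.
Proof.
move=> hxi wQ wQ' xQ xQ' yQ'.
have h1 := whitney_ball_sub hxi wQ' yQ'; have h2 := whitney_neighbors wQ wQ' xQ xQ'.
move/dilate2P : xQ => xQ; move/dilate2P : xQ' => xQ'.
have s0 := side_ge0 (R := R) Q.
have t1 := ler_distD x (center Q) y; have t2 := ler_distD (center Q') x y.
rewrite (distrC x (center Q')) in t2.
have h3 : nu * side Q' <= nu * (3 * nu * side Q) by rewrite ler_wpM2l.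
have h4 : nu * side Q <= nu ^+ 2 * side Q.
  by rewrite ler_wpM2r// expr2 ler_peMl// (le_trans _ nu1).
have h5 : side Q <= nu * side Q by rewrite ler_peMl.
have -> : 208 * nu ^+ 2 * side Q = 208 * (nu ^+ 2 * side Q) by ring.
have h6 : nu * (3 * nu * side Q) = 3 * (nu ^+ 2 * side Q) by ring.
by lra.
Qed.

(** All the cubes whose doubles contain x have sides between D / (22 n) and D / 9, where D is the
    distance from x to Gamma. *)
Lemma whitney_count : exists N : nat, forall x (s : seq dyadic), uniq s ->
  (forall Q, Q \in s -> whitney Gamma Q /\ dilate 2 Q x) -> (size s <= N)%N.
Proof.
have c0 : 0 < 22 * nu / 9 by rewrite divr_gt0// mulr_gt0// (lt_le_trans _ nu1).
have [N hN] := @dyadic_count_range R n 1 _ ler01 c0.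
(* A first cube in the list shows that the distance from x to Gamma is positive; the empty list is
   immediate. *)
exists N => x s us hs; case: s us hs => // Q0 s us hs.
have nn0 : 0 < 22 * nu by rewrite mulr_gt0// (lt_le_trans _ nu1).
have [w0 x0] := hs Q0 (mem_head _ _); have /andP[d1 _] := whitney_dist w0 x0.
have dx0 : 0 < dist_pt x Gamma by rewrite (lt_le_trans _ d1)// mulr_gt0// side_gt0.
apply: (hN x (dist_pt x Gamma / (22 * nu))) => //; first by rewrite divr_gt0.
move=> Q /hs[wQ xQ]; have /andP[h1 h2] := whitney_dist wQ xQ; split.
  by rewrite mul1r; apply/dilate2P.
rewrite ler_pdivrMr// [X in _ <= X]mulrC h2/=.
have -> : 22 * nu / 9 * (dist_pt x Gamma / (22 * nu)) = dist_pt x Gamma / 9.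
  by field; rewrite gt_eqF// (lt_le_trans _ nu1).
by rewrite ler_pdivlMr// mulrC.
Qed.

(** On the chosen ball the distance to Gamma stays between 1/2 and 3/2 of its value at x, which
    confines the sides to [dx / (44 n), dx / 6]; the radius of the ball is then at most 22 sides,
    and 23 = 22 + 1. *)
Lemma whitney_locally_finite x : closed Gamma -> ~ Gamma x -> exists2 r : R, 0 < r &
  finite_set [set Q | whitney Gamma Q /\ exists2 y, ball x r y & dilate 2 Q y].
Proof.
move=> cG Gx; have dx0 := dist_pt_gt0 G0 cG Gx; set dx := dist_pt x Gamma in dx0.
have nn0 : 0 < nu by rewrite (lt_le_trans _ nu1).
exists (dx / (2 * nu)); first by rewrite divr_gt0// mulr_gt0.
have a0 : 0 < dx / (44 * nu) by rewrite divr_gt0// mulr_gt0.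
apply: sub_finite_set (finite_dyadic_range 23 (dx / 6) x a0) => Q [wQ [y xy yQ]].
have /andP[h1 h2] := whitney_dist wQ yQ; move: xy; rewrite -ball_normE/= => xy.
have xy' : enorm (x - y) <= dx / 2.
  apply: (le_trans (le_nu_norm (ltW xy))); rewrite le_eqVlt; apply/orP; left.
  by apply/eqP; field; rewrite gt_eqF.
have := dist_pt_lipschitz x y G0; rewrite ler_norml => /andP[h3 h4].
have s1 : dx / (44 * nu) <= side Q.
  by rewrite ler_pdivrMr ?mulr_gt0//; rewrite /dx in xy' h3 h4 *; lra.
split; last by rewrite s1/=; rewrite /dx in xy' *; lra.
move/dilate2P : yQ => yQ; have := ler_distD y (center Q) x; rewrite (distrC y x).
have : dx / (2 * nu) <= 22 * side Q.
  have -> : dx / (2 * nu) = 22 * (dx / (44 * nu)) by field; rewrite gt_eqF.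
  by rewrite ler_pM2l.
by lra.
Qed.

End WhitneyGeometry.

(** * Weak gradients of continuously differentiable functions *)

Section C1Functions.
Context {R : realType} {n : nat}.
Implicit Types (u v f : 'rV[R]_n -> R) (U : set 'rV[R]_n) (x : 'rV[R]_n) (i : 'I_n).
Local Notation e_ i := (delta_mx ord0 i : 'rV[R]_n).

Definition C1_on U u := forall x, U x -> {for x, continuous u} /\
  forall i, derivable u x (e_ i) /\ {for x, continuous (partial i u)}.

Lemma near_eq_continuous_at u v x : (\forall y \near x, u y = v y) ->
  {for x, continuous v} -> {for x, continuous u}.
Proof.
move=> uv cv; have e : u x = v x by exact: (nbhs_singleton uv).
rewrite /prop_for /continuous_at e.
apply: cvg_trans cv; apply: (@near_eq_cvg _ _ (nbhs x)).
by apply: filterS uv => y ->.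
Qed.

Lemma near_open U x (P : 'rV[R]_n -> Prop) : open U -> U x ->
  (forall y, U y -> P y) -> \forall y \near x, P y.
Proof. by move=> oU Ux UP; apply: (filterS UP); exact: open_nbhs_nbhs. Qed.

Lemma C1_on_eq U u v : open U -> (forall x, U x -> u x = v x) ->
  C1_on U v -> C1_on U u.
Proof.
move=> oU uv cv x Ux; have [cvx dvx] := cv _ Ux.
have nuv y : U y -> \forall z \near y, u z = v z by move=> Uy; exact: near_open uv.
have nvu y : U y -> \forall z \near y, v z = u z.
  by move=> Uy; apply: (near_open oU) => // z /uv ->.
split; first exact: near_eq_continuous_at (nuv _ Ux) cvx.
move=> i; have [d1 d2] := dvx i; split; first exact: near_eq_derivable (nvu _ Ux) d1.
apply: near_eq_continuous_at d2; apply: (near_open oU) => // y Uy.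
exact: near_eq_derive (nuv _ Uy).
Qed.

Lemma C1_on_sub U V u : V `<=` U -> C1_on U u -> C1_on V u.
Proof. by move=> VU cu x /VU; exact: cu. Qed.

Lemma partial_cst i (c : R) x : partial i (cst c) x = 0.
Proof. exact: derive_cst. Qed.

Lemma C1_on_cst U (c : R) : C1_on U (cst c).
Proof.
move=> x _; split; first exact: cst_continuous.
move=> i; split; first exact: derivable_cst.
rewrite (_ : partial i (cst c) = cst 0); first exact: cst_continuous.
by apply/funext => y; rewrite partial_cst.
Qed.

Lemma partialD i u v x : derivable u x (e_ i) -> derivable v x (e_ i) ->
  partial i (u \+ v) x = partial i u x + partial i v x.
Proof. exact: deriveD. Qed.

Lemma partialM i u v x : derivable u x (e_ i) -> derivable v x (e_ i) ->
  partial i (u \* v) x = u x * partial i v x + v x * partial i u x.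
Proof. exact: deriveM. Qed.

Lemma C1_onD U u v : open U -> C1_on U u -> C1_on U v -> C1_on U (u \+ v).
Proof.
move=> oU cu cv x Ux; have [cux dux] := cu _ Ux; have [cvx dvx] := cv _ Ux.
split; first exact: (continuousD cux cvx).
move=> i; have [u1 u2] := dux i; have [v1 v2] := dvx i.
split; first exact: (derivableD u1 v1).
apply: (near_eq_continuous_at (v := partial i u \+ partial i v)); last exact: (continuousD u2 v2).
apply: (near_open oU) => // y Uy; apply: partialD; first exact: ((cu _ Uy).2 i).1.
exact: ((cv _ Uy).2 i).1.
Qed.

Lemma C1_onM U u v : open U -> C1_on U u -> C1_on U v -> C1_on U (u \* v).
Proof.
move=> oU cu cv x Ux; have [cux dux] := cu _ Ux; have [cvx dvx] := cv _ Ux.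
split; first exact: (continuousM cux cvx).
move=> i; have [u1 u2] := dux i; have [v1 v2] := dvx i.
split; first exact: (derivableM u1 v1).
apply: (near_eq_continuous_at (v := (u \* partial i v) \+ (v \* partial i u))).
  apply: (near_open oU) => // y Uy; apply: partialM; first exact: ((cu _ Uy).2 i).1.
  exact: ((cv _ Uy).2 i).1.
exact: (continuousD (continuousM cux v2) (continuousM cvx u2)).
Qed.

Lemma C1_on_sum U (I : Type) (s : seq I) (f : I -> 'rV[R]_n -> R) (c : I -> R) : open U ->
  (forall j, C1_on U (f j)) ->
  C1_on U (fun x => \sum_(j <- s) f j x * c j) /\
  forall x i, U x -> partial i (fun x => \sum_(j <- s) f j x * c j) x =
    \sum_(j <- s) partial i (f j) x * c j.
Proof.
move=> oU cf; elim: s => [|j s [IH1 IH2]].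
  have -> : (fun x => \sum_(j <- [::]) f j x * c j) = cst 0.
    by apply/funext => x; rewrite big_nil.
  split; first exact: C1_on_cst.
  by move=> x i Ux; rewrite big_nil partial_cst.
have cfc : C1_on U (f j \* cst (c j)) by apply: C1_onM => //; exact: C1_on_cst.
have -> : (fun x => \sum_(j <- j :: s) f j x * c j) =
    (f j \* cst (c j)) \+ (fun x => \sum_(j <- s) f j x * c j).
  by apply/funext => x; rewrite big_cons.
split; first exact: C1_onD.
move=> x i Ux; rewrite partialD; [|exact: ((cfc _ Ux).2 i).1|exact: ((IH1 _ Ux).2 i).1].
rewrite IH2// big_cons partialM; [|exact: ((cf j _ Ux).2 i).1|exact: derivable_cst].
by rewrite partial_cst mulr0 add0r mulrC.
Qed.

Lemma smooth_C1_on U f : smooth f -> C1_on U f.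
Proof.
move=> sf x _; split; first exact/differentiable_continuous/(sf [::] x).
move=> i; split; first exact/diff_derivable/(sf [::] x).
exact/differentiable_continuous/(sf [:: i] x).
Qed.

Lemma C1_on_zero_ext U f : C1_on U f -> closure [set x | f x != 0] `<=` U -> open U ->
  C1_on setT f.
Proof.
move=> cf fU oU x _; have [Ux|nUx] := pselect (U x); first exact: cf.
pose V := ~` closure [set x | f x != 0].
have oV : open V by apply: closed_openC; exact: closed_closure.
have f0 y : V y -> f y = 0.
  by move=> Vy; apply: contrapT => /eqP fy; apply: Vy; exact: subset_closure.
apply: (@C1_on_eq V f (cst 0)) => //; first exact: C1_on_cst.
by move=> /fU.
Qed.

End C1Functions.

Section LebesgueCalculus.
Context {R : realType} {n : nat}.
Implicit Types (u v f : 'rV[R]_n -> R) (U : set 'rV[R]_n) (x : 'rV[R]_n) (i : 'I_n).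
Local Notation e_ i := (delta_mx ord0 i : 'rV[R]_n).
Local Notation lebT := (caratheodory_type (@lebesgue R n)).

Lemma open_continuous_leb_measurable U f : open U ->
  (forall x, U x -> {for x, continuous f}) -> measurable_fun (U : set lebT) f.
Proof.
move=> oU cf; apply: (measurability _ (RGenOpens.measurableE R)).
move=> _ [_ [a [b ->] <-]]; apply: lebesgue_measurable_open.
rewrite openE => x [Ux /= fx]; apply: filterI; first exact: open_nbhs_nbhs.
apply: cf => //; apply: open_nbhs_nbhs; split => //; exact: interval_open.
Qed.

Lemma integral_shift f h : measurable_fun (setT : set lebT) f ->
  (leb R n).-integrable setT (EFin \o f) ->
  (\int[leb R n]_x (f (x + h)%R)%:E = \int[leb R n]_x (f x)%:E)%E.
Proof.
move=> mf If; pose phi (x : lebT) : lebT := (x + h)%R.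
have mphi : measurable_fun setT phi.
  by move=> _ A mA; rewrite setTI; exact: lebesgue_measurable_shift.
have pf A : measurable A -> A `<=` setT -> pushforward (leb R n) phi A = leb R n A.
  by move=> mA _; exact: lebesgue_shift.
have mEf : measurable_fun (setT : set lebT) (EFin \o f) by apply/measurable_EFinP.
have Ip : (leb R n).-integrable (phi @^-1` setT) ((EFin \o f) \o phi).
  rewrite preimage_setT; apply/integrableP; split; first exact: measurableT_comp.
  move/integrableP : If => [_]; apply: le_lt_trans.
  have := @ge0_integral_pushforward _ _ lebT lebT R phi mphi (leb R n) setT
    (fun x => `|(f x)%:E|)%E measurableT.
  rewrite preimage_setT => H; rewrite -H//; last exact: measurableT_comp.
  by rewrite (eq_measure_integral (leb R n)).
have := @integral_pushforward _ _ lebT lebT R phi mphi (leb R n) setT (EFin \o f)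
  mEf Ip measurableT.
by rewrite preimage_setT (eq_measure_integral (leb R n)).
Qed.

End LebesgueCalculus.

Section IntegrationByParts.
Context {R : realType} {n : nat}.
Implicit Types (u v f : 'rV[R]_n -> R) (U : set 'rV[R]_n) (x : 'rV[R]_n) (i : 'I_n).
Local Notation e_ i := (delta_mx ord0 i : 'rV[R]_n).
Local Notation lebT := (caratheodory_type (@lebesgue R n)).
Local Notation leb := (leb R n).

Lemma norm_delta_mx i : `|e_ i| <= 1.
Proof.
apply/(norm_rVP _ ler01) => j; rewrite mxE eqxx /=.
by case: (_ == _); rewrite ?normr1 ?normr0.
Qed.

Lemma bounded_support_integrable f (r M : R) : 0 <= M ->
  measurable_fun (setT : set lebT) f -> (forall x, `|f x| <= M) ->
  (forall x, r <= `|x| -> f x = 0) -> leb.-integrable setT (EFin \o f).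
Proof.
move=> M0 mf fM f0; apply/integrableP; split; first exact/measurable_EFinP.
pose B : set lebT := ball (0 : 'rV[R]_n) r.
have mB : measurable B by apply: lebesgue_measurable_open; exact: ball_open.
apply: (@le_lt_trans _ _ (\int[leb]_x (M%:E * (\1_B x : R)%:E)))%E.
  apply: (@lower_integral_le _ lebT R leb setT) => x _; first exact: abse_ge0.
  rewrite -EFinM lee_fin indicE; have [xB|xB] := pselect (B x).
    by rewrite mem_set// mulr1.
  rewrite memNset// mulr0 /= f0 ?normr0//.
  by rewrite leNgt; apply/negP => h; apply: xB; rewrite /B -ball_normE/= sub0r normrN.
rewrite ge0_integralZl_EFin//; last by apply/measurable_EFinP; exact: measurable_indic.
rewrite integral_indic// setIT lte_mul_pinfty ?lee_fin//.
exact: (lebesgue_bounded (x := 0) (r := r)).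
Qed.

Lemma continuous_support_bounded f (r : R) : continuous f ->
  (forall x, r <= `|x| -> f x = 0) -> exists2 M : R, 0 <= M & forall x, `|f x| <= M.
Proof.
move=> cf f0.
have K0 : closed_ball_ Num.norm (0 : 'rV[R]_n) `|r| !=set0.
  by exists 0; rewrite /closed_ball_/= subrr normr0.
have [|c _ hc] := @EVT_max_rV R n (fun x => `|f x|) _ K0 (@compact_closed_ball_ R n 0 `|r|).
  apply: continuous_subspaceT => x; apply: continuous_comp; first exact: cf.
  exact: norm_continuous.
exists `|f c| => // x; have [rx|xr] := leP r `|x|; first by rewrite f0// normr0.
apply: hc; rewrite inE /closed_ball_/= sub0r normrN (le_trans (ltW xr))//.
exact: ler_norm.
Qed.

Lemma is_derive_line v i x (t : R) : derivable v (x + t *: e_ i) (e_ i) ->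
  is_derive t 1 (fun s : R => v (x + s *: e_ i)) (partial i v (x + t *: e_ i)).
Proof.
move=> dv.
have E : (fun h : R => h^-1 *: (((fun s : R => v (x + s *: e_ i)) \o shift t) (h *: 1) -
    (fun s : R => v (x + s *: e_ i)) t)) =
  (fun h : R => h^-1 *: ((v \o shift (x + t *: e_ i)) (h *: e_ i) - v (x + t *: e_ i))).
  apply/funext => h; congr (_ *: (v _ - _)).
  by rewrite /= [h *: 1]mulr1 scalerDl addrCA.
by split; rewrite /derivable /partial /derive E.
Qed.

Lemma line_increment_le v i (M : R) : (forall x, derivable v x (e_ i)) ->
  (forall x, `|partial i v x| <= M) ->
  forall x (h : R), 0 <= h -> `|v (x + h *: e_ i) - v x| <= M * h.
Proof.
move=> dv vM x h h0; pose w (s : R) := v (x + s *: e_ i).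
have dw (s : R) : is_derive s (1 : R) w (partial i v (x + s *: e_ i)) by exact: is_derive_line.
have cw : {within `[0, h], continuous w}.
  apply: derivable_within_continuous => s _; exact: ex_derive.
have [c _] := MVT_segment h0 (fun s _ => dw s) cw.
rewrite /w scale0r addr0 subr0 => ->; rewrite normrM (ger0_norm h0).
by rewrite ler_wpM2r.
Qed.

(** Difference quotients of v integrate to 0 by translation invariance. The mean value theorem
    bounds them by M on a fixed ball, outside of which they vanish, so dominated convergence passes
    to the derivative. *)
Lemma integral_partial0 v i (r : R) : C1_on setT v ->
  (forall x, r <= `|x| -> v x = 0) ->
  leb.-integrable setT (EFin \o partial i v) /\ (\int[leb]_x (partial i v x)%:E = 0)%E.
Proof.
move=> cv v0.
have ctv : continuous v by move=> x; exact: (cv x Logic.I).1.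
have dv x : derivable v x (e_ i) by exact: ((cv x Logic.I).2 i).1.
have ctp : continuous (partial i v) by move=> x; exact: ((cv x Logic.I).2 i).2.
have mT f : continuous f -> measurable_fun (setT : set lebT) f.
  by move=> cf; apply: open_continuous_leb_measurable => [|x _]; [exact: openT|exact: cf].
(* The increments used below are at most 1, so radius r + 1 serves the derivative and all the
   difference quotients. *)
have p0 x : r + 1 <= `|x| -> partial i v x = 0.
  move=> rx; rewrite -(partial_cst i 0 x); apply: near_eq_derive.
  apply/nbhs_ballP; exists 1 => //= y; rewrite -ball_normE/= => xy; apply: v0.
  by have := ler_distD y x 0; rewrite !subr0; lra.
have [N N0 vN] := continuous_support_bounded ctv v0.
have [M M0 pM] := continuous_support_bounded ctp p0.
have Iv : leb.-integrable setT (EFin \o v).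
  exact: (bounded_support_integrable N0 (mT _ ctv) vN v0).
pose h k : R := k.+1%:R^-1; have h0 k : 0 < h k by rewrite invr_gt0.
have h1 k : h k <= 1 by rewrite invf_le1// ler1n.
pose f k x : R := (h k)^-1 * (v (x + h k *: e_ i) - v x).
have cshift k : continuous (fun x => v (x + h k *: e_ i)).
  move=> x; have H1 : {for x, continuous (fun y : 'rV[R]_n => y + h k *: e_ i)}.
    apply: (@continuousD _ _ _ (fun y : 'rV[R]_n => y) (fun=> h k *: e_ i)).
      exact: cvg_id.
    exact: cst_continuous.
  exact: (continuous_comp H1 (ctv _)).
have mf k : measurable_fun (setT : set lebT) (EFin \o f k).
  apply/measurable_EFinP; apply: mT => x.
  apply: (@continuousM _ _ (cst (h k)^-1) (fun x => v (x + h k *: e_ i) - v x)).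
    exact: cst_continuous.
  exact: (continuousB (cshift k x) (ctv x)).
have fM k x : `|f k x| <= M.
  rewrite /f normrM gtr0_norm ?invr_gt0// mulrC ler_pdivrMr//.
  by apply: line_increment_le => //; exact: ltW.
have f0 k x : r + 1 <= `|x| -> f k x = 0.
  move=> rx; rewrite /f !v0 ?subrr ?mulr0//; first lra.
  have : `|h k *: e_ i| <= 1.
    by rewrite normrZ gtr0_norm// (le_trans _ (h1 k))// ler_piMr ?norm_delta_mx// ltW.
  by have := ler_distD (x + h k *: e_ i) x 0; rewrite !subr0 opprD addNKr normrN; lra.
pose B : set lebT := ball (0 : 'rV[R]_n) (r + 1).
have mB : measurable B by apply: lebesgue_measurable_open; exact: ball_open.
pose g (x : 'rV[R]_n) : R := M * \1_B x.
have gE x : r + 1 <= `|x| -> g x = 0.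
  move=> rx; rewrite /g indicE memNset ?mulr0//.
  by rewrite /B -ball_normE/= sub0r normrN; apply/negP; rewrite -leNgt.
have gM x : `|g x| <= M.
  by rewrite /g normrM ger0_norm// indicE; case: (_ \in _); rewrite ?normr1 ?normr0 ?mulr1 ?mulr0.
have Ig : leb.-integrable setT (EFin \o g).
  apply: (bounded_support_integrable M0 _ gM gE).
  by apply: measurable_funM => //; exact: measurable_indic.
have fg k x : `|f k x| <= g x.
  have [rx|xr] := leP (r + 1) `|x|; first by rewrite f0// gE// normr0.
  by rewrite /g indicE mem_set ?mulr1// /B -ball_normE/= sub0r normrN.
have hcvg : h k @[k --> \oo] --> 0^'.
  move=> P P0; have H : \forall k \near \oo, h k != 0 -> P (h k) := @cvg_harmonic R _ P0.
  by change (\forall k \near \oo, P (h k)); apply: filterS H => k; apply; rewrite gt_eqF.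
have fcvg x : f k x @[k --> \oo] --> partial i v x.
  have := dv x; rewrite /derivable => /cvg_ex[l hl].
  have -> : partial i v x = l by exact: cvg_lim hl.
  pose F (t : R) : R := t^-1 *: ((v \o shift x) (t *: e_ i) - v x).
  rewrite (_ : (fun k => f k x) = F \o h).
    exact: (@cvg_comp _ _ _ h F \oo 0^' (nbhs l) hcvg hl).
  by apply/funext => k; rewrite /f /F /= [_ + x]addrC.
have fcvgE : {ae leb, forall x, setT x ->
    (EFin \o f k) x @[k --> \oo] --> (EFin \o partial i v) x}.
  apply: aeW => x _; apply/fine_cvgP; split; first exact: nearW.
  exact: fcvg.
have mEp : measurable_fun (setT : set lebT) (EFin \o partial i v).
  by apply/measurable_EFinP; exact: mT.
have fgE : {ae leb, forall x k, setT x -> (`|(EFin \o f k) x| <= (EFin \o g) x)%E}.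
  by apply: aeW => x k _; rewrite lee_fin.
have [Ip _ cvI] := @dominated_convergence _ lebT R leb setT measurableT
  (fun k => EFin \o f k) (EFin \o partial i v) (EFin \o g) mf mEp
  fcvgE Ig fgE.
suff E0 : (fun k => \int[leb]_x (EFin \o f k) x)%E = (fun=> 0%E).
  split => //; move: cvI; rewrite E0 => /(cvg_lim (@ereal_hausdorff R)) <-.
  by rewrite lim_cst//; exact: ereal_hausdorff.
apply/funext => k /=.
have vs0 x : r + 1 <= `|x| -> v (x + h k *: e_ i) = 0.
  move=> rx; rewrite v0//.
  have : `|h k *: e_ i| <= 1.
    by rewrite normrZ gtr0_norm// (le_trans _ (h1 k))// ler_piMr ?norm_delta_mx// ltW.
  by have := ler_distD (x + h k *: e_ i) x 0; rewrite !subr0 opprD addNKr normrN; lra.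
have Is : leb.-integrable setT (EFin \o (fun x => v (x + h k *: e_ i))).
  exact: (bounded_support_integrable N0 (mT _ (cshift k)) (fun x => vN _) vs0).
transitivity (((h k)^-1)%:E * \int[leb]_x ((v (x + h k *: e_ i))%:E - (v x)%:E))%E.
  rewrite -(integralZl measurableT (integrableB measurableT Is Iv)).
  by apply: (@eq_integral _ lebT R leb) => x _; rewrite /f EFinM EFinB.
rewrite (integralB measurableT Is Iv) integral_shift// ?subee ?mule0//.
  exact: (integrable_fin_num measurableT Iv).
exact: mT.
Qed.

Lemma continuous_integrable_compact (Om K : set 'rV[R]_n) f : open Om ->
  (forall x, Om x -> {for x, continuous f}) -> compact K -> K `<=` Om ->
  leb.-integrable K (EFin \o f).
Proof.
move=> oO cf cK KO.
have mK : measurable (K : set lebT).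
  by apply: lebesgue_measurable_closed; exact: compact_closed.
have [a aK] := compact_norm_lt cK.
have Koo : (leb K < +oo)%E.
  apply: (@lebesgue_bounded R n K 0 a) => x /aK.
  by rewrite -ball_normE/= sub0r normrN.
have mf : measurable_fun (K : set lebT) f.
  apply: measurable_funS (open_continuous_leb_measurable oO cf) => //.
  exact: lebesgue_measurable_open.
have [->|/set0P K0] := eqVneq K set0; first exact: integrable_set0.
have [|c _ hc] := @EVT_max_rV R n (fun x => `|f x|) _ K0 cK.
  apply: continuous_in_subspaceT => x /set_mem Kx.
  by apply: continuous_comp; [exact/cf/KO|exact: norm_continuous].
apply: (measurable_bounded_integrable mK Koo mf).
exists `|f c|; split; first exact: num_real.
by move=> M fM x /= Kx; rewrite (le_trans (hc x _))// ?inE// ltW.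
Qed.

Lemma L1loc_continuous (Om : set 'rV[R]_n) f : open Om ->
  (forall x, Om x -> {for x, continuous f}) -> L1loc (@lebesgue R n) Om f.
Proof.
move=> oO cf; split; first exact: open_continuous_leb_measurable.
by move=> K cK KO; exact: continuous_integrable_compact cK KO.
Qed.

Theorem weak_gradient_C1 (Om : set 'rV[R]_n) u : open Om -> C1_on Om u ->
  is_weak_grad Om u (grad u).
Proof.
move=> oO cu; split=> [i|psi [spsi cpsi suppO] i].
  apply: L1loc_continuous => // x Ox.
  have -> : (fun x => grad u x ord0 i) = partial i u by apply/funext => y; rewrite mxE.
  exact: ((cu _ Ox).2 i).2.
set S := closure _ in cpsi suppO.
have cpsiT : C1_on setT psi by exact: smooth_C1_on.
have psi0 x : ~ S x -> psi x = 0.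
  by move=> nS; apply: contrapT => /eqP fy; apply: nS; exact: subset_closure.
have dpsi0 x : ~ S x -> partial i psi x = 0.
  move=> nS; rewrite -(partial_cst i 0 x); apply: near_eq_derive.
  apply: (@near_open _ _ (~` S)) => //.
  by apply: closed_openC; exact: closed_closure.
(* The values of u off [Om] are arbitrary, but the product vanishes off the support of psi and is
   therefore C^1 everywhere. *)
pose v := u \* psi.
have cv : C1_on setT v.
  apply: (C1_on_zero_ext (U := Om)) => //.
    by apply: C1_onM => //; exact: C1_on_sub cpsiT.
  apply: subset_trans suppO; apply: closure_subset => x /=.
  by rewrite /v/= mulf_eq0 negb_or => /andP[].
have [a aS] := compact_norm_lt cpsi.
have v0 x : a <= `|x| -> v x = 0.
  by move=> ax; rewrite /v/= psi0 ?mulr0// => /aS; rewrite ltNge ax.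
have [Iv I0] := integral_partial0 i cv v0.
have mO : measurable (Om : set lebT) by exact: lebesgue_measurable_open.
have cS : closed S by exact: closed_closure.
have mS : measurable (S : set lebT) by exact: lebesgue_measurable_closed.
have dvE x : Om x -> partial i v x = u x * partial i psi x + psi x * partial i u x.
  move=> Ox; apply: partialM; first exact: ((cu _ Ox).2 i).1.
  exact: ((cpsiT _ Logic.I).2 i).1.
have IS f : (forall x, Om x -> {for x, continuous f}) -> (forall x, ~ S x -> f x = 0) ->
    leb.-integrable Om (EFin \o f).
  move=> cf f0; have IS : leb.-integrable S (EFin \o f).
    exact: (continuous_integrable_compact oO cf cpsi suppO).
  apply/(integrable_mkcond _ mO).
  have -> : (EFin \o f) \_ Om = (EFin \o f) \_ S.
    apply/funext => x; rewrite !patchE.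
    have [Sx|nSx] := pselect (S x); first by rewrite !mem_set//; exact: suppO.
    by rewrite [x \in S]memNset// /= f0//; case: ifP.
  exact/(integrable_mkcond _ mS).
have I1 : leb.-integrable Om (EFin \o (fun x => u x * partial i psi x)).
  apply: IS => [x Ox|x nS]; last by rewrite dpsi0// mulr0.
  exact: (continuousM (cu _ Ox).1 ((cpsiT x Logic.I).2 i).2).
have I2 : leb.-integrable Om (EFin \o (fun x => grad u x ord0 i * psi x)).
  apply: IS => [x Ox|x nS]; last by rewrite psi0// mulr0.
  have -> : (fun x => grad u x ord0 i * psi x) = (partial i u \* psi).
    by apply/funext => y; rewrite mxE.
  exact: (continuousM ((cu _ Ox).2 i).2 (cpsiT x Logic.I).1).
apply/eqP; rewrite -subr_eq0 opprK -RintegralD//; apply/eqP.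
rewrite /Rintegral; transitivity (fine (\int[leb]_x (partial i v x)%:E)); last by rewrite I0.
congr fine; rewrite integral_mkcond; apply: eq_integral => x _.
rewrite patchE; have [Ox|nOx] := pselect (Om x).
  by rewrite mem_set// dvE// mxE (mulrC (psi x)).
rewrite memNset//; congr EFin; apply/esym.
have nSx : ~ S x by move=> /suppO.
rewrite -(partial_cst i 0 x); apply: near_eq_derive.
apply: (@near_open _ _ (~` S)) => //; first exact: closed_openC.
by move=> y nSy; rewrite /v/= psi0// mulr0.
Qed.

End IntegrationByParts.

(** * The extension operator: energy estimate *)

Section Extension.
Context {R : realType} {n : nat} (Gamma : set 'rV[R]_n).
Hypotheses (n0 : (0 < n)%N) (G0 : Gamma !=set0) (cG : closed Gamma).
Variable phi : @dyadic n -> 'rV[R]_n -> R.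
Hypothesis hphi : whitney_partition Gamma phi.
Implicit Types (Q : @dyadic n) (x z : 'rV[R]_n) (i : 'I_n) (y : @dyadic n -> R).

(** [extension] with arbitrary values in place of the averages. This generality gives access to
    constant values, through which the partition of unity is used. *)
Definition glue y x : R := \sum_(Q \in whitney Gamma) phi Q x * y Q.

Lemma whitney_phi0 Q x : whitney Gamma Q -> ~ dilate 2 Q x -> phi Q x = 0.
Proof.
move=> wQ nx; apply: contrapT => /eqP px; apply: nx.
have [/(_ _ wQ)[_ sQ _] _ _] := hphi; apply: sQ; exact: subset_closure.
Qed.

Lemma whitney_partial0 Q x i : whitney Gamma Q -> ~ dilate 2 Q x -> partial i (phi Q) x = 0.
Proof.
move=> wQ nx; have [/(_ _ wQ)[_ sQ _] _ _] := hphi.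
rewrite -(partial_cst i 0 x); apply: near_eq_derive.
apply: (@near_open _ _ (~` closure [set x | phi Q x != 0])).
- by apply: closed_openC; exact: closed_closure.
- by move=> /sQ.
- by move=> z nz; apply: contrapT => /eqP pz; apply: nz; exact: subset_closure.
Qed.

Lemma glue_local x : ~ Gamma x -> exists2 r : R, 0 < r & ball x r `<=` ~` Gamma /\
  exists s : seq (@dyadic n), [/\ uniq s, forall Q, Q \in s -> whitney Gamma Q &
    forall y z, ball x r z -> glue y z = \sum_(Q <- s) phi Q z * y Q].
Proof.
move=> Gx; have [r r0 fA] := whitney_locally_finite n0 G0 cG Gx.
have /nbhs_ballP[r' /= r'0 hr'] : nbhs x (~` Gamma).
  by apply: open_nbhs_nbhs; split => //; exact: closed_openC.
exists (Num.min r r'); first by rewrite lt_min r0 r'0.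
have sub z : ball x (Num.min r r') z -> ball x r z /\ ball x r' z.
  by rewrite -!ball_normE/= lt_min => /andP[].
split; first by move=> z /sub[_ /hr'].
set A := [set Q | _] in fA.
exists (finmap.enum_fset (fset_set A)); split.
- exact: finmap.fset_uniq.
- by move=> Q; rewrite in_fset_set// => /set_mem[].
move=> y z /sub[xz _]; rewrite /glue -(fsbig_widen A (whitney Gamma)).
- by rewrite fsbig_finite.
- by move=> Q [].
- move=> Q [wQ nQ] /=; rewrite whitney_phi0 ?mul0r// => zQ; apply: nQ; split => //.
  by exists z.
Qed.

Lemma glue_C1_at x : ~ Gamma x -> exists s : seq (@dyadic n),
  [/\ uniq s, forall Q, Q \in s -> whitney Gamma Q,
      forall y, {for x, continuous (glue y)} /\
        forall i, derivable (glue y) x (delta_mx ord0 i) /\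
        {for x, continuous (partial i (glue y))},
      forall y, glue y x = \sum_(Q <- s) phi Q x * y Q &
      forall y i, partial i (glue y) x = \sum_(Q <- s) partial i (phi Q) x * y Q].
Proof.
move=> Gx; have [r r0 [rG [s [us sW hs]]]] := glue_local Gx.
have oB : open (ball x r) by exact: ball_open.
have xB : ball x r x by exact: ballxx.
(* The lemma on sums of C^1 functions asks for every index to be C^1, whereas nothing is known of
   [phi Q] when Q is not a Whitney cube. *)
pose f Q := if `[< whitney Gamma Q >] then phi Q else cst 0.
have fE Q : Q \in s -> f Q = phi Q by move=> /sW wQ; rewrite /f asboolT.
have fC Q : C1_on (ball x r) (f Q).
  rewrite /f; case: asboolP => [wQ|_]; last exact: C1_on_cst.
  by apply: smooth_C1_on; have [/(_ _ wQ)[]] := hphi.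
have gE y z : ball x r z -> glue y z = \sum_(Q <- s) f Q z * y Q.
  by move=> xz; rewrite hs//; apply: eq_big_seq => Q /fE ->.
exists s; split => // [y|y|y i].
- by apply: (C1_on_eq oB (gE y)) => //; exact: (C1_on_sum s y oB fC).1.
- by rewrite hs.
- transitivity (partial i (fun z => \sum_(Q <- s) f Q z * y Q) x).
    by apply: near_eq_derive; apply: (near_open oB) => // z /gE ->.
  rewrite (C1_on_sum s y oB fC).2//; apply: eq_big_seq => Q /fE -> //.
Qed.

Lemma glue_C1 y : C1_on (~` Gamma) (glue y).
Proof. by move=> x Gx; have [s [_ _ h _ _]] := glue_C1_at Gx; exact: h. Qed.

(* Subtracting a constant [c] from the [y Q] changes [glue y] by [c], since the
   [phi Q] add up to [1]; the gradient does not change. *)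
Lemma glueB x : ~ Gamma x -> exists s : seq (@dyadic n),
  [/\ uniq s, forall Q, Q \in s -> whitney Gamma Q /\ dilate 2 Q x,
      forall y (c : R), glue y x - c = \sum_(Q <- s) phi Q x * (y Q - c) &
      forall y (c : R) i, partial i (glue y) x = \sum_(Q <- s) partial i (phi Q) x * (y Q - c)].
Proof.
move=> Gx; have [s [us sW _ h1 h2]] := glue_C1_at Gx.
have glue1 z : ~ Gamma z -> glue (fun=> 1) z = 1.
  move=> Gz; have [_ _ /(_ z) hz] := hphi.
  transitivity (\1_(~` Gamma) z : R); last by rewrite indicE mem_set.
  by rewrite -hz /glue; apply: eq_fsbigr => Q _; rewrite mulr1.
have p1 : \sum_(Q <- s) phi Q x = 1.
  by rewrite -(glue1 x Gx) h1; apply: eq_bigr => Q _; rewrite mulr1.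
have p0 i : \sum_(Q <- s) partial i (phi Q) x = 0.
  transitivity (partial i (glue (fun=> 1)) x).
    by rewrite h2; apply: eq_bigr => Q _; rewrite mulr1.
  rewrite -(partial_cst i 1 x); apply: near_eq_derive.
  by apply: (near_open (closed_openC cG)).
exists [seq Q <- s | `[< dilate 2 Q x >]]; split.
- exact: filter_uniq.
- by move=> Q; rewrite mem_filter => /andP[/asboolP ? /sW].
- move=> y c; rewrite big_filter.
  rewrite (eq_bigr (fun Q => phi Q x * y Q - phi Q x * c)); last first.
    by move=> Q _; rewrite mulrBr.
  have -> : glue y x - c = \sum_(Q <- s) (phi Q x * y Q - phi Q x * c).
    by rewrite big_split/= sumrN -mulr_suml p1 mul1r h1.
  rewrite [RHS]big_mkcond/=; apply: eq_big_seq => Q /sW wQ.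
  by case: asboolP => // nQ; rewrite whitney_phi0// !mul0r subrr.
- move=> y c i; rewrite big_filter.
  rewrite (eq_bigr (fun Q => partial i (phi Q) x * y Q - partial i (phi Q) x * c)); last first.
    by move=> Q _; rewrite mulrBr.
  have -> : partial i (glue y) x =
      \sum_(Q <- s) (partial i (phi Q) x * y Q - partial i (phi Q) x * c).
    by rewrite big_split/= sumrN -mulr_suml p0 mul0r subr0 h2.
  rewrite [RHS]big_mkcond/=; apply: eq_big_seq => Q /sW wQ.
  by case: asboolP => // nQ; rewrite whitney_partial0// !mul0r subrr.
Qed.

Lemma whitney_grad_bound : exists2 C : R, 0 < C & forall Q x i, whitney Gamma Q ->
  `|partial i (phi Q) x| <= C / side Q.
Proof.
have [_ [C hC] _] := hphi; exists (`|C| + 1); first by rewrite ltr_wpDl.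
move=> Q x i wQ; have s0 := side_gt0 (R := R) Q.
have := norm_coord_le_enorm (grad (phi Q) x) i; rewrite mxE => /le_trans; apply.
apply: le_trans (hC _ _ wQ) _.
have dQ := diam_cube_ge (R := R) Q n0.
apply: (@le_trans _ _ ((`|C| + 1) / diam (cube Q : set 'rV[R]_n))).
  by rewrite ler_wpM2r ?invr_ge0 ?(le_trans (ltW s0))// (le_trans (ler_norm _))// lerDl.
rewrite ler_wpM2l ?addr_ge0// lef_pV2 ?posrE//.
exact: lt_le_trans dQ.
Qed.

End Extension.

Section LowerIntegralSub.
Context d (T : measurableType d) (R : realType).
Variable mu : {measure set T -> \bar R}.
Local Open Scope ereal_scope.

Lemma lower_integral_le_sub (A B : set T) (f g : T -> \bar R) : A `<=` B ->
  (forall x, A x -> 0 <= f x <= g x) -> (forall x, B x -> 0 <= g x) ->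
  \int[mu]_(x in A) f x <= \int[mu]_(x in B) g x.
Proof.
move=> AB fg g0; rewrite [leLHS]integral_mkcond [leRHS]integral_mkcond.
apply: lower_integral_le => x _.
  by apply: erestrict_ge0 => y /fg /andP[].
rewrite !patchE; case: ifPn => [/set_mem Ax|_].
  by rewrite (mem_set (AB _ Ax)); have /andP[] := fg _ Ax.
by case: ifPn => [/set_mem /g0|].
Qed.

End LowerIntegralSub.

Section Oscillation.
Context {R : realType} {n : nat} (d : R) (Gamma : set 'rV[R]_n).
Hypotheses (n0 : (0 < n)%N) (G0 : Gamma !=set0) (cG : closed Gamma).
Hypotheses (d0 : 0 < d) (aG : ahlfors_regular d Gamma).
Variables (phi : @dyadic n -> 'rV[R]_n -> R) (xi : @dyadic n -> 'rV[R]_n).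
Hypotheses (hphi : whitney_partition Gamma phi) (hxi : whitney_points Gamma xi).
Implicit Types (Q : @dyadic n) (x y z : 'rV[R]_n) (g : 'rV[R]_n -> R).
Local Notation hauT := (caratheodory_type (@hausdorff R n d)).
Local Notation sigma := (hausd n d).
Local Notation nu := (n%:R : R).

Let nu1 : 1 <= nu. Proof. by rewrite ler1n. Qed.
Let nu0 : 0 < nu. Proof. exact: lt_le_trans nu1. Qed.

Definition whitney_set Q : set 'rV[R]_n := Gamma `&` eball (xi Q) (dist_set (cube Q) Gamma).

(* The radius is such that [fat_set Q] contains the [whitney_set Q'] of all the
   cubes for which 2Q' meets 2Q. *)
Definition fat_set Q : set 'rV[R]_n :=
  Gamma `&` closed_ball_ Num.norm (center Q) (208 * nu ^+ 2 * side Q).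

Definition local_osc g Q : \bar R :=
  (\int[sigma]_(x in fat_set Q) \int[sigma]_(y in fat_set Q) ((g x - g y) ^+ 2)%:E)%E.

Lemma local_osc_ge0 g Q : (0 <= local_osc g Q)%E.
Proof. by do 2 (apply: integral_ge0 => ? _); rewrite lee_fin sqr_ge0. Qed.

Lemma whitney_set_measurable Q : measurable (whitney_set Q : set hauT).
Proof. exact: ahlfors_measurable_eball. Qed.

Lemma whitney_set_lty Q : (sigma (whitney_set Q) < +oo)%E.
Proof.
apply: le_lt_trans (ahlfors_bounded aG (xi Q) (dist_set (cube Q) Gamma)).
by apply: le_hausdorff => x [Gx /eball_sub_ball].
Qed.

Lemma whitney_set_integrable g Q : L1loc (@hausdorff R n d) Gamma g ->
  sigma.-integrable (whitney_set Q) (EFin \o g).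
Proof.
move=> Lg; apply: (@integrableS _ hauT R sigma (Gamma `&` ball (xi Q) (dist_set (cube Q) Gamma))).
- exact: ahlfors_measurable_ball.
- exact: whitney_set_measurable.
- by move=> x [Gx /eball_sub_ball].
- by apply: L1loc_integrable_ball => // U; exact: hausdorff_measurable_open.
Qed.

Lemma whitney_set_ge : exists2 c : R, 0 < c & forall Q, whitney Gamma Q ->
  c * side Q `^ d <= fine (sigma (whitney_set Q)).
Proof.
have [c c0 hc] := ahlfors_eball_ge aG; exists c => // Q wQ.
have s0 := side_gt0 (R := R) Q.
have /andP[h1 _] := whitney_dist_set n0 wQ.
have r0 : 0 < dist_set (cube Q) Gamma by apply: lt_le_trans h1; rewrite mulr_gt0.
have [Gxi _] := hxi wQ; rewrite -lee_fin fineK; last first.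
  by rewrite ge0_fin_numE ?outer_measure_ge0// whitney_set_lty.
apply: le_trans (hc _ _ Gxi r0); rewrite lee_fin ler_wpM2l ?(ltW c0)//.
rewrite ge0_ler_powR ?nnegrE ?(ltW d0) ?(ltW s0) ?(ltW r0)//.
by apply: le_trans h1; rewrite ler_peMl ?(ltW s0)// ler1n.
Qed.

Lemma whitney_set_fat Q Q' z : whitney Gamma Q -> whitney Gamma Q' ->
  dilate 2 Q z -> dilate 2 Q' z -> whitney_set Q' `<=` fat_set Q.
Proof.
move=> wQ wQ' zQ zQ' x [Gx xB]; split => //.
exact: (whitney_ball_neighbor n0 G0 hxi wQ wQ' zQ zQ' xB).
Qed.

(** Jensen on the product of the two whitney sets, divided by their masses, which are at least c l^d
    by Ahlfors regularity; (3 n)^d pays for replacing the side of Q' by that of Q. *)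
Lemma whitney_avg_osc : exists2 C : R, 0 < C & forall g, L1loc (@hausdorff R n d) Gamma g ->
  forall Q Q' z, whitney Gamma Q -> whitney Gamma Q' -> dilate 2 Q z -> dilate 2 Q' z ->
  (((whitney_avg d Gamma xi g Q' - whitney_avg d Gamma xi g Q) ^+ 2)%:E <=
    (C * (side Q `^ d) ^- 2)%:E * local_osc g Q)%E.
Proof.
have [c c0 hc] := whitney_set_ge.
have k0 : 0 < (3 * nu) `^ d by rewrite powR_gt0// mulr_gt0.
exists ((3 * nu) `^ d / c ^+ 2); first by rewrite divr_gt0// exprn_gt0.
move=> g Lg Q Q' z wQ wQ' zQ zQ'.
have s0 := side_gt0 (R := R) Q; have s'0 := side_gt0 (R := R) Q'.
have ss : side Q `^ d <= (3 * nu) `^ d * side Q' `^ d :> R.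
  rewrite -powRM ?(ltW s'0)// ?mulr_ge0//.
  rewrite ge0_ler_powR ?nnegrE ?(ltW d0) ?(ltW s0) ?mulr_ge0 ?(ltW s'0)//.
  exact: (whitney_neighbors n0 G0 wQ' wQ zQ' zQ).
have pQ P : whitney Gamma P -> (0 < sigma (whitney_set P))%E.
  move=> wP; rewrite lt0e measure_ge0 andbT; apply/eqP => e0; have := hc _ wP.
  by rewrite e0 leNgt mulr_gt0// powR_gt0// side_gt0.
have J := sqr_avg_dist_le (whitney_set_measurable Q') (pQ _ wQ') (whitney_set_lty Q')
  (whitney_set_integrable Q' Lg)
  (whitney_set_measurable Q) (pQ _ wQ) (whitney_set_lty Q) (whitney_set_integrable Q Lg).
have {J} : (((avg sigma (whitney_set Q') g - avg sigma (whitney_set Q) g) ^+ 2 *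
    fine (sigma (whitney_set Q')) * fine (sigma (whitney_set Q)))%:E <= local_osc g Q)%E.
  apply: le_trans J _; have subQ := whitney_set_fat wQ wQ zQ zQ.
  have subQ' := whitney_set_fat wQ wQ' zQ zQ'.
  have sq0 (a : R) : (0 <= (a ^+ 2)%:E)%E by rewrite lee_fin sqr_ge0.
  apply: (@lower_integral_le_sub _ hauT R sigma) => // x _; last first.
    by apply: integral_ge0 => y _.
  rewrite integral_ge0//=; apply: (@lower_integral_le_sub _ hauT R sigma) => // y _.
  by rewrite sq0 lexx.
rewrite -/(whitney_avg d Gamma xi g Q) -/(whitney_avg d Gamma xi g Q').
set t := (_ - _) ^+ 2; set m' := fine _; set m := fine _ => J.
have t0 : 0 <= t by exact: sqr_ge0.
have S0 : 0 < side Q `^ d :> R by rewrite powR_gt0.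
have S'0 : 0 < side Q' `^ d :> R by rewrite powR_gt0.
have hm : c * side Q `^ d <= m := hc _ wQ; have hm' : c * side Q' `^ d <= m' := hc _ wQ'.
apply: (@le_trans _ _ (((3 * nu) `^ d / c ^+ 2 * (side Q `^ d) ^- 2)%:E * (t * m' * m)%:E)%E).
  rewrite -EFinM lee_fin.
  have H : c * side Q `^ d / (3 * nu) `^ d * (c * side Q `^ d) <= m' * m.
    rewrite ler_pM ?divr_ge0 ?mulr_ge0 ?(ltW c0) ?(ltW S0) ?(ltW k0)//.
    apply: le_trans hm'; rewrite -mulrA ler_pM2l// ler_pdivrMr// mulrC //.
  have -> : (3 * nu) `^ d / c ^+ 2 * side Q `^ d ^- 2 * (t * m' * m) =
    t * ((m' * m) / (c * side Q `^ d / (3 * nu) `^ d * (c * side Q `^ d))).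
    by field; rewrite !gt_eqF.
  rewrite ler_peMr// ler_pdivlMr ?mul1r//.
  by rewrite mulr_gt0 ?divr_gt0 ?mulr_gt0.
by apply: lee_wpmul2l => //; rewrite lee_fin ltW// mulr_gt0 ?divr_gt0 ?invr_gt0 ?exprn_gt0.
Qed.

(** The exponent d + 1 - n is negative, so the lower bound on the distance to Gamma gives the upper
    bound on the weight. *)
Lemma weight_le Q z : d < n%:R - 1 -> whitney Gamma Q -> dilate 2 Q z ->
  weight d Gamma z <= side Q `^ (d + 1 - nu).
Proof.
move=> dn wQ zQ; have s0 := side_gt0 (R := R) Q.
have /andP[h1 _] := whitney_dist n0 G0 wQ zQ.
have h : side Q <= dist_pt z Gamma.
  by apply: le_trans h1; rewrite ler_peMl ?(ltW s0)// ler1n.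
have h0 : 0 < dist_pt z Gamma by exact: lt_le_trans h.
rewrite /weight; have -> : d + 1 - nu = - (nu - d - 1) by ring.
rewrite !powRN lef_pV2 ?posrE ?powR_gt0//.
by rewrite ge0_ler_powR ?nnegrE ?(ltW s0) ?(ltW h0)//; lra.
Qed.

(** The exponent of the side collects -2 from the squared gradient, -2d from Jensen and d + 1 - n
    from the weight. *)
Lemma grad_extension_le : d < n%:R - 1 ->
  exists2 C : R, 0 < C & forall g, L1loc (@hausdorff R n d) Gamma g ->
  forall Q z, whitney Gamma Q -> dilate 2 Q z ->
  ((enorm (grad (extension d Gamma phi xi g) z) ^+ 2 * weight d Gamma z)%:E <=
    (C * side Q `^ (- (d + 1 + nu)))%:E * local_osc g Q)%E.
Proof.
move=> dn; have [C1 C10 hosc] := whitney_avg_osc.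
have [C2 C20 hgrad] := whitney_grad_bound n0 hphi.
have [N hN] := whitney_count n0 G0.
pose L : R := N%:R * (3 * nu * C2).
have L0 : 0 <= L by rewrite mulr_ge0// mulr_ge0 ?(ltW C20)// mulr_ge0.
exists (nu * L ^+ 2 * C1 + 1).
  by rewrite ltr_wpDl// mulr_ge0 ?(ltW C10)// mulr_ge0// sqr_ge0.
move=> g Lg Q z wQ zQ; have s0 := side_gt0 (R := R) Q.
have K0 : 0 < (nu * L ^+ 2 * C1 + 1) * side Q `^ (- (d + 1 + nu)).
  rewrite mulr_gt0 ?powR_gt0//.
  by rewrite ltr_wpDl// mulr_ge0 ?(ltW C10)// mulr_ge0// sqr_ge0.
have Gz : ~ Gamma z.
  by move=> /(whitney_far wQ zQ); rewrite subrr normr0 ltNge mulr_ge0 ?(ltW s0).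
have O0 := local_osc_ge0 g Q.
have hq Q' : whitney Gamma Q' -> dilate 2 Q' z -> _ := fun w v => hosc g Lg Q Q' z wQ w zQ v.
(* An infinite oscillation makes the bound trivial; otherwise [W] is real and has a square root to
   work with. *)
case EW : (local_osc g Q) hq O0 => [W||] hq O0 //; last first.
  by rewrite gt0_muley ?leey// lte_fin.
rewrite lee_fin in O0.
set A := whitney_avg d Gamma xi g in hq.
pose S := side Q `^ d : R; have S0 : 0 < S by rewrite powR_gt0.
pose V := Num.sqrt (C1 * S ^- 2 * W).
have VV : V ^+ 2 = C1 * S ^- 2 * W.
  by rewrite sqr_sqrtr// mulr_ge0// mulr_ge0 ?(ltW C10)// invr_ge0 sqr_ge0.
have hV Q' : whitney Gamma Q' -> dilate 2 Q' z -> `|A Q' - A Q| <= V.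
  move=> wQ' zQ'; rewrite -(@ler_pXn2r _ 2)// ?nnegrE ?sqrtr_ge0// real_normK ?num_real//.
  by rewrite VV -lee_fin EFinM; exact: hq.
have [s [us hs _ hp]] := glueB n0 G0 cG hphi Gz.
have hpart i : `|partial i (extension d Gamma phi xi g) z| <= L / side Q * V.
  rewrite (hp A (A Q) i); apply: le_trans (ler_norm_sum _ _ _) _.
  apply: (@le_trans _ _ (\sum_(Q' <- s) (3 * nu * C2 / side Q * V))).
    rewrite big_seq [leRHS]big_seq; apply: ler_sum => Q' /hs[wQ' zQ'].
    rewrite normrM ler_pM// ?hV//; apply: le_trans (hgrad Q' z i wQ') _.
    have s'0 := side_gt0 (R := R) Q'.
    rewrite ler_pdivrMr// mulrAC ler_pdivlMr//.
    rewrite (_ : 3 * nu * C2 * side Q' = C2 * (3 * nu * side Q')); last by ring.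
    by rewrite ler_pM2l// (whitney_neighbors n0 G0 wQ' wQ zQ' zQ).
  rewrite big_const_seq count_predT iter_addr_0 -[leLHS]mulr_natl /L -!mulrA.
  rewrite ler_wpM2r ?ler_nat ?(hN z s us hs)//.
  by rewrite !mulr_ge0 ?invr_ge0 ?(ltW s0) ?(ltW C20) ?sqrtr_ge0.
have hw := weight_le dn wQ zQ.
have henorm : enorm (grad (extension d Gamma phi xi g) z) ^+ 2 <= nu * (L / side Q * V) ^+ 2.
  rewrite sqr_enorm; apply: (@le_trans _ _ (\sum_(i < n) (L / side Q * V) ^+ 2)).
    apply: ler_sum => i _; rewrite mxE -[leLHS]real_normK ?num_real//.
    by rewrite ler_pXn2r ?nnegrE//; apply: le_trans (hpart i).
  by rewrite sumr_const card_ord -[leLHS]mulr_natl.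
rewrite -EFinM lee_fin.
apply: (@le_trans _ _ (nu * (L / side Q * V) ^+ 2 * side Q `^ (d + 1 - nu))).
  by rewrite ler_pM ?sqr_ge0 ?powR_ge0.
have -> : side Q `^ (- (d + 1 + nu)) = side Q `^ (d + 1 - nu) / (S ^+ 2 * side Q ^+ 2) :> R.
  rewrite /S -(powR_mulrn 2) ?powR_ge0// -(powR_mulrn 2) ?(ltW s0)// -powRrM -powRD; last first.
    by rewrite (gt_eqF s0) implybT.
  rewrite -powRN -powRD; last by rewrite (gt_eqF s0) implybT.
  by congr (_ `^ _); ring.
rewrite (exprMn 2 (L / side Q)) VV.
set P := side Q `^ _; have P0 : 0 <= P by exact: powR_ge0.
have -> : nu * ((L / side Q) ^+ 2 * (C1 * S ^- 2 * W)) * P =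
   (nu * L ^+ 2 * C1) * (P / (S ^+ 2 * side Q ^+ 2) * W).
  by field; rewrite !gt_eqF.
rewrite -[leRHS]mulrA ler_wpM2r ?lerDl// mulr_ge0// divr_ge0// mulr_ge0 ?sqr_ge0//.
Qed.

End Oscillation.

Section DyadicIntegral.
Context {R : realType} {n : nat}.
Implicit Types (Q : @dyadic n) (z : 'rV[R]_n).
Local Notation lebT := (caratheodory_type (@lebesgue R n)).
Local Notation leb := (leb R n).

Lemma lebesgue_dilate2_le Q :
  (leb (dilate 2 Q : set 'rV[R]_n) <= ((2 * side Q) ^+ n)%:E)%E.
Proof.
have s0 := side_ge0 (R := R) Q.
have -> : 2 * side Q = 2 * (2 * side Q / 2) :> R by field.
by rewrite dilateE//; apply: lebesgue_closed_ball_le; rewrite divr_ge0// mulr_ge0.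
Qed.

Lemma dilate_measurable Q : measurable (dilate 2 Q : set lebT).
Proof.
by rewrite dilateE//; apply: lebesgue_measurable_closed; exact: closed_closed_ball_.
Qed.

(** F is dominated on D by the series of c Q times the indicator of 2Q over all dyadic cubes, which
    may be integrated term by term; its partial sums run over duplicate-free lists. *)
Lemma dyadic_integral_le (D : set 'rV[R]_n) (F : 'rV[R]_n -> \bar R)
    (c : @dyadic n -> \bar R) (B : \bar R) : measurable (D : set lebT) ->
  (forall z, D z -> 0 <= F z)%E -> (forall Q, 0 <= c Q)%E ->
  (forall z, D z -> exists2 Q, dilate 2 Q z & (F z <= c Q)%E) ->
  (forall s, uniq s -> \sum_(Q <- s) c Q * ((2 * side Q) ^+ n)%:E <= B)%E ->
  (\int[leb]_(z in D) F z <= B)%E.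
Proof.
move=> mD F0 c0 hF hB.
(* [pickle_inv] is an exact partial inverse, so the enumeration meets each cube only once, as [uniq]
   requires. *)
pose q k : option (@dyadic n) := @pickle_inv (int * 'rV[int]_n)%type k.
pose A k : set 'rV[R]_n := oapp (dilate 2) set0 (q k).
pose f k (z : 'rV[R]_n) : \bar R := (oapp c 0 (q k) * (\1_(A k) z)%:E)%E.
have c'0 k : (0 <= oapp c 0 (q k))%E by case: (q k).
have f0 k z : (0 <= f k z)%E by rewrite mule_ge0// lee_fin.
have mA k : measurable (A k : set lebT).
  by rewrite /A; case: (q k) => [Q|]; [exact: dilate_measurable|exact: measurable0].
have m1 k : measurable_fun (D : set lebT) (fun z => (\1_(A k) z : R)%:E).
  by apply/measurable_EFinP; apply: measurable_funTS; exact: measurable_indic.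
apply: (@le_trans _ _ (\int[leb]_(z in D) \sum_(0 <= k <oo) f k z)%E).
  apply: (@lower_integral_le _ lebT R leb) => // z Dz.
  have [Q zQ FQ] := hF _ Dz; apply: le_trans FQ _.
  have qQ : q (@pickle (int * 'rV[int]_n)%type Q) = Some Q by exact: pickleK_inv.
  apply: le_trans (nneseries_lim_ge (@pickle (int * 'rV[int]_n)%type Q).+1 _); last first.
    by move=> k _ _; exact: f0.
  rewrite big_nat_recr//= /f {2}/A qQ /= indicE mem_set// mule1 leeDr//.
  by apply: sume_ge0 => k _; exact: f0.
rewrite (@integral_nneseries _ lebT R leb D mD f)//; last first.
  by move=> k; exact: measurable_funeM.
apply: lime_le; first by apply: is_cvg_nneseries => k _ _; exact: integral_ge0.
apply: nearW => K.
apply: le_trans (hB (pmap q (iota 0 K)) _); last first.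
  exact: (@pmap_uniq _ _ _ _ (@pickle_invK (int * 'rV[int]_n)%type) _ (iota_uniq 0 K)).
rewrite big_pmap /index_iota subn0; apply: lee_sum => k _.
rewrite /f (@ge0_integralZl _ lebT R leb D mD)//.
rewrite (@integral_indic _ lebT R leb D mD)//.
case E : (q k) => [Q|] /=; last by rewrite mul0e.
rewrite lee_wpmul2l//; apply: le_trans (lebesgue_dilate2_le Q).
by apply: le_outer_measure; rewrite /A E => z [].
Qed.

End DyadicIntegral.

Section Energy.
Context {R : realType} {n : nat} (d : R) (Gamma : set 'rV[R]_n).
Hypotheses (n0 : (0 < n)%N) (G0 : Gamma !=set0) (cG : closed Gamma).
Hypotheses (d0 : 0 < d) (aG : ahlfors_regular d Gamma).
Implicit Types (Q : @dyadic n) (x y z : 'rV[R]_n) (g : 'rV[R]_n -> R).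
Local Notation hauT := (caratheodory_type (@hausdorff R n d)).
Local Notation sigma := (hausd n d).
Local Notation nu := (n%:R : R).

Let nu1 : 1 <= nu. Proof. by rewrite ler1n. Qed.
Let nu0 : 0 < nu. Proof. exact: lt_le_trans nu1. Qed.

Definition kernel g x y : R := (g x - g y) ^+ 2 / enorm (x - y) `^ (d + 1).

Definition H_energy g : \bar R :=
  (\int[sigma]_(x in Gamma) \int[sigma]_(y in Gamma) (kernel g x y)%:E)%E.

Lemma kernel_ge0 g x y : 0 <= kernel g x y.
Proof. by rewrite divr_ge0 ?sqr_ge0 ?powR_ge0. Qed.

Lemma fat_sum_kernel : exists2 C : R, 0 < C & forall g x y (s : seq (@dyadic n)), uniq s ->
  \sum_(Q <- s | `[< fat_set Gamma Q x >] && `[< fat_set Gamma Q y >])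
    side Q `^ (- (d + 1)) * (g x - g y) ^+ 2 <= C * kernel g x y.
Proof.
pose K := 208 * nu ^+ 2; have K0 : 0 < K by rewrite mulr_gt0// exprn_gt0.
have b0 : - (d + 1) != 0 by rewrite oppr_eq0 gt_eqF// addr_gt0.
have [C C0 hC] := @sum_side R n K (- (d + 1)) (ltW K0) b0.
have M0 : 0 < nu * (2 * K) by rewrite !mulr_gt0.
exists (C * (nu * (2 * K)) `^ (d + 1)); first by rewrite mulr_gt0// powR_gt0.
(* On the diagonal the sides are not bounded below, but both members of the inequality vanish. *)
move=> g x y s us; have [->|xy] := eqVneq x y.
  rewrite big1; first by rewrite mulr_ge0 ?kernel_ge0// mulr_ge0 ?(ltW C0)// powR_ge0.
  by move=> Q _; rewrite subrr expr0n mulr0.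
have e0 : 0 < enorm (x - y).
  by rewrite lt0r enorm_ge0 andbT; apply: contraNneq xy => /enorm_eq0/eqP; rewrite subr_eq0.
rewrite -mulr_suml -big_filter; set s' := [seq Q <- s | _].
have : \sum_(Q <- s') side Q `^ (- (d + 1)) <=
    C * (enorm (x - y) / (nu * (2 * K))) `^ (- (d + 1)).
  apply: (hC x); [exact: filter_uniq|exact: powR_ge0|].
  move=> Q; rewrite mem_filter => /andP[/andP[/asboolP[_ xQ] /asboolP[_ yQ]] _].
  split; first exact: xQ.
  have s0 := side_gt0 (R := R) Q.
  have h : enorm (x - y) / (nu * (2 * K)) <= side Q.
    rewrite ler_pdivrMr//; apply: le_trans (enorm_le_norm _) _.
    rewrite mulrCA ler_pM2l//.
    have := ler_distD (center Q) x y; rewrite (distrC x (center Q)).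
    rewrite /closed_ball_/= -/K in xQ yQ; lra.
  rewrite !powRN lef_pV2 ?posrE ?powR_gt0 ?divr_gt0//.
  rewrite ge0_ler_powR ?nnegrE ?(ltW s0)//; last by rewrite divr_ge0 ?(ltW e0) ?(ltW M0).
  by rewrite addr_ge0 ?(ltW d0).
move=> h; apply: le_trans (ler_wpM2r (sqr_ge0 (g x - g y)) h) _.
rewrite /kernel powRM ?(ltW e0) ?invr_ge0 ?(ltW M0)//
  -(powR_inv1 (ltW M0)) -powRrM mulN1r opprK powRN.
by rewrite le_eqVlt; apply/orP; left; apply/eqP; ring.
Qed.

(** Superadditivity is applied in x and then, for fixed x, in y; what remains is the pointwise
    inequality [fat_sum_kernel]. *)
Lemma local_osc_sum : exists2 C : R, 0 < C & forall g (s : seq (@dyadic n)), uniq s ->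
  (\sum_(Q <- s) (side Q `^ (- (d + 1)))%:E * local_osc d Gamma g Q <= C%:E * H_energy g)%E.
Proof.
have [C C0 hC] := fat_sum_kernel; exists C => // g s us.
pose c Q := side Q `^ (- (d + 1)) / C.
have c0 Q : 0 <= c Q by rewrite divr_ge0 ?powR_ge0 ?(ltW C0).
pose sq x y : \bar R := ((g x - g y) ^+ 2)%:E.
have sq0 x y : (0 <= sq x y)%E by rewrite lee_fin sqr_ge0.
pose D Q := fat_set Gamma Q.
pose f Q x y : \bar R := ((sq x) \_ (D Q)) y.
pose F Q : 'rV[R]_n -> \bar R := (fun x => \int[sigma]_y f Q x y)%E \_ (D Q).
have f0 Q x y : (0 <= f Q x y)%E by apply: erestrict_ge0.
have F0 Q x : (0 <= F Q x)%E by apply: erestrict_ge0 => z _; exact: integral_ge0.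
have oscE Q : local_osc d Gamma g Q = (\int[sigma]_x F Q x)%E.
  rewrite /local_osc integral_mkcond; congr (integral _ _ (_ \_ _)).
  by apply/funext => x; rewrite integral_mkcond.
have : (\sum_(Q <- s) (c Q)%:E * \int[sigma]_x F Q x <= H_energy g)%E.
  rewrite /H_energy [leRHS]integral_mkcond.
  apply: (@lower_integral_sum _ hauT R sigma) => // x.
  have [Gx|nGx] := pselect (Gamma x); last first.
    rewrite patchE memNset// big1// => Q _; rewrite /F patchE memNset ?mule0//.
    by case.
  rewrite patchE mem_set// integral_mkcond.
  (* With x frozen, its membership in the fat set moves into the coefficient, so that the inner
     integrals have the shape of the outer ones. *)
  pose c' Q := if `[< D Q x >] then c Q else 0.
  rewrite (eq_bigr (fun Q => ((c' Q)%:E * \int[sigma]_y f Q x y)%E)); last first.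
    move=> Q _; rewrite /F patchE /c'; case: asboolP => Dx; first by rewrite mem_set.
    by rewrite memNset// mule0 mul0e.
  apply: (@lower_integral_sum _ hauT R sigma) => // [Q|y].
    by rewrite /c'; case: ifP.
  have [Gy|nGy] := pselect (Gamma y); last first.
    by rewrite patchE memNset// big1// => Q _; rewrite /f patchE memNset ?mule0// => -[].
  rewrite patchE mem_set//.
  rewrite (eq_bigr (fun Q => (if `[< D Q x >] && `[< D Q y >] then
      side Q `^ (- (d + 1)) * (g x - g y) ^+ 2 / C else 0)%:E)); last first.
    move=> Q _; rewrite /c' /f patchE.
    case: asboolP => Dx /=; last by rewrite mul0e.
    case: asboolP => Dy; last by rewrite memNset// mule0.
    by rewrite mem_set// /sq -EFinM /c mulrAC.
  rewrite sumEFin lee_fin -big_mkcond/= -mulr_suml ler_pdivrMr// mulrC.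
  exact: hC.
move=> h; rewrite -lee_pdivrMl//; apply: le_trans h.
rewrite ge0_sume_distrr; last first.
  by move=> Q _; rewrite mule_ge0 ?local_osc_ge0// lee_fin powR_ge0.
by apply: lee_sum => Q _; rewrite oscE muleA -EFinM mulrC.
Qed.

Variables (phi : @dyadic n -> 'rV[R]_n -> R) (xi : @dyadic n -> 'rV[R]_n).
Hypotheses (hphi : whitney_partition Gamma phi) (hxi : whitney_points Gamma xi).

(** With no double cube at z the list in [glueB] would be empty, and taking c = 0 and c = 1 there
    would give 0 = 1. *)
Lemma whitney_cover z : ~ Gamma z -> exists2 Q, whitney Gamma Q & dilate 2 Q z.
Proof.
move=> Gz; have [s [_ hs hg _]] := glueB n0 G0 cG hphi Gz.
have := hg (fun=> 0) 0; have := hg (fun=> 0) 1; case: s hs hg => [_ _|Q s hs _ _ _].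
  by rewrite !big_nil subr0 => /eqP; rewrite subr_eq0 => /eqP -> /eqP; rewrite oner_eq0.
by have [] := hs Q (mem_head _ _); exists Q.
Qed.

Theorem energy_extension : d < n%:R - 1 ->
  exists2 C : R, 0 < C & forall g, L1loc (@hausdorff R n d) Gamma g ->
  (energy d Gamma (grad (extension d Gamma phi xi g)) <= C%:E * H_energy g)%E.
Proof.
move=> dn; have [C1 C10 h1] := grad_extension_le n0 G0 cG d0 aG hphi hxi dn.
have [C2 C20 h2] := local_osc_sum.
exists (C1 * 2 ^+ n * C2); first by rewrite !mulr_gt0// exprn_gt0.
move=> g Lg; rewrite /energy.
pose c Q : \bar R := ((C1 * side Q `^ (- (d + 1 + nu)))%:E * local_osc d Gamma g Q)%E.
have c0 Q : (0 <= c Q)%E.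
  by rewrite mule_ge0 ?local_osc_ge0// lee_fin mulr_ge0 ?powR_ge0 ?(ltW C10).
apply: (@dyadic_integral_le _ _ _ _ c) => //.
- by apply: lebesgue_measurable_open; exact: closed_openC.
- by move=> z _; rewrite lee_fin mulr_ge0 ?sqr_ge0 ?powR_ge0.
- by move=> z /whitney_cover[Q wQ zQ]; exists Q => //; exact: h1.
move=> s us; rewrite EFinM -muleA.
apply: le_trans (lee_wpmul2l _ (h2 g s us)); last first.
  by rewrite lee_fin mulr_ge0 ?(ltW C10)// exprn_ge0.
rewrite ge0_sume_distrr; last first.
  by move=> Q _; rewrite mule_ge0 ?local_osc_ge0// lee_fin powR_ge0.
apply: lee_sum => Q _; rewrite /c muleAC -EFinM muleA -EFinM.
have s0 := side_gt0 (R := R) Q.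
have -> : - (d + 1 + nu) = - (d + 1) - nu by ring.
rewrite powRD; last by rewrite (gt_eqF s0) implybT.
rewrite (powRN _ nu) powR_mulrn ?(ltW s0)// exprMn.
rewrite (_ : C1 * (side Q `^ (- (d + 1)) / side Q ^+ n) * (2 ^+ n * side Q ^+ n) =
  C1 * 2 ^+ n * side Q `^ (- (d + 1)))//.
by field; rewrite expf_eq0 (gt_eqF s0) andbF.
Qed.

End Energy.

(** * The space H: local integrability and the energy bound *)

Section HSpace.
Context {R : realType} {n : nat} (d : R) (Gamma : set 'rV[R]_n).
Hypotheses (n0 : (0 < n)%N) (G0 : Gamma !=set0) (cG : closed Gamma).
Hypotheses (d0 : 0 < d) (aG : ahlfors_regular d Gamma).
Implicit Types (Q : @dyadic n) (x y z : 'rV[R]_n) (g : 'rV[R]_n -> R).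
Local Notation hauT := (caratheodory_type (@hausdorff R n d)).
Local Notation sigma := (hausd n d).
Local Notation nu := (n%:R : R).

Lemma H_energy_ge0 g : (0 <= H_energy d Gamma g)%E.
Proof. by do 2 (apply: integral_ge0 => ? _); rewrite lee_fin kernel_ge0. Qed.

Lemma H_space_energy_lty g : H_space d Gamma g -> (H_energy d Gamma g < +oo)%E.
Proof. by move=> [_]; apply: lty_poweRy. Qed.

(** Otherwise the inner integral is the constant +oo on Gamma, which has positive measure, and the
    energy is infinite. *)
Lemma H_finite_point g : (H_energy d Gamma g < +oo)%E ->
  exists2 x, Gamma x & (\int[sigma]_(y in Gamma) (kernel d g x y)%:E < +oo)%E.
Proof.
move=> Hoo; apply: contrapT => nx; move: Hoo; rewrite ltNge => /negP; apply.
rewrite /H_energy (_ : (\int[sigma]_(x in Gamma) _)%E =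
    (\int[sigma]_(x in Gamma) cst +oo x)%E); last first.
  apply: (@eq_integral _ hauT R sigma) => x /set_mem Gx /=; apply: contrapT => h.
  by apply: nx; exists x => //; rewrite ltey; apply/eqP.
rewrite (@integral_cst _ hauT R sigma)//; last exact: ahlfors_measurable.
rewrite gt0_mulye ?leey//; have [x0 Gx0] := G0.
have [c c0 hc] := ahlfors_eball_ge aG.
apply: (@lt_le_trans _ _ (c * 1 `^ d)%:E); first by rewrite lte_fin powR1 mulr1.
by apply: le_trans (hc _ _ Gx0 ltr01) _; apply: le_hausdorff => x [].
Qed.

(** Freeze a point x0 with finite inner integral. On a compact K the distance to x0 is at most M, so
    (g(x0) - g)^2 is integrable over K; since K has finite measure, so is g. *)
Lemma H_space_L1loc g : H_space d Gamma g -> L1loc (@hausdorff R n d) Gamma g.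
Proof.
move=> Hg; split; first exact: Hg.1.
move=> K cK KG; have mg := Hg.1; rewrite -/(hausd n d).
have mK : measurable (K : set hauT).
  by apply: hausdorff_measurable_closed; exact: compact_closed.
have mgK : measurable_fun (K : set hauT) g.
  exact: (measurable_funS (ahlfors_measurable d cG) KG mg).
have [x0 Gx0 h0] := H_finite_point (H_space_energy_lty Hg).
have [a aK] := compact_norm_lt cK.
have Koo : (sigma K < +oo)%E.
  apply: le_lt_trans (ahlfors_bounded aG 0 a); apply: le_hausdorff => x Kx; split; first exact: KG.
  by rewrite -ball_normE/= sub0r normrN; exact: aK.
pose M := nu * (`|x0| + `|a|) + 1.
have M0 : 0 < M by rewrite ltr_wpDl// mulr_ge0// addr_ge0.
have hM y : K y -> enorm (x0 - y) <= M.
  move=> /aK ya; apply: le_trans (enorm_le_norm _) _; rewrite /M ler_wpDr// ler_wpM2l//.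
  by apply: le_trans (ler_normB _ _) _; rewrite lerD2l (le_trans (ltW ya))// ler_norm.
pose P := M `^ (d + 1); have P0 : 0 < P by rewrite powR_gt0.
pose h y : R := (g x0 - g y) ^+ 2 / P.
have mh : measurable_fun (K : set hauT) h.
  apply: (@measurable_funM _ hauT R K (fun y => (g x0 - g y) ^+ 2) (cst P^-1)); last first.
    exact: measurable_cst.
  apply: (@measurable_funX _ hauT R K (fun y => g x0 - g y) 2).
  by apply: (@measurable_funB _ hauT R K (cst (g x0)) g) => //; exact: measurable_cst.
have Ih : sigma.-integrable K (EFin \o h).
  apply/integrableP; split; first exact/measurable_EFinP.
  apply: le_lt_trans h0; apply: (@lower_integral_le_sub _ hauT R sigma) => // y Ky; last first.
    by rewrite lee_fin kernel_ge0.
  rewrite abse_ge0/= lee_fin ger0_norm ?divr_ge0 ?sqr_ge0 ?(ltW P0)// /h /kernel.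
  have [->|xy] := eqVneq x0 y; first by rewrite subrr expr0n/= !mul0r.
  have e0 : 0 < enorm (x0 - y).
    by rewrite lt0r enorm_ge0 andbT; apply: contraNneq xy => /enorm_eq0/eqP; rewrite subr_eq0.
  rewrite ler_wpM2l ?sqr_ge0// lef_pV2 ?posrE ?powR_gt0//.
  by rewrite ge0_ler_powR ?nnegrE ?enorm_ge0 ?(ltW M0) ?addr_ge0 ?(ltW d0) ?hM.
have IPh := @integrableZl _ hauT R sigma K mK P _ Ih.
have Ic : sigma.-integrable K (EFin \o cst (`|g x0| + 1)).
  exact: (@integrable_cst_finite _ hauT R sigma).
apply: (le_integrable mK _ _ (integrableD mK Ic IPh)); first exact/measurable_EFinP.
move=> y Ky /=; rewrite lee_fin /h [P * _]mulrC divfK ?gt_eqF//.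
rewrite [leRHS]ger0_norm ?addr_ge0 ?sqr_ge0//.
have h1 : `|g y| <= `|g x0| + `|g x0 - g y|.
  by have := ler_normB (g x0) (g x0 - g y); rewrite opprB addrCA subrr addr0.
have h2 : `|g x0 - g y| ^+ 2 = (g x0 - g y) ^+ 2 by rewrite real_normK ?num_real.
(* The elementary bound t <= 1 + t^2 with t = |g(x0) - g(y)|. *)
by have := sqr_ge0 (`|g x0 - g y| - 1); rewrite -h2; nra.
Qed.

Variables (phi : @dyadic n -> 'rV[R]_n -> R) (xi : @dyadic n -> 'rV[R]_n).
Hypotheses (hphi : whitney_partition Gamma phi) (hxi : whitney_points Gamma xi).

Theorem extension_bounded : d < n%:R - 1 -> exists2 C : R, 0 < C &
  forall g, H_space d Gamma g -> W_space d Gamma (extension d Gamma phi xi g) /\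
    (W_norm d Gamma (extension d Gamma phi xi g) <= C%:E * H_norm d Gamma g)%E.
Proof.
move=> dn; have [C C0 hC] := energy_extension n0 G0 cG d0 aG hphi hxi dn.
exists (C `^ 2^-1); first by rewrite powR_gt0.
move=> g Hg; have Lg := H_space_L1loc Hg; have h := hC _ Lg.
set E := extension _ _ _ _ _ in h *.
have oG : open (~` Gamma) by exact: closed_openC.
have cE : C1_on (~` Gamma) E by exact: (glue_C1 n0 G0 cG hphi).
have wE := weak_gradient_C1 oG cE.
split.
  split; first by apply: L1loc_continuous => // x Gx; exact: (cE x Gx).1.
  exists (grad E) => //; apply: le_lt_trans h _.
  by rewrite lte_mul_pinfty ?lee_fin ?(ltW C0)//; exact: H_space_energy_lty.
apply: (@le_trans _ _ (energy d Gamma (grad E) `^ 2^-1)%E).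
  by apply: ereal_inf_lbound; exists (grad E).
have e0 : (0 <= energy d Gamma (grad E))%E.
  by apply: integral_ge0 => z _; rewrite lee_fin mulr_ge0 ?sqr_ge0 ?powR_ge0.
rewrite -poweR_EFin -poweRM ?lee_fin ?(ltW C0)//; last exact: H_energy_ge0.
apply: gt0_ler_poweR => //; first by rewrite in_itv/= e0 leey.
by rewrite in_itv/= leey andbT mule_ge0 ?lee_fin ?(ltW C0)//; exact: H_energy_ge0.
Qed.

End HSpace.

(** * Traces *)

Section AverageDeviation.
Context d (T : measurableType d) (R : realType).
Variable mu : {measure set T -> \bar R}.

Lemma avg_dist_le (A : set T) (f : T -> R) (c : R) :
  measurable A -> (0 < mu A)%E -> (mu A < +oo)%E -> mu.-integrable A (EFin \o f) ->
  (`|avg mu A f - c|%:E <= ((fine (mu A))^-1)%:E * \int[mu]_(x in A) `|f x - c|%:E)%E.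
Proof.
move=> mA A0 Aoo If.
have Ifc : mu.-integrable A (EFin \o (fun x => f x - c)).
  exact: (integrableB mA If (integrable_cst_finite mA Aoo c)).
have m0 : 0 < fine (mu A) by exact: fine_measure_gt0.
rewrite -avgB// /avg normrM gtr0_norm ?invr_gt0// EFinM lee_wpmul2l ?lee_fin ?invr_ge0 ?(ltW m0)//.
rewrite EFin_normr_Rintegral//.
exact: (@le_abse_integral _ T R mu A _ mA (measurable_int _ Ifc)).
Qed.

End AverageDeviation.

Section Trace.
Context {R : realType} {n : nat} (d : R) (Gamma : set 'rV[R]_n).
Hypotheses (n0 : (0 < n)%N) (G0 : Gamma !=set0) (cG : closed Gamma).
Hypotheses (d0 : 0 < d) (dn : d < n%:R) (aG : ahlfors_regular d Gamma).
Variables (phi : @dyadic n -> 'rV[R]_n -> R) (xi : @dyadic n -> 'rV[R]_n).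
Hypotheses (hphi : whitney_partition Gamma phi) (hxi : whitney_points Gamma xi).
Implicit Types (Q : @dyadic n) (x y z : 'rV[R]_n) (g : 'rV[R]_n -> R) (r : R).
Local Notation hauT := (caratheodory_type (@hausdorff R n d)).
Local Notation sigma := (hausd n d).
Local Notation lebT := (caratheodory_type (@lebesgue R n)).
Local Notation leb := (leb R n).
Local Notation nu := (n%:R : R).

Let nu1 : 1 <= nu. Proof. by rewrite ler1n. Qed.
Let nu0 : 0 < nu. Proof. exact: lt_le_trans nu1. Qed.

(** At z the glued function is a convex combination of the values of the cubes near z, so it is no
    farther from c than the farthest of them. *)
Lemma glue_dist_le (y : @dyadic n -> R) z (c : R) : ~ Gamma z ->
  exists Q, [/\ whitney Gamma Q, dilate 2 Q z & `|glue Gamma phi y z - c| <= `|y Q - c|].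
Proof.
move=> Gz; have [s [_ hs hg _]] := glueB n0 G0 cG hphi Gz.
(* The sum is recovered from [glueB] with all values 0, by comparing c = 0 with c = 1. *)
have p1 : \sum_(Q <- s) phi Q z = 1.
  have := hg (fun=> 0) 0; have := hg (fun=> 0) 1; rewrite subr0 => e1 e0.
  move: e1; rewrite e0 -[in X in _ = X]mulr_suml.
  by rewrite -mulr_suml subrr mulr0 !sub0r mulrN1 => /oppr_inj.
have sn0 : s != [::].
  by apply/eqP => s0; move/eqP: p1; rewrite s0 big_nil eq_sym oner_eq0.
have [Q Qs hQ] := seq_argmax (fun Q => `|y Q - c|) sn0.
have [wQ zQ] := hs _ Qs; exists Q; split => //.
rewrite hg; apply: le_trans (ler_norm_sum _ _ _) _.
rewrite -[leRHS]mul1r -p1 mulr_suml big_seq [leRHS]big_seq; apply: ler_sum => P Ps.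
have [wP _] := hs _ Ps; have [/(_ _ wP)[_ _ /(_ z)/andP[p0 _]] _ _] := hphi.
by rewrite normrM ger0_norm// ler_wpM2l// hQ.
Qed.

(** A cube contributes its volume, of order l^n, times a deviation of averages costing l^(-d). Cubes
    whose doubles meet B(x, r) have l <= r / 9, so the sum of l^(n-d) is dominated by its largest
    scale, of order r^(n-d). *)
Lemma extension_dist_integral_le : exists2 C : R, 0 < C &
  forall g, L1loc (@hausdorff R n d) Gamma g -> forall x r, Gamma x -> 0 < r ->
  (\int[leb]_(z in eball x r `&` ~` Gamma) `|extension d Gamma phi xi g z - g x|%:E <=
   (C * r `^ (nu - d))%:E *
     \int[sigma]_(y in Gamma `&` ball x (70 * nu * r)) `|g y - g x|%:E)%E.
Proof.
have [c c0 hc] := whitney_set_ge n0 d0 aG hxi.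
have b0 : nu - d != 0 by rewrite gt_eqF// subr_gt0.
have K0 : 0 <= 68 * nu by rewrite mulr_ge0.
have [C C0 hC] := @sum_side R n (68 * nu) (nu - d) K0 b0.
exists (2 ^+ n / c * C); first by rewrite mulr_gt0// divr_gt0// exprn_gt0.
move=> g Lg x r Gx r0.
pose A := whitney_avg d Gamma xi g.
pose meets Q := `[< whitney Gamma Q /\ exists2 z, eball x r z & dilate 2 Q z >].
pose cQ Q : \bar R := (if meets Q then `|A Q - g x| else 0)%:E.
pose I Q : \bar R := (\int[sigma]_(y in whitney_set Gamma xi Q) `|g y - g x|%:E)%E.
have I0 Q : (0 <= I Q)%E by apply: integral_ge0 => y _; rewrite lee_fin.
apply: (@dyadic_integral_le _ _ _ _ cQ) => //.
- apply: lebesgue_measurable_open; apply: openI; first exact: open_eball.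
  exact: closed_openC.
- by move=> Q; rewrite lee_fin; case: ifP.
- move=> z [xz Gz]; have [Q [wQ zQ h]] := glue_dist_le A (g x) Gz; exists Q => //.
  by rewrite lee_fin /cQ /meets asboolT//; split => //; exists z.
move=> s us.
(* Normalized so that the weights of the cubes whose whitney set contains a given point add up to at
   most 1. *)
pose k Q := if meets Q then side Q `^ (nu - d) / (C * r `^ (nu - d)) else 0.
have R0 : 0 < C * r `^ (nu - d) by rewrite mulr_gt0// powR_gt0.
have k0 Q : 0 <= k Q.
  by rewrite /k; case: ifP => // _; rewrite divr_ge0 ?powR_ge0 ?(ltW R0).
have side_le Q : meets Q -> side Q <= r / 9.
  move=> /asboolP[wQ [z xz zQ]]; have := whitney_far wQ zQ Gx.
  by have := eball_sub_ball xz; rewrite -ball_normE/= distrC; lra.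
have H1 Q : (cQ Q * ((2 * side Q) ^+ n)%:E <=
    (2 ^+ n / c * C * r `^ (nu - d))%:E * ((k Q)%:E * I Q))%E.
  rewrite /cQ /k; case: ifP => [/asboolP[wQ _]|_]; last by rewrite !mul0e mule0.
  have s0 := side_gt0 (R := R) Q.
  have m0 : 0 < fine (sigma (whitney_set Gamma xi Q)).
    by apply: lt_le_trans (hc _ wQ); rewrite mulr_gt0// powR_gt0.
  have p0 : (0 < sigma (whitney_set Gamma xi Q))%E.
    rewrite lt0e measure_ge0 andbT; apply/eqP => e0.
    by move: m0; rewrite e0 ltxx.
  have h := avg_dist_le (g x) (whitney_set_measurable d cG xi Q) p0 (whitney_set_lty aG xi Q)
    (whitney_set_integrable cG xi Q Lg).
  have h' : (`|A Q - g x|%:E <= ((c * side Q `^ d)^-1)%:E * I Q)%E.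
    apply: le_trans h _; apply: lee_wpmul2r; [exact: I0|rewrite lee_fin].
    by rewrite lef_pV2 ?posrE ?mulr_gt0 ?powR_gt0// hc.
  apply: le_trans (lee_wpmul2r _ h') _; first by rewrite lee_fin exprn_ge0// mulr_ge0 ?(ltW s0).
  rewrite muleAC -EFinM muleA -EFinM.
  rewrite (_ : (c * side Q `^ d)^-1 * (2 * side Q) ^+ n =
    2 ^+ n / c * C * r `^ (nu - d) * (side Q `^ (nu - d) / (C * r `^ (nu - d))))//.
  rewrite (@powRD _ (side Q)); last by rewrite (gt_eqF s0) implybT.
  rewrite powRN powR_mulrn ?(ltW s0)// exprMn.
  by field; rewrite !gt_eqF ?powR_gt0.
apply: (@le_trans _ _ (\sum_(Q <- s) (2 ^+ n / c * C * r `^ (nu - d))%:E * ((k Q)%:E * I Q))%E).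
  by apply: lee_sum => Q _; exact: H1.
rewrite -ge0_sume_distrr; last by move=> Q _; rewrite mule_ge0// lee_fin.
apply: lee_wpmul2l; first by rewrite lee_fin !mulr_ge0 ?invr_ge0 ?(ltW c0) ?(ltW C0) ?powR_ge0.
pose f y : \bar R := `|g y - g x|%:E.
rewrite (eq_bigr (fun Q =>
    (k Q)%:E * \int[sigma]_y (f \_ (whitney_set Gamma xi Q)) y))%E; last first.
  by move=> Q _; rewrite -integral_mkcond.
rewrite [leRHS]integral_mkcond.
have f0 y : (0 <= f y)%E by rewrite lee_fin.
apply: (@lower_integral_sum _ hauT R sigma) => // [Q y|y].
  by apply: erestrict_ge0.
(* From x to y by way of z and the centre: r + l + 68 n l with l <= r / 9, below 70 n r. *)
have far Q : meets Q -> whitney_set Gamma xi Q y ->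
    (Gamma `&` ball x (70 * nu * r)) y /\ `|center Q - y| <= 68 * nu * side Q.
  move=> mQ [Gy yQ]; have hs := side_le _ mQ.
  move: mQ => /asboolP[wQ [z xz /dilate2P zQ]].
  have h := whitney_ball_sub n0 hxi wQ yQ; split => //; split => //.
  have hxz := eball_sub_ball xz; rewrite -ball_normE/= in hxz; rewrite -ball_normE/=.
  have h1 := ler_distD z x y; have h2 := ler_distD (center Q) z y.
  rewrite (distrC z (center Q)) in h2.
  have h3 : nu * side Q <= nu * (r / 9) by rewrite ler_pM2l.
  have h4 : r <= nu * r by rewrite ler_peMl// ltW.
  lra.
have [By|nBy] := pselect ((Gamma `&` ball x (70 * nu * r)) y); last first.
  rewrite big1 ?erestrict_ge0// => Q _; rewrite /k; case: ifPn => [mQ|_]; last by rewrite mul0e.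
  rewrite patchE memNset ?mule0// => yQ; apply: nBy; exact: (far _ mQ yQ).1.
rewrite [leRHS]patchE mem_set//.
rewrite (eq_bigr (fun Q => (if meets Q && `[< whitney_set Gamma xi Q y >] then
   side Q `^ (nu - d) * `|g y - g x| / (C * r `^ (nu - d)) else 0)%:E)); last first.
  move=> Q _; rewrite /k; case: ifP => mQ /=; last by rewrite mul0e.
  rewrite patchE; case: asboolP => yQ; last by rewrite memNset// mule0.
  by rewrite mem_set// /f -EFinM mulrAC.
rewrite sumEFin lee_fin -big_mkcond/= -!mulr_suml ler_pdivrMr// mulrC ler_wpM2l//.
rewrite -big_filter; apply: (hC y); [exact: filter_uniq|exact: powR_ge0|].
move=> Q; rewrite mem_filter => /andP[/andP[mQ /asboolP yQ] _].
split; first exact: (far _ mQ yQ).2.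
have s0 := side_gt0 (R := R) Q; have := side_le _ mQ => hs.
rewrite ge0_ler_powR ?nnegrE ?(ltW s0) ?(ltW r0) ?subr_ge0 ?(ltW dn)//; lra.
Qed.

(** [ball_avg] integrates off Gamma but divides by the volume of the whole ball; this makes it a
    genuine average. *)
Lemma lebesgue_eball_setC x r :
  leb (eball x r `&` ~` Gamma) = leb (eball x r).
Proof.
apply/eqP; rewrite eq_le; apply/andP; split; first by apply: le_outer_measure => y [].
have null : lebesgue (Gamma `&` eball x r) = 0%E.
  apply: (lebesgue_hausdorff0 d0 dn).
  apply: le_lt_trans (ahlfors_bounded aG x r).
  by apply: le_hausdorff => y [Gy /eball_sub_ball].
apply: (@le_trans _ _ (lebesgue (eball x r `&` ~` Gamma) + lebesgue (Gamma `&` eball x r))%E).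
  rewrite -[X in (X <= _)%E](_ : lebesgue ((eball x r `&` ~` Gamma) `|` (Gamma `&` eball x r)) = _).
    exact: outer_measureU2.
  by congr lebesgue; rewrite (setIC Gamma) -setIUr setUC setUv setIT.
by rewrite null adde0.
Qed.

Lemma lebesgue_point_trace g x : L1loc (@hausdorff R n d) Gamma g -> Gamma x ->
  lebesgue_point d Gamma g x ->
  trace_exists Gamma (extension d Gamma phi xi g) x /\
  trace Gamma (extension d Gamma phi xi g) x = g x.
Proof.
move=> Lg Gx Lx; set E := extension d Gamma phi xi g.
have [C C0 hC] := extension_dist_integral_le.
pose K := 70 * nu; have K0 : 0 < K by rewrite mulr_gt0.
pose a : R := 2 / n.+1%:R; have a0 : 0 < a by rewrite divr_gt0.
have oD r : open (eball x r `&` ~` Gamma).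
  by apply: openI; [exact: open_eball|exact: closed_openC].
have mD r : measurable (eball x r `&` ~` Gamma : set lebT) by exact: lebesgue_measurable_open.
have Doo r : (leb (eball x r `&` ~` Gamma) < +oo)%E.
  by apply: (@lebesgue_bounded R n _ x r) => y [/eball_sub_ball].
have Dge r : 0 < r -> (((a * r) ^+ n)%:E <= leb (eball x r `&` ~` Gamma))%E.
  by move=> r0; rewrite lebesgue_eball_setC; exact: lebesgue_eball_ge.
have mE r : measurable_fun (eball x r `&` ~` Gamma : set lebT) E.
  apply: open_continuous_leb_measurable => // y [_ Gy].
  exact: (glue_C1 n0 G0 cG hphi _ Gy).1.
have small (e : R) : 0 < e -> exists2 r0 : R, 0 < r0 & forall r, 0 < r -> r < r0 ->
    (\int[leb]_(z in eball x r `&` ~` Gamma) `|E z - g x|%:E <= (e * (a * r) ^+ n)%:E)%E.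
  (* Chosen so that C K^d e' = e a^n, where (a r)^n bounds the volume of the ball from below; the
     powers of r combine as r^(n-d) r^d = r^n. *)
  move=> e0; pose e' := e * a ^+ n / (C * K `^ d).
  have e'0 : 0 < e' by rewrite divr_gt0 ?mulr_gt0 ?exprn_gt0 ?powR_gt0.
  have [r0 r00 hr] := Lx e' e'0; exists (r0 / K); first by rewrite divr_gt0.
  move=> r rp; rewrite ltr_pdivlMr// mulrC => rK.
  apply: le_trans (hC g Lg x r Gx rp) _.
  have Kr : 0 < K * r by rewrite mulr_gt0.
  apply: le_trans (lee_wpmul2l _ (hr _ Kr rK)) _.
    by rewrite lee_fin mulr_ge0 ?powR_ge0 ?(ltW C0).
  rewrite -EFinM lee_fin powRM ?(ltW K0) ?(ltW rp)//.
  have -> : C * r `^ (nu - d) * (e' * (K `^ d * r `^ d)) =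
      e * a ^+ n * (r `^ (nu - d) * r `^ d).
    by rewrite /e'; field; rewrite !gt_eqF ?powR_gt0.
  rewrite -powRD; last by rewrite (gt_eqF rp) implybT.
  by rewrite subrK powR_mulrn ?(ltW rp)// (exprMn n a) mulrA.
have Dpos r : 0 < r -> (0 < leb (eball x r `&` ~` Gamma))%E.
  by move=> r0; apply: lt_le_trans (Dge _ r0); rewrite lte_fin exprn_gt0// mulr_gt0.
(* Integrability near x comes from the same estimate: E differs from the constant g(x) by a function
   of finite integral. *)
have IE : exists2 r0 : R, 0 < r0 & forall r, 0 < r -> r < r0 ->
    leb.-integrable (eball x r `&` ~` Gamma) (EFin \o E).
  have [r0 r00 hr] := small 1 ltr01; exists r0 => // r rp rr0.
  have Ic := @integrable_cst_finite _ lebT R leb _ (mD r) (Doo r) (g x).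
  have Ie : leb.-integrable (eball x r `&` ~` Gamma) (EFin \o (fun z => E z - g x)).
    apply/integrableP; split.
      apply/measurable_EFinP.
      apply: (@measurable_funB _ lebT R _ E (cst (g x))) => //; exact: measurable_cst.
    by apply: le_lt_trans (hr _ rp rr0) _; rewrite ltry.
  have := integrableD (mD r) Ie Ic; apply: eq_integrable => // z _ /=.
  by rewrite -EFinD subrK.
have cv : ball_avg Gamma E x r @[r --> 0^'+] --> g x.
  apply/cvgrPdist_le => e e0; have [r1 r10 h1] := IE; have [r2 r20 h2] := small e e0.
  near=> r.
  have rp : 0 < r by near: r; exact: nbhs_right_gt.
  have rr1 : r < r1 by near: r; exact: nbhs_right_lt.
  have rr2 : r < r2 by near: r; exact: nbhs_right_lt.
  have := avg_dist_le (g x) (mD r) (Dpos _ rp) (Doo r) (h1 _ rp rr1).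
  have -> : avg leb (eball x r `&` ~` Gamma) E = ball_avg Gamma E x r.
    by rewrite /avg /ball_avg lebesgue_eball_setC.
  rewrite distrC -lee_fin => /le_trans; apply.
  have m0 : 0 < fine (leb (eball x r `&` ~` Gamma)).
    exact: fine_measure_gt0 (Dpos _ rp) (Doo r).
  rewrite lee_pdivrMl//; apply: le_trans (h2 _ rp rr2) _.
  rewrite -EFinM lee_fin [leRHS]mulrC ler_pM2l//.
  by rewrite -lee_fin fineK ?Dge// ge0_fin_numE// Doo.
split; last by apply: cvg_lim => //; exact: norm_hausdorff.
split; last by apply/cvg_ex; exists (g x).
have [r1 r10 h1] := IE; near=> r; apply: h1; near: r; first exact: nbhs_right_gt.
exact: nbhs_right_lt.
Unshelve. all: by end_near. Qed.

End Trace.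

Theorem theorem7p3 (R : realType) (n : nat) (hn : (2 <= n)%N)
    (d : R) (hd0 : 0 < d) (hdn : d < n%:R - 1)
    (Gamma : set 'rV[R]_n) (hGamma0 : Gamma !=set0) (hGammac : closed Gamma)
    (hGamma : ahlfors_regular d Gamma)
    (phi : dyadic -> 'rV[R]_n -> R) (hphi : whitney_partition Gamma phi)
    (xi : dyadic -> 'rV[R]_n) (hxi : whitney_points Gamma xi) :
  let E := extension d Gamma phi xi in
  (forall g : 'rV[R]_n -> R, L1loc (@hausdorff R n d) Gamma g ->
    {ae hausd n d, forall x, Gamma x ->
      trace_exists Gamma (E g) x /\ trace Gamma (E g) x = g x}) /\
  (forall g : 'rV[R]_n -> R, H_space d Gamma g ->
    L1loc (@hausdorff R n d) Gamma g) /\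
  (exists2 C : R, 0 < C & forall g : 'rV[R]_n -> R, H_space d Gamma g ->
    W_space d Gamma (E g) /\
    (W_norm d Gamma (E g) <= C%:E * H_norm d Gamma g)%E).
Proof.
have n0 : (0 < n)%N by exact: leq_trans hn.
move=> E; split; last split.
- move=> g Lg; have := ae_lebesgue_point hd0 hGammac hGamma Lg.
  apply: (@filterS _ _ (ae_filter_ringOfSetsType (hausd n d))) => x Lx Gx.
  apply: lebesgue_point_trace => //; last exact: Lx.
  by move: hdn; lra.
- by move=> g; exact: (H_space_L1loc hGamma0 hGammac hd0 hGamma).
- exact: (extension_bounded n0 hGamma0 hGammac hd0 hGamma hphi hxi hdn).
Qed.
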